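(* Let $F\in\mathcal B_{\log}^{n}$. Suppose that all tracts of $F$ are translates of one another by $2n\pi i$, $n\in\mathbb Z$, and that they have bounded slope, bounded wiggling and bounded gulfs. If $w_0'\in I(F)$, then there exists $k\in\mathbb N$ such that $w_0=F^k(w_0')$ can be connected to $\infty$ by a curve $\Gamma\subset I(F)$ such that (a) ${\rm Re}\,F^n\to\infty$ uniformly on $\Gamma$; (b) $\Gamma$ is a Devaney hair of $F$; (c) $\Gamma\setminus\{w_0\}\subset A(F)$.
   Context: Class $\mathcal B_{\log}$: a holomorphic map $F:\mathcal T\to H$ such that (1) $H$ is a $2\pi i$-periodic Jordan domain containing a right half-plane; (2) every component of $\mathcal T$ (a tract) is an unbounded Jordan domain with real parts bounded below but not above; (3) the tracts have disjoint closures and accumulate only at $\infty$; (4) $F$ maps each tract conformally onto $H$ (extending continuously to closures); (5) $\exp$ is injective on each tract; (6) $\mathcal T+2\pi i=\mathcal T$. $F\in\mathcal B_{\log}^{n}$ if moreover $H=\{{\rm Re}\,w>0\}$ and $|F'|\ge2$ on $\mathcal T$. $J(F)=\{w\in\overline{\mathcal T}:F^n(w)\in\overline{\mathcal T}\ \forall n\}$, $I(F)=\{w\in J(F):{\rm Re}\,F^n(w)\to\infty\}$; $M(r,F)=\max_{{\rm Re}\,w=r}{\rm Re}\,F(w)$; $A(F)=\{w\in J(F):\exists L,\ {\rm Re}\,F^{n+L}(w)\ge M^n(R,F)\ \forall n\in\mathbb N\}$ with $M^n$ the $n$-th iterate and $R$ so large that $M(r,F)>r$ for $r\ge R$. A Devaney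 hair of $F$ is a simple curve $\Gamma:[0,\infty)\to J(F)$ with $\Gamma((0,\infty))\subset I(F)$ such that for each $t>0$, ${\rm Re}\,F^n\to\infty$ uniformly on $\Gamma([t,\infty))$, and for each $n$, $F^n(\Gamma)$ is a simple curve connecting $F^n(\Gamma(0))$ to $\infty$. A tract $T$ has bounded slope (constants $\alpha,\beta>0$) if $|{\rm Im}\,w_1-{\rm Im}\,w_2|\le\alpha\max\{{\rm Re}\,w_1,{\rm Re}\,w_2,0\}+\beta$ for $w_1,w_2\in T$; bounded wiggling (constants $K'>1,\mu>0$) if for every $w_0\in\overline T$ every point $w$ of the hyperbolic geodesic of $T$ from $w_0$ to $\infty$ satisfies $({\rm Re}\,w)^+>\frac1{K'}{\rm Re}\,w_0-\mu$. For $\zeta\in\overline T$ and $a>{\rm Re}\,\zeta$, $L_{\zeta,a}$ denotes the unique component of $\{{\rm Re}\,w=a\}\cap T$ that separates $\zeta$ from $\infty$ in $T$ and can be joined to $\zeta$ by a path lying, apart from its endpoints, in $\{{\rm Re}\,w<a\}\cap T$. Let $p\in\partial T$ be the point with $F(p)=0$. $T$ has bounded gulfs with constant $C>1$ if $L_{\zeta,a}$ separates $p$ from $\infty$ for all $\zeta\in T$ and $a>0$ with ${\rm Re}\,\zeta\ge\max\{{\rm Re}\,p,1\}$ and $a\ge C\,{\rm Re}\,\zeta$. *)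

(* Defs.v *)
From Stdlib Require Import Reals ZArith.
Open Scope R_scope.

Definition Cplx := (R * R)%type.
Definition Re (z : Cplx) : R := fst z.
Definition Im (z : Cplx) : R := snd z.
Definition Cadd (z w : Cplx) : Cplx := (fst z + fst w, snd z + snd w).
Definition Csub (z w : Cplx) : Cplx := (fst z - fst w, snd z - snd w).
Definition Cmul (z w : Cplx) : Cplx :=
  (fst z * fst w - snd z * snd w, fst z * snd w + snd z * fst w).
Definition Cnorm (z : Cplx) : R := sqrt (fst z * fst z + snd z * snd z).
Definition Cexp (z : Cplx) : Cplx := (exp (fst z) * cos (snd z), exp (fst z) * sin (snd z)).
Definition RtoC (x : R) : Cplx := (x, 0).

Definition iterF (F : Cplx -> Cplx) (n : nat) (w : Cplx) : Cplx := Nat.iter n F w.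

Definition is_open (U : Cplx -> Prop) : Prop :=
  forall z, U z -> exists r, r > 0 /\ forall w, Cnorm (Csub w z) < r -> U w.
Definition closure (U : Cplx -> Prop) (z : Cplx) : Prop :=
  forall eps, eps > 0 -> exists w, U w /\ Cnorm (Csub w z) < eps.
Definition boundary (U : Cplx -> Prop) (z : Cplx) : Prop :=
  closure U z /\ closure (fun w => ~ U w) z.
Definition connected (S : Cplx -> Prop) : Prop :=
  ~ exists U V : Cplx -> Prop, is_open U /\ is_open V /\
      (forall z, S z -> U z \/ V z) /\
      (exists z, S z /\ U z) /\ (exists z, S z /\ V z) /\
      (forall z, S z -> U z -> V z -> False).
Definition continuous_on (S : Cplx -> Prop) (f : Cplx -> Cplx) : Prop :=
  forall z, S z -> forall eps, eps > 0 -> exists delta, delta > 0 /\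
    forall w, S w -> Cnorm (Csub w z) < delta -> Cnorm (Csub (f w) (f z)) < eps.

(* unbounded Jordan domain: open connected set whose boundary (in Cplx) is a
   Jordan curve through infinity, i.e. a proper injective continuous image of R *)
Definition unbounded_jordan_domain (T : Cplx -> Prop) : Prop :=
  is_open T /\ connected T /\
  exists g : R -> Cplx,
    (forall t eps, eps > 0 -> exists delta, delta > 0 /\
        forall s, Rabs (s - t) < delta -> Cnorm (Csub (g s) (g t)) < eps) /\
    (forall s t, g s = g t -> s = t) /\
    (forall M, exists N, forall t, Rabs t >= N -> Cnorm (g t) >= M) /\
    (forall z, boundary T z <-> exists t, g t = z).

Definition has_cderiv (f : Cplx -> Cplx) (z d : Cplx) : Prop :=
  forall eps, eps > 0 -> exists delta, delta > 0 /\
    forall h, 0 < Cnorm h < delta ->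
      Cnorm (Csub (Csub (f (Cadd z h)) (f z)) (Cmul d h)) <= eps * Cnorm h.
Definition holomorphic_on (U : Cplx -> Prop) (f : Cplx -> Cplx) : Prop :=
  forall z, U z -> exists d, has_cderiv f z d.

Definition tract (T0 : Cplx -> Prop) (n : Z) : Cplx -> Prop :=
  fun w => T0 (Csub w (0, 2 * PI * IZR n)).
(* closure of the union of the tracts (= union of closures, tracts being locally finite) *)
Definition clT (T0 : Cplx -> Prop) (w : Cplx) : Prop := exists n : Z, closure (tract T0 n) w.

Definition Blog_n_translates (T0 : Cplx -> Prop) (F : Cplx -> Cplx) : Prop :=
  unbounded_jordan_domain T0 /\
  (exists m, forall w, T0 w -> Re w >= m) /\
  (forall m, exists w, T0 w /\ Re w > m) /\
  (forall n m : Z, n <> m -> forall w,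
      closure (tract T0 n) w -> closure (tract T0 m) w -> False) /\
  (forall r, exists N : Z, forall n : Z, (Z.abs n > N)%Z ->
      forall w, tract T0 n w -> Cnorm w > r) /\
  (forall n : Z,
      holomorphic_on (tract T0 n) F /\
      (forall w1 w2, tract T0 n w1 -> tract T0 n w2 -> F w1 = F w2 -> w1 = w2) /\
      (forall w, tract T0 n w -> Re (F w) > 0) /\
      (forall u, Re u > 0 -> exists w, tract T0 n w /\ F w = u) /\
      continuous_on (closure (tract T0 n)) F) /\
  (forall n : Z, forall w1 w2, tract T0 n w1 -> tract T0 n w2 ->
      Cexp w1 = Cexp w2 -> w1 = w2) /\
  (forall n : Z, forall w d, tract T0 n w -> has_cderiv F w d -> Cnorm d >= 2).

Definition bounded_slope (T : Cplx -> Prop) : Prop :=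
  exists alpha beta, alpha > 0 /\ beta > 0 /\
    forall w1 w2, T w1 -> T w2 ->
      Rabs (Im w1 - Im w2) <= alpha * Rmax (Rmax (Re w1) (Re w2)) 0 + beta.

(* The hyperbolic geodesic of T from w0 (in the closure) to infinity is the
   preimage under the conformal map F : T -> {Re > 0} of the horizontal ray
   {F w0 + t : t >= 0}, which is the geodesic of the half-plane to infinity. *)
Definition on_geodesic_to_infty (T : Cplx -> Prop) (F : Cplx -> Cplx) (w0 w : Cplx) : Prop :=
  closure T w /\ exists t, t >= 0 /\ F w = Cadd (F w0) (RtoC t).

Definition bounded_wiggling (T : Cplx -> Prop) (F : Cplx -> Cplx) : Prop :=
  exists K' mu, K' > 1 /\ mu > 0 /\
    forall w0 w, closure T w0 -> on_geodesic_to_infty T F w0 w ->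
      Rmax (Re w) 0 > Re w0 / K' - mu.

Definition separates_from_infty (T L : Cplx -> Prop) (z : Cplx) : Prop :=
  forall g : R -> Cplx,
    (forall t, t >= 0 -> forall eps, eps > 0 -> exists delta, delta > 0 /\
        forall s, s >= 0 -> Rabs (s - t) < delta -> Cnorm (Csub (g s) (g t)) < eps) ->
    g 0 = z -> (forall t, t > 0 -> T (g t)) ->
    (forall M, exists S, forall s, s >= S -> Cnorm (g s) >= M) ->
    exists t, t >= 0 /\ L (g t).

Definition vline_component (T : Cplx -> Prop) (a y0 : R) : Cplx -> Prop :=
  fun w => Re w = a /\
    forall s, Rmin y0 (Im w) <= s <= Rmax y0 (Im w) -> T (a, s).

Definition joinable_left (T L : Cplx -> Prop) (a : R) (zeta : Cplx) : Prop :=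
  exists g : R -> Cplx,
    (forall t, 0 <= t <= 1 -> forall eps, eps > 0 -> exists delta, delta > 0 /\
        forall s, 0 <= s <= 1 -> Rabs (s - t) < delta -> Cnorm (Csub (g s) (g t)) < eps) /\
    g 0 = zeta /\ L (g 1) /\
    forall s, 0 < s < 1 -> T (g s) /\ Re (g s) < a.

Definition bounded_gulfs (T : Cplx -> Prop) (F : Cplx -> Cplx) : Prop :=
  exists Cc, Cc > 1 /\
    forall p, boundary T p -> F p = (0, 0) ->
    forall zeta a, T zeta -> a > 0 ->
      Re zeta >= Rmax (Re p) 1 -> a >= Cc * Re zeta ->
      forall y0, T (a, y0) ->
        separates_from_infty T (vline_component T a y0) zeta ->
        joinable_left T (vline_component T a y0) a zeta ->
        separates_from_infty T (vline_component T a y0) p.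

Definition inJ (T0 : Cplx -> Prop) (F : Cplx -> Cplx) (w : Cplx) : Prop :=
  forall n, clT T0 (iterF F n w).

Definition escaping (T0 : Cplx -> Prop) (F : Cplx -> Cplx) (w : Cplx) : Prop :=
  inJ T0 F w /\ forall K, exists N, forall n, (n >= N)%nat -> Re (iterF F n w) >= K.

Definition uniform_escape (F : Cplx -> Cplx) (S : Cplx -> Prop) : Prop :=
  forall K, exists N, forall n, (n >= N)%nat -> forall w, S w -> Re (iterF F n w) >= K.

Definition M_admissible (T0 : Cplx -> Prop) (F : Cplx -> Cplx) (Mf : R -> R) (Rr : R) : Prop :=
  forall r, r >= Rr ->
    is_lub (fun x => exists w, clT T0 w /\ Re w = r /\ x = Re (F w)) (Mf r) /\
    Mf r > r.

Definition fast_escaping (T0 : Cplx -> Prop) (F : Cplx -> Cplx) (Mf : R -> R) (Rr : R) (w : Cplx) : Prop :=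
  inJ T0 F w /\
  exists L : nat, forall n : nat, Re (iterF F (n + L) w) >= Nat.iter n Mf Rr.

Definition simple_curve_to_infty (g : R -> Cplx) : Prop :=
  (forall t, t >= 0 -> forall eps, eps > 0 -> exists delta, delta > 0 /\
      forall s, s >= 0 -> Rabs (s - t) < delta -> Cnorm (Csub (g s) (g t)) < eps) /\
  (forall s t, s >= 0 -> t >= 0 -> g s = g t -> s = t) /\
  (forall M, exists S, forall s, s >= S -> Cnorm (g s) >= M).

Definition devaney_hair (T0 : Cplx -> Prop) (F : Cplx -> Cplx) (g : R -> Cplx) : Prop :=
  (forall t, t >= 0 -> inJ T0 F (g t)) /\
  (forall t, t > 0 -> escaping T0 F (g t)) /\
  (forall t, t > 0 -> uniform_escape F (fun w => exists s, s >= t /\ w = g s)) /\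
  (forall n : nat, simple_curve_to_infty (fun s => iterF F n (g s))).

(* Main.v *)
(* Inverse branches G of F on the tracts are conformal on the half-plane Re > 0 with |G'| <= 1/2, so
   they extend to its closure, and Bloch's theorem gives |G'(u)| <= const / Re u: G is Lipschitz from
   the hyperbolic to the Euclidean metric.

   Along the orbit z_k of a point of I(F), join z_k to infinity by the geodesic of its tract.  Bounded
   slope and wiggling let the geodesic of step k be reparametrized so that F maps it to within bounded
   distance of the geodesic of step k + 1, while the hyperbolic parameter at least doubles.  The curves
   obtained by pulling back along the orbit converge, and parameter doubling makes the limit, the hair,
   injective.

   For fast escape, bounded gulfs give a cut L_{zeta,a} with a = C Re zeta that meets the geodesics
   from p and from zeta; hence every G(iy) with y between 0 and Im F(zeta) has real part O(Re zeta).  A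
   harmonic comparison on half-discs turns this boundary bound into the expansion estimate
   |F(w)| >= Lambda |F(zeta)| for Re w >= B Re zeta.  It passes to all tracts because two conformal
   maps of translated tracts onto the half-plane differ by a similarity, with constants absorbed by
   the exponential growth of M. *)
From Stdlib Require Import Reals Ranalysis5 Lra Lia Psatz ZArith Classical ClassicalEpsilon.
From Coquelicot Require Import Coquelicot.
Require Import Defs.
Open Scope R_scope.
(* [Defs.RtoC] has type [R -> Cplx]; the coercion of Coquelicot is wanted here. *)
Notation RtoC := Coquelicot.Complex.RtoC.

(** * Complex derivatives *)

(** No relation between F(w) and F(w + 2 pi i) is assumed, and the wiggling and gulf conditions come
    with constants that may depend on the tract. An orbit may visit infinitely many tracts, so
    uniformity has to be produced. A similarity of the half-plane maps horizontal rays to horizontal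
    rays, so the geodesics of one tract are translates of those of another, and the wiggling
    constants of a single tract serve for all. The gulf condition refers to the zero of F, which the
    similarity need not carry along; therefore the expansion estimate is proved in one tract, and
    what moves between tracts is its conclusion, a comparison of moduli of F. Since F is itself a
    Riemann map of each tract, hyperbolic distances and geodesics are explicit formulas in the
    half-plane. The second obstacle is plane topology: that a vertical cut separates a point from
    infinity is usually read off the Jordan curve theorem. Here the parity of crossings of the image
    of the cut is recorded by a Z/2-valued function on rectangles of the half-plane, where its
    existence is a gluing argument. *)

Definition Cplx_field_theory :
  @field_theory Cplx (RtoC 0) (RtoC 1) Cplus Cmult Cminus Copp Cdiv Cinv eq := C_field_theory.
Add Field Cplx_field : Cplx_field_theory.

(** [ring] and [field] look up the structure by the syntactic form of the carrier, which in goals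
    may be [C], [Cplx] or [R * R]; each form gets a registration. *)
Definition RR_field_theory :
  @field_theory (R * R) (RtoC 0) (RtoC 1) Cplus Cmult Cminus Copp Cdiv Cinv eq := C_field_theory.
Add Field RR_field : RR_field_theory.

Lemma Rlt_Rmin {a b c : R} : a < Rmin b c -> a < b /\ a < c.
Proof. assert (h1 := Rmin_l b c). assert (h2 := Rmin_r b c). lra. Qed.

Lemma Rlt_Rmin_l {a b c : R} : a < Rmin b c -> a < b.
Proof. apply Rlt_Rmin. Qed.

Lemma Rlt_Rmin_r {a b c : R} : a < Rmin b c -> a < c.
Proof. apply Rlt_Rmin. Qed.

Lemma Cnorm_Cmod (z : C) : Cnorm z = Cmod z.
Proof. unfold Cnorm, Cmod. f_equal. simpl. ring. Qed.

Lemma Cmod_sym (z w : C) : Cmod (z - w) = Cmod (w - z).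
Proof. replace (z - w)%C with (- (w - z))%C by ring. apply Cmod_opp. Qed.

Lemma Cmod_triangle3 (x y z : C) : Cmod (x - z) <= Cmod (x - y) + Cmod (y - z).
Proof. replace (x - z)%C with ((x - y) + (y - z))%C by ring. apply Cmod_triangle. Qed.

Lemma Cmod_sub_le (x y : C) : Cmod x - Cmod y <= Cmod (x - y).
Proof.
  assert (H := Cmod_triangle (x - y) y).
  replace (x - y + y)%C with x in H by ring. lra.
Qed.

Lemma Cmod_le_add (x y : C) : Cmod (x - y) <= Cmod x + Cmod y.
Proof. unfold Cminus. rewrite <- (Cmod_opp y). apply Cmod_triangle. Qed.

Lemma Cmod_self (z : C) : Cmod (z - z) = 0.
Proof. replace (z - z)%C with (RtoC 0) by ring. apply Cmod_0. Qed.

Lemma Cmod_sub_eq_0 (z w : C) : Cmod (z - w) = 0 -> z = w.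
Proof.
  intros H. apply Cmod_eq_0 in H.
  replace z with ((z - w) + w)%C by ring. rewrite H. ring.
Qed.

Lemma Cmod_small_eq (z w : C) : (forall eps, 0 < eps -> Cmod (z - w) <= eps) -> z = w.
Proof.
  intros H. apply Cmod_sub_eq_0.
  destruct (Rle_lt_or_eq_dec _ _ (Cmod_ge_0 (z - w))) as [h|h]; auto.
  specialize (H (Cmod (z - w) / 2)). lra.
Qed.

Lemma Cmod_fst_le (z : C) : Rabs (fst z) <= Cmod z.
Proof. eapply Rle_trans; [apply Rmax_l | apply Rmax_Cmod]. Qed.

Lemma Cmod_snd_le (z : C) : Rabs (snd z) <= Cmod z.
Proof. eapply Rle_trans; [apply Rmax_r | apply Rmax_Cmod]. Qed.

Lemma Cmod_sq (z : C) : Cmod z * Cmod z = fst z * fst z + snd z * snd z.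
Proof.
  unfold Cmod. rewrite sqrt_sqrt; simpl; nra.
Qed.

Lemma Cmod_le_fst_snd (z : C) : Cmod z <= Rabs (fst z) + Rabs (snd z).
Proof.
  assert (H := Cmod_sq z).
  assert (h1 := Rabs_pos (fst z)). assert (h2 := Rabs_pos (snd z)).
  assert (e1 : fst z * fst z = Rabs (fst z) * Rabs (fst z)) by (rewrite <- Rabs_mult; symmetry; apply Rabs_right; nra).
  assert (e2 : snd z * snd z = Rabs (snd z) * Rabs (snd z)) by (rewrite <- Rabs_mult; symmetry; apply Rabs_right; nra).
  nra.
Qed.

Lemma Re_sub_le (z w : C) : Re z - Re w <= Cmod (z - w).
Proof.
  assert (H := Cmod_fst_le (z - w)). simpl in H. unfold Re.
  assert (H1 := Rle_abs (fst z + - fst w)). lra.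
Qed.

Lemma Rabs_Re_sub_le (z w : C) : Rabs (Re z - Re w) <= Cmod (z - w).
Proof. apply (Cmod_fst_le (z - w)). Qed.

Lemma Rabs_Im_sub_le (z w : C) : Rabs (Im z - Im w) <= Cmod (z - w).
Proof. apply (Cmod_snd_le (z - w)). Qed.

(** Rotating a value onto the positive axis transfers statements about real parts, such as the real
    mean value theorem and [circle_max], to moduli of complex functions. *)
Lemma unimodular_align (z : C) : exists c : C, Cmod c = 1 /\ Re (c * z)%C = Cmod z.
Proof.
  destruct (Req_dec (Cmod z) 0) as [h|h].
  - exists (RtoC 1). rewrite Cmod_1. apply Cmod_eq_0 in h. subst z. rewrite Cmod_0.
    split; [|unfold Re; simpl]; ring.
  -
    exists (Cconj z / RtoC (Cmod z))%C.
    assert (hn : RtoC (Cmod z) <> 0) by (intros e; apply h; injection e; auto).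
    assert (e : (Cconj z / RtoC (Cmod z) * z)%C = RtoC (Cmod z)).
    { replace (Cconj z / RtoC (Cmod z) * z)%C with ((z * Cconj z) / RtoC (Cmod z))%C by (field; auto).
      rewrite <- Cmod2_conj. rewrite RtoC_pow. simpl. field; auto. }
    repeat split; auto.
    + rewrite Cmod_div by auto. rewrite Cmod_conj, Cmod_R, Rabs_right; [field; auto | apply Rle_ge, Cmod_ge_0].
    + rewrite e. reflexivity.
Qed.

Lemma Cmult_ne_0 (z w : C) : z <> 0 -> w <> 0 -> (z * w)%C <> 0.
Proof.
  intros hz hw. apply Cmod_gt_0 in hz. apply Cmod_gt_0 in hw. apply Cmod_gt_0.
  rewrite Cmod_mult. nra.
Qed.

Definition ccont (f : C -> C) (z : C) : Prop :=
  forall eps, 0 < eps -> exists del, 0 < del /\ forall w : C, Cmod (w - z) < del -> Cmod (f w - f z) < eps.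

Definition cder (f : C -> C) (z d : C) : Prop :=
  forall eps, 0 < eps -> exists del, 0 < del /\ forall w : C, Cmod (w - z) < del ->
    Cmod (f w - f z - d * (w - z)) <= eps * Cmod (w - z).

Lemma has_cderiv_cder (f : C -> C) (z d : C) : has_cderiv f z d <-> cder f z d.
Proof.
  split; intros H eps He; destruct (H eps He) as [del [Hd H1]]; exists del; split; auto.
  - intros w Hw. destruct (Req_dec (Cmod (w - z)) 0) as [h|h].
    + rewrite h. apply Cmod_sub_eq_0 in h. subst w.
      replace (f z - f z - d * (z - z))%C with (RtoC 0) by ring. rewrite Cmod_0. lra.
    + specialize (H1 (w - z)%C). rewrite !Cnorm_Cmod in H1.
      assert (h2 := Cmod_ge_0 (w - z)).
      assert (h3 : 0 < Cmod (w - z) < del) by lra. specialize (H1 h3).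
      change (Cmod (f (z + (w - z))%C - f z - d * (w - z)) <= eps * Cmod (w - z)) in H1.
      replace (z + (w - z))%C with w in H1 by ring. exact H1.
  - intros h Hh. rewrite Cnorm_Cmod in Hh. rewrite !Cnorm_Cmod.
    specialize (H1 (z + h)%C). replace (z + h - z)%C with h in H1 by ring. apply H1. lra.
Qed.

Lemma ccont_const (c z : C) : ccont (fun _ => c) z.
Proof. intros e He. exists 1. split; [lra|]. intros. rewrite Cmod_self. auto. Qed.

Lemma ccont_id (z : C) : ccont (fun w => w) z.
Proof. intros e He. exists e. auto. Qed.

Lemma ccont_ext_loc (f g : C -> C) (z : C) (r : R) :
  0 < r -> (forall w : C, Cmod (w - z) < r -> f w = g w) -> ccont f z -> ccont g z.
Proof.
  intros Hr E H e He. destruct (H e He) as [d [Hd H1]].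
  exists (Rmin d r). split; [apply Rmin_glb_lt; auto|].
  intros w Hw. rewrite <- !E.
  - apply H1. exact (Rlt_Rmin_l Hw).
  - rewrite Cmod_self; auto.
  - exact (Rlt_Rmin_r Hw).
Qed.

Lemma ccont_comp (f g : C -> C) (z : C) : ccont g z -> ccont f (g z) -> ccont (fun w => f (g w)) z.
Proof.
  intros Hg Hf e He. destruct (Hf e He) as [d [Hd H1]]. destruct (Hg d Hd) as [d' [Hd' H2]].
  exists d'. split; auto.
Qed.

Lemma ccont_plus (f g : C -> C) (z : C) : ccont f z -> ccont g z -> ccont (fun w => f w + g w)%C z.
Proof.
  intros Hf Hg e He. destruct (Hf (e/2)) as [d [Hd H1]]; [lra|]. destruct (Hg (e/2)) as [d' [Hd' H2]]; [lra|].
  exists (Rmin d d'). split; [apply Rmin_glb_lt; auto|]. intros w Hw.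
  specialize (H1 w (Rlt_Rmin_l Hw)). specialize (H2 w (Rlt_Rmin_r Hw)).
  replace (f w + g w - (f z + g z))%C with ((f w - f z) + (g w - g z))%C by ring.
  assert (h := Cmod_triangle (f w - f z) (g w - g z)). lra.
Qed.

Lemma ccont_mult (f g : C -> C) (z : C) : ccont f z -> ccont g z -> ccont (fun w => f w * g w)%C z.
Proof.
  intros Hf Hg e He.
  set (A := Cmod (f z) + Cmod (g z) + 1).
  assert (HA : 1 <= A) by (unfold A; assert (h := Cmod_ge_0 (f z)); assert (h' := Cmod_ge_0 (g z)); lra).
  assert (hp : 0 < Rmin 1 (e / (2 * A))).
  { apply Rmin_glb_lt; [lra|]. apply Rdiv_lt_0_compat; lra. }
  destruct (Hf _ hp) as [d [Hd H1]]. destruct (Hg _ hp) as [d' [Hd' H2]].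
  exists (Rmin d d'). split; [apply Rmin_glb_lt; auto|]. intros w Hw.
  specialize (H1 w (Rlt_Rmin_l Hw)). specialize (H2 w (Rlt_Rmin_r Hw)).
  replace (f w * g w - (f z * g z))%C with ((f w - f z) * g w + f z * (g w - g z))%C by ring.
  assert (h := Cmod_triangle ((f w - f z) * g w) (f z * (g w - g z))). rewrite !Cmod_mult in h.
  assert (hg : Cmod (g w) <= Cmod (g z) + 1).
  { assert (hh := Cmod_sub_le (g w) (g z)). assert (h3 := Rmin_l 1 (e/(2*A))). lra. }
  assert (q : Rmin 1 (e/(2*A)) * A <= e / 2).
  { apply Rle_trans with (e/(2*A) * A). apply Rmult_le_compat_r; [lra|apply Rmin_r]. right. field. lra. }
  assert (a1 := Cmod_ge_0 (f w - f z)).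
  assert (a3 := Cmod_ge_0 (f z)). assert (a4 := Cmod_ge_0 (g w)).
  set (m := Rmin 1 (e/(2*A))) in *.
  assert (Cmod (f w - f z) * Cmod (g w) <= m * (Cmod (g z) + 1)) by (apply Rmult_le_compat; lra).
  assert (Cmod (f z) * Cmod (g w - g z) <= Cmod (f z) * m) by (apply Rmult_le_compat_l; lra).
  assert (m * (Cmod (g z) + 1) + Cmod (f z) * m = m * A) by (unfold A; ring). lra.
Qed.

Lemma ccont_inv (z : C) : z <> 0 -> ccont Cinv z.
Proof.
  intros Hz e He. assert (hz : 0 < Cmod z) by (apply Cmod_gt_0; auto).
  set (m := Cmod z) in *.
  exists (Rmin (m / 2) (e * (m * m) / 2)). split.
  { apply Rmin_glb_lt; [lra|]. assert (0 < m * m) by nra. nra. }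
  intros w Hw.
  destruct (Rlt_Rmin Hw) as [w1 w2].
  assert (hw : m / 2 < Cmod w). { assert (h := Cmod_sub_le z w). rewrite Cmod_sym in h. unfold m in *. lra. }
  assert (w <> 0). { apply Cmod_gt_0. lra. }
  replace (/ w - / z)%C with ((z - w) / (w * z))%C by (field; split; auto).
  rewrite Cmod_div by (apply Cmult_ne_0; auto). rewrite Cmod_mult, (Cmod_sym z w). fold m.
  apply Rmult_lt_reg_r with (Cmod w * m); [nra|].
  unfold Rdiv. rewrite Rmult_assoc, Rinv_l by nra. rewrite Rmult_1_r.
  assert (m / 2 * m < Cmod w * m) by nra.
  assert (e * (m/2*m) < e * (Cmod w * m)) by nra. lra.
Qed.

(** Caratheodory's form of the derivative: differentiability at [z] is continuity at [z] of the
    difference quotient filled in by [d], which reduces the rules of differentiation to algebra of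
    continuous functions. The same function later plays the part of a removable singularity: the
    maximum principles below ask for differentiability only off the centre and continuity at it. *)
Definition slope (f : C -> C) (z d : C) (w : C) : C :=
  if excluded_middle_informative (w = z) then d else ((f w - f z) / (w - z))%C.

Lemma slope_at (f : C -> C) (z d : C) : slope f z d z = d.
Proof. unfold slope. destruct (excluded_middle_informative (z = z)); tauto. Qed.

Lemma slope_ne (f : C -> C) (z d w : C) : w <> z -> slope f z d w = ((f w - f z) / (w - z))%C.
Proof. unfold slope. destruct (excluded_middle_informative (w = z)); tauto. Qed.

Lemma Csub_ne (w z : C) : w <> z -> (w - z)%C <> 0.
Proof. intros h e. apply h. replace w with ((w - z) + z)%C by ring. rewrite e. ring. Qed.

Lemma slope_eq (f : C -> C) (z d w : C) : (f w - f z)%C = (slope f z d w * (w - z))%C.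
Proof.
  unfold slope. destruct (excluded_middle_informative (w = z)) as [->|n]; [ring|].
  apply Csub_ne in n. field. auto.
Qed.

Lemma slope_ccont (f : C -> C) (z d : C) : cder f z d -> ccont (slope f z d) z.
Proof.
  intros H e He. destruct (H (e/2)) as [del [Hd H1]]; [lra|]. exists del. split; auto.
  intros w Hw. rewrite slope_at.
  destruct (excluded_middle_informative (w = z)) as [->|n].
  - rewrite slope_at, Cmod_self. auto.
  - rewrite slope_ne by auto. specialize (H1 w Hw).
    assert (n' := Csub_ne _ _ n). assert (hp : 0 < Cmod (w - z)) by (apply Cmod_gt_0; auto).
    replace ((f w - f z) / (w - z) - d)%C with ((f w - f z - d * (w - z)) / (w - z))%C by (field; auto).
    rewrite Cmod_div by auto.
    apply Rle_lt_trans with (e / 2); [|lra].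
    apply Rmult_le_reg_r with (Cmod (w - z)); auto. unfold Rdiv at 1. rewrite Rmult_assoc, Rinv_l by lra. lra.
Qed.

Lemma cder_of_slope (f phi : C -> C) (z : C) (r : R) : 0 < r ->
  (forall w : C, Cmod (w - z) < r -> (f w - f z)%C = (phi w * (w - z))%C) -> ccont phi z -> cder f z (phi z).
Proof.
  intros Hr E H e He. destruct (H e He) as [d [Hd H1]].
  exists (Rmin d r). split; [apply Rmin_glb_lt; auto|]. intros w Hw.
  rewrite E by exact (Rlt_Rmin_r Hw).
  replace (phi w * (w - z) - phi z * (w - z))%C with ((phi w - phi z) * (w - z))%C by ring.
  rewrite Cmod_mult. apply Rmult_le_compat_r; [apply Cmod_ge_0|].
  left. apply H1. exact (Rlt_Rmin_l Hw).
Qed.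

Lemma cder_ccont (f : C -> C) (z d : C) : cder f z d -> ccont f z.
Proof.
  intros H. assert (h := slope_ccont _ _ _ H).
  apply ccont_ext_loc with (f := fun w => (f z + slope f z d w * (w - z))%C) (r := 1); [lra| |].
  - intros w _. rewrite <- slope_eq. ring.
  - apply ccont_plus; [apply ccont_const|]. apply ccont_mult; auto.
    apply ccont_plus; [apply ccont_id|]. apply ccont_const.
Qed.

Lemma cder_const (c z : C) : cder (fun _ => c) z 0.
Proof.
  apply (cder_of_slope (fun _ => c) (fun _ => RtoC 0) z 1); [lra| |apply ccont_const]. intros; ring.
Qed.

Lemma cder_id (z : C) : cder (fun w => w) z 1.
Proof.
  apply (cder_of_slope (fun w => w) (fun _ => RtoC 1) z 1); [lra| |apply ccont_const]. intros; ring.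
Qed.

Lemma cder_eq (f : C -> C) (z d d' : C) : cder f z d -> d = d' -> cder f z d'.
Proof. intros H <-. exact H. Qed.

Lemma cder_ext_loc (f g : C -> C) (z d : C) (r : R) :
  0 < r -> (forall w : C, Cmod (w - z) < r -> f w = g w) -> cder f z d -> cder g z d.
Proof.
  intros Hr E H e He. destruct (H e He) as [d' [Hd H1]].
  exists (Rmin d' r). split; [apply Rmin_glb_lt; auto|].
  intros w Hw. rewrite <- !E.
  - apply H1. exact (Rlt_Rmin_l Hw).
  - rewrite Cmod_self; auto.
  - exact (Rlt_Rmin_r Hw).
Qed.

Lemma cder_plus (f g : C -> C) (z a b : C) : cder f z a -> cder g z b -> cder (fun w => f w + g w)%C z (a + b).
Proof.
  intros Hf Hg.
  assert (hf := slope_ccont _ _ _ Hf). assert (hg := slope_ccont _ _ _ Hg).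
  eapply cder_eq. apply (cder_of_slope _ (fun w => slope f z a w + slope g z b w)%C z 1); [lra| |].
  - intros w _. replace (f w + g w - (f z + g z))%C with ((f w - f z) + (g w - g z))%C by ring.
    rewrite (slope_eq f z a w), (slope_eq g z b w). ring.
  - apply ccont_plus; auto.
  - simpl. rewrite !slope_at. ring.
Qed.

Lemma cder_mult (f g : C -> C) (z a b : C) :
  cder f z a -> cder g z b -> cder (fun w => f w * g w)%C z (a * g z + f z * b).
Proof.
  intros Hf Hg.
  assert (hf := slope_ccont _ _ _ Hf). assert (hg := slope_ccont _ _ _ Hg).
  eapply cder_eq. apply (cder_of_slope _ (fun w => slope f z a w * g w + f z * slope g z b w)%C z 1); [lra| |].
  - intros w _. replace (f w * g w - (f z * g z))%C with ((f w - f z) * g w + f z * (g w - g z))%C by ring.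
    rewrite (slope_eq f z a w), (slope_eq g z b w). ring.
  - apply ccont_plus; apply ccont_mult; auto using ccont_const. eapply cder_ccont; eauto.
  - simpl. rewrite !slope_at. ring.
Qed.

Lemma cder_comp (f g : C -> C) (z a b : C) :
  cder g z b -> cder f (g z) a -> cder (fun w => f (g w)) z (a * b).
Proof.
  intros Hg Hf.
  assert (hf := slope_ccont _ _ _ Hf). assert (hg := slope_ccont _ _ _ Hg).
  eapply cder_eq. apply (cder_of_slope _ (fun w => slope f (g z) a (g w) * slope g z b w)%C z 1); [lra| |].
  - intros w _. rewrite (slope_eq f (g z) a (g w)), (slope_eq g z b w). ring.
  - apply ccont_mult; auto. apply (ccont_comp (slope f (g z) a) g); auto. eapply cder_ccont; eauto.
  - simpl. rewrite !slope_at. ring.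
Qed.

Lemma cder_inv (z : C) : z <> 0 -> cder Cinv z (- / (z * z))%C.
Proof.
  intros Hz. assert (hz : 0 < Cmod z) by (apply Cmod_gt_0; auto).
  eapply cder_eq. apply (cder_of_slope _ (fun w => - (/ w * / z))%C z (Cmod z)); auto.
  - intros w Hw. assert (w <> 0). { intros ->. rewrite Cmod_sym in Hw. replace (z - 0)%C with z in Hw by ring. lra. }
    field. split; auto.
  - apply ccont_ext_loc with (f := fun w => ((- / z) * / w)%C) (r := 1); [lra|intros; ring|].
    apply ccont_mult; [apply ccont_const|]. apply ccont_inv; auto.
  - simpl. field. auto.
Qed.

Lemma cder_minus (f g : C -> C) (z a b : C) : cder f z a -> cder g z b -> cder (fun w => f w - g w)%C z (a - b).
Proof.
  intros Hf Hg. unfold Cminus. apply cder_plus; auto.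
  apply cder_ext_loc with (f := fun w => ((-(1)) * g w)%C) (r := 1); [lra|intros; ring|].
  apply cder_eq with (0 * g z + (-(1)) * b)%C; [|ring]. apply (cder_mult (fun _ => (-(1))%C) g); [apply cder_const|apply Hg].
Qed.

Lemma cder_scal (c : C) (f : C -> C) (z a : C) : cder f z a -> cder (fun w => c * f w)%C z (c * a).
Proof.
  intros H. apply cder_eq with (0 * f z + c * a)%C; [|ring]. apply (cder_mult (fun _ => c) f); [apply cder_const|apply H].
Qed.

Lemma cder_div (f g : C -> C) (z a b : C) : cder f z a -> cder g z b -> g z <> 0 ->
  exists d, cder (fun w => f w / g w)%C z d.
Proof.
  intros Hf Hg Hz. eexists. unfold Cdiv. apply cder_mult. apply Hf.
  apply (cder_comp Cinv g). apply Hg. apply cder_inv; auto.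
Qed.

Lemma cder_pow (f : C -> C) (z a : C) (n : nat) : cder f z a -> exists d, cder (fun w => Cpow (f w) n) z d.
Proof.
  intros H. induction n as [|n [d IH]].
  - exists 0. simpl. apply cder_const.
  - eexists. simpl. apply cder_mult; eauto.
Qed.

Lemma slope_cder (f : C -> C) (z d w e : C) : w <> z -> cder f w e -> exists e', cder (slope f z d) w e'.
Proof.
  intros n H. assert (hp : 0 < Cmod (w - z)) by (apply Cmod_gt_0, Csub_ne; auto).
  assert (Hid : cder (fun v => v - z)%C w (1 - 0)) by (apply cder_minus; [apply cder_id|apply cder_const]).
  assert (Hf : cder (fun v => f v - f z)%C w (e - 0)) by (apply cder_minus; [apply H|apply cder_const]).
  destruct (cder_div _ _ _ _ _ Hf Hid) as [e' He']; [apply Csub_ne; auto|].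
  exists e'. eapply cder_ext_loc; [apply hp| |apply He'].
  intros v Hv. simpl. symmetry. apply slope_ne. intros ->. rewrite Cmod_sym in Hv. lra.
Qed.

(** * Induction on real intervals, Cousin's lemma and compactness *)

Lemma real_induction (P : R -> Prop) (a b : R) : a <= b -> P a ->
  (forall t, a <= t < b -> (forall s, a <= s <= t -> P s) ->
     exists d, 0 < d /\ forall s, t < s < t + d -> s <= b -> P s) ->
  (forall t, a < t <= b -> (forall s, a <= s < t -> P s) -> P t) ->
  forall t, a <= t <= b -> P t.
Proof.
  intros Hab Ha Hr Hl.
  set (E := fun t => a <= t <= b /\ forall s, a <= s <= t -> P s).
  destruct (completeness E) as [m [Hm1 Hm2]].
  { exists b. intros x [h _]. lra. }
  { exists a. split; [lra|]. intros s Hs. replace s with a by lra. auto. }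
  assert (Hma : a <= m). { apply Hm1. split; [lra|]. intros s Hs. replace s with a by lra. auto. }
  assert (Hmb : m <= b). { apply Hm2. intros x [h _]. lra. }
  assert (Hbelow : forall s, a <= s < m -> P s).
  { intros s Hs. apply NNPP. intros n. assert (h : m <= s); [|lra].
    apply Hm2. intros x [Hx1 Hx2]. apply Rnot_lt_le. intros hl. apply n. apply Hx2. lra. }
  assert (HPm : P m).
  { destruct (Req_dec a m) as [<-|]; auto. apply Hl; auto. lra. }
  assert (Hall : forall s, a <= s <= m -> P s).
  { intros s Hs. destruct (Req_dec s m) as [->|]; auto. apply Hbelow. lra. }
  assert (m = b).
  { apply NNPP. intros n. destruct (Hr m) as [d [Hd H]]; [lra|auto|].
    set (m' := Rmin b (m + d / 2)).
    assert (m < m') by (apply Rmin_glb_lt; lra).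
    assert (m' <= b) by apply Rmin_l. assert (m' <= m + d / 2) by apply Rmin_r.
    assert (m' <= m); [|lra]. apply Hm1. split; [lra|]. intros s Hs.
    destruct (Rle_lt_dec s m); [apply Hall; lra|]. apply H; lra. }
  subst m. auto.
Qed.

Lemma locally_constant (A : Type) (f : R -> A) (a b : R) : a <= b ->
  (forall t, a <= t <= b -> exists d, 0 < d /\ forall s, a <= s <= b -> Rabs (s - t) < d -> f s = f t) ->
  forall t, a <= t <= b -> f t = f a.
Proof.
  intros Hab H. apply real_induction; auto.
  - intros t Ht IH. destruct (H t) as [d [Hd H1]]; [lra|]. exists d. split; auto.
    intros s Hs Hsb. rewrite H1; [apply IH; lra|lra|]. rewrite Rabs_right; lra.
  - intros t Ht IH. destruct (H t) as [d [Hd H1]]; [lra|].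
    set (s := Rmax a (t - d / 2)).
    assert (s < t) by (apply Rmax_lub_lt; lra).
    assert (a <= s) by apply Rmax_l. assert (t - d / 2 <= s) by apply Rmax_r.
    rewrite <- (H1 s); [apply IH; lra|lra|]. rewrite Rabs_left; lra.
Qed.

(* Cousin's lemma for the rectangles [x, x + a h] x [y, y + b h] of fixed shape. *)
Lemma cousin (a b : R) (P : R -> R -> R -> Prop) (X Y H : R) : 0 < a -> 0 < b -> 0 < H ->
  (forall x y h, 0 < h -> X <= x -> x + a * h <= X + a * H -> Y <= y -> y + b * h <= Y + b * H ->
     P x y (h / 2) -> P (x + a * (h / 2)) y (h / 2) -> P x (y + b * (h / 2)) (h / 2) ->
     P (x + a * (h / 2)) (y + b * (h / 2)) (h / 2) -> P x y h) ->
  (forall x0 y0, X <= x0 <= X + a * H -> Y <= y0 <= Y + b * H -> exists d, 0 < d /\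
     forall x y h, 0 < h < d -> X <= x -> x + a * h <= X + a * H -> Y <= y -> y + b * h <= Y + b * H ->
       x <= x0 <= x + a * h -> y <= y0 <= y + b * h -> P x y h) ->
  P X Y H.
Proof.
  intros Ha Hb HH Hsplit Hloc. apply NNPP. intros Hn.
  set (good := fun q : R * R * R => let '(x, y, h) := q in
         0 < h /\ X <= x /\ x + a * h <= X + a * H /\ Y <= y /\ y + b * h <= Y + b * H /\ ~ P x y h).
  set (next := fun q q' : R * R * R => let '(x, y, h) := q in let '(x', y', h') := q' in
         h' = h / 2 /\ x <= x' /\ x' + a * h' <= x + a * h /\ y <= y' /\ y' + b * h' <= y + b * h).
  assert (Hstep : forall q, exists q', good q -> good q' /\ next q q').
  { intros [[x y] h]. destruct (classic (good (x, y, h))) as [g|g]; [|exists (x, y, h); tauto].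
    destruct g as [g1 [g2 [g3 [g4 [g5 g6]]]]].
    assert (Hex : exists x' y', (x' = x \/ x' = x + a * (h / 2)) /\ (y' = y \/ y' = y + b * (h / 2)) /\ ~ P x' y' (h / 2)).
    { apply NNPP. intros hn. apply g6. apply Hsplit; auto; apply NNPP; intros hh; apply hn.
      - exists x, y. auto.
      - exists (x + a * (h / 2)), y. auto.
      - exists x, (y + b * (h / 2)). auto.
      - exists (x + a * (h / 2)), (y + b * (h / 2)). auto. }
    destruct Hex as [x' [y' [hx [hy hP]]]]. exists (x', y', h / 2). intros _.
    assert (0 < a * (h / 2)) by (apply Rmult_lt_0_compat; lra).
    assert (0 < b * (h / 2)) by (apply Rmult_lt_0_compat; lra).
    simpl. repeat split; auto; destruct hx as [->| ->]; destruct hy as [->| ->]; lra. }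
  destruct (choice (fun q q' => good q -> good q' /\ next q q') Hstep) as [nx Hnx].
  set (q := fun n => Nat.iter n nx (X, Y, H)).
  assert (Hgood : forall n, good (q n)).
  { induction n. simpl. repeat split; auto; lra. apply (Hnx (q n) IHn). }
  assert (Hnext : forall n, next (q n) (q (S n))) by (intros n; apply (Hnx (q n) (Hgood n))).
  set (qx := fun n => fst (fst (q n))). set (qy := fun n => snd (fst (q n))). set (qh := fun n => snd (q n)).
  assert (Hg : forall n, 0 < qh n /\ X <= qx n /\ qx n + a * qh n <= X + a * H /\ Y <= qy n /\ qy n + b * qh n <= Y + b * H /\ ~ P (qx n) (qy n) (qh n)).
  { intros n. unfold qx, qy, qh. assert (h := Hgood n). destruct (q n) as [[x y] h']. exact h. }
  assert (Hn' : forall n, qh (S n) = qh n / 2 /\ qx n <= qx (S n) /\ qx (S n) + a * qh (S n) <= qx n + a * qh n /\ qy n <= qy (S n) /\ qy (S n) + b * qh (S n) <= qy n + b * qh n).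
  { intros n. unfold qx, qy, qh. assert (h := Hnext n). destruct (q n) as [[x y] h']. destruct (q (S n)) as [[x' y'] h'']. exact h. }
  assert (Hmono : forall n k, qx n <= qx (n + k)%nat /\ qx (n + k)%nat + a * qh (n + k)%nat <= qx n + a * qh n /\ qy n <= qy (n + k)%nat /\ qy (n + k)%nat + b * qh (n + k)%nat <= qy n + b * qh n).
  { intros n k. induction k. rewrite Nat.add_0_r. lra. rewrite Nat.add_succ_r. destruct (Hn' (n + k)%nat). lra. }
  assert (Hcross : forall n m, qx n <= qx m + a * qh m /\ qy n <= qy m + b * qh m).
  { intros n m. destruct (Nat.le_ge_cases n m) as [l|l].
    - assert (h := Hmono n (m - n)%nat). replace (n + (m - n))%nat with m in h by lia. destruct (Hg m).
      assert (0 < a * qh m) by (apply Rmult_lt_0_compat; lra). assert (0 < b * qh m) by (apply Rmult_lt_0_compat; lra). lra.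
    - assert (h := Hmono m (n - m)%nat). replace (m + (n - m))%nat with n in h by lia. destruct (Hg n).
      assert (0 < a * qh n) by (apply Rmult_lt_0_compat; lra). assert (0 < b * qh n) by (apply Rmult_lt_0_compat; lra). lra. }
  destruct (completeness (fun r => exists n, r = qx n)) as [x0 [Hx1 Hx2]].
  { exists (qx 0%nat + a * qh 0%nat). intros r [n ->]. apply Hcross. }
  { exists (qx 0%nat). exists 0%nat. auto. }
  destruct (completeness (fun r => exists n, r = qy n)) as [y0 [Hy1 Hy2]].
  { exists (qy 0%nat + b * qh 0%nat). intros r [n ->]. apply Hcross. }
  { exists (qy 0%nat). exists 0%nat. auto. }
  assert (Hin : forall n, qx n <= x0 <= qx n + a * qh n /\ qy n <= y0 <= qy n + b * qh n).
  { intros n. repeat split.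
    - apply Hx1. eauto.
    - apply Hx2. intros r [m ->]. apply Hcross.
    - apply Hy1. eauto.
    - apply Hy2. intros r [m ->]. apply Hcross. }
  assert (h0 := Hin 0%nat). unfold qx, qy, qh in h0. simpl in h0.
  destruct (Hloc x0 y0) as [d [Hd Hl]]; [lra|lra|].
  assert (Hqh : forall n, qh n = H / 2 ^ n).
  { induction n. unfold qh; simpl. field. destruct (Hn' n) as [-> _]. rewrite IHn. simpl. field. apply pow_nonzero. lra. }
  destruct (Pow_x_infinity 2) with (b := (H / d + 1)) as [N HN]; [rewrite Rabs_right; lra|].
  specialize (HN N (Nat.le_refl _)). rewrite Rabs_right in HN by (apply Rle_ge, pow_le; lra).
  destruct (Hg N) as [g1 [g2 [g3 [g4 [g5 g6]]]]]. apply g6. apply Hl; auto.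
  - split; auto. rewrite Hqh. assert (0 < 2 ^ N) by (apply pow_lt; lra).
    apply Rmult_lt_reg_r with (2 ^ N); auto. unfold Rdiv. rewrite Rmult_assoc, Rinv_l, Rmult_1_r by lra.
    assert (H / d < 2 ^ N) by lra. apply Rmult_lt_compat_l with (r := d) in H1; auto.
    replace (d * (H / d)) with H in H1 by (field; lra). lra.
  - apply Hin.
  - apply Hin.
Qed.

Definition closedC (K : C -> Prop) : Prop :=
  forall z : C, ~ K z -> exists r, 0 < r /\ forall w : C, Cmod (w - z) < r -> ~ K w.
Definition rcont_on (K : C -> Prop) (f : C -> R) : Prop :=
  forall z, K z -> forall eps, 0 < eps -> exists del, 0 < del /\
    forall w, K w -> Cmod (w - z) < del -> Rabs (f w - f z) < eps.

(** Boundedness over a square is a property to which Cousin's lemma applies: it passes from four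
    quarters to the whole, continuity gives it near points of [K], and near other points it is
    vacuous because [K] is closed. *)
Lemma rcont_bounded (K : C -> Prop) (f : C -> R) (B : R) : closedC K -> (forall z, K z -> Cmod z <= B) ->
  rcont_on K f -> exists M, forall z, K z -> f z <= M.
Proof.
  intros Hc HB Hf.
  set (B' := Rabs B + 1).
  assert (HB' : 0 < B') by (unfold B'; assert (h := Rabs_pos B); lra).
  assert (Hall : exists M, forall z, K z -> (-B') <= fst z <= (-B') + 2 * B' -> (-B') <= snd z <= (-B') + 2 * B' -> f z <= M).
  { apply (cousin 2 2 (fun x y h => exists M, forall z, K z -> x <= fst z <= x + 2 * h -> y <= snd z <= y + 2 * h -> f z <= M)); try lra.
    - intros x y h Hh _ _ _ _ [M1 h1] [M2 h2] [M3 h3] [M4 h4].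
      exists (Rmax (Rmax M1 M2) (Rmax M3 M4)). intros z Kz hx hy.
      assert (m1 := Rmax_l (Rmax M1 M2) (Rmax M3 M4)). assert (m2 := Rmax_r (Rmax M1 M2) (Rmax M3 M4)).
      assert (m3 := Rmax_l M1 M2). assert (m4 := Rmax_r M1 M2). assert (m5 := Rmax_l M3 M4). assert (m6 := Rmax_r M3 M4).
      destruct (Rle_dec (fst z) (x + 2 * (h/2))); destruct (Rle_dec (snd z) (y + 2 * (h/2))).
      + assert (f z <= M1) by (apply h1; auto; lra). lra.
      + assert (f z <= M3) by (apply h3; auto; lra). lra.
      + assert (f z <= M2) by (apply h2; auto; lra). lra.
      + assert (f z <= M4) by (apply h4; auto; lra). lra.
    - intros x0 y0 _ _. destruct (classic (K (x0, y0))) as [k|k].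
      + destruct (Hf _ k 1 Rlt_0_1) as [d [Hd H]]. exists (d / 4). split; [lra|].
        intros x y h Hh _ _ _ _ hx hy. exists (f (x0, y0) + 1). intros z Kz zx zy.
        assert (Cmod (z - (x0, y0)) < d).
        { eapply Rle_lt_trans; [apply Cmod_le_fst_snd|]. simpl.
          assert (Rabs (fst z + - x0) <= 2 * h) by (apply Rabs_le; lra).
          assert (Rabs (snd z + - y0) <= 2 * h) by (apply Rabs_le; lra). lra. }
        specialize (H z Kz H0). apply Rabs_def2 in H. lra.
      + destruct (Hc _ k) as [d [Hd H]]. exists (d / 4). split; [lra|].
        intros x y h Hh _ _ _ _ hx hy. exists 0. intros z Kz zx zy. exfalso.
        apply (H z); auto. eapply Rle_lt_trans; [apply Cmod_le_fst_snd|]. simpl.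
          assert (Rabs (fst z + - x0) <= 2 * h) by (apply Rabs_le; lra).
          assert (Rabs (snd z + - y0) <= 2 * h) by (apply Rabs_le; lra). lra. }
  destruct Hall as [M HM]. exists M. intros z Kz.
  assert (h := HB z Kz). assert (h1 := Cmod_fst_le z). assert (h2 := Cmod_snd_le z).
  assert (h3 := Rle_abs B). unfold B'.
  assert (Rabs (fst z) <= B') by (unfold B'; lra). assert (Rabs (snd z) <= B') by (unfold B'; lra).
  apply Rabs_le_between in H. apply Rabs_le_between in H0.
  apply HM; auto; lra.
Qed.

(** If the supremum [s] were not attained, [1 / (s - f)] would be continuous on [K], hence bounded,
    which would keep [f] away from [s]. *)
Lemma rcont_max (K : C -> Prop) (f : C -> R) (B : R) : closedC K -> (forall z, K z -> Cmod z <= B) ->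
  rcont_on K f -> (exists z, K z) -> exists a, K a /\ forall z, K z -> f z <= f a.
Proof.
  intros Hc HB Hf [z0 Hz0]. destruct (rcont_bounded K f B Hc HB Hf) as [M HM].
  destruct (completeness (fun r => exists z, K z /\ r = f z)) as [s [Hs1 Hs2]].
  { exists M. intros r [z [h ->]]. auto. }
  { exists (f z0), z0. auto. }
  apply NNPP. intros Hn.
  assert (Hlt : forall z, K z -> f z < s).
  { intros z Kz. assert (f z <= s) by (apply Hs1; eauto).
    destruct (Req_dec (f z) s) as [e|e]; [|lra]. exfalso. apply Hn. exists z. split; auto.
    intros w Kw. rewrite e. apply Hs1. eauto. }
  destruct (rcont_bounded K (fun z => / (s - f z)) B Hc HB) as [M' HM'].
  { intros z Kz e He. assert (hz := Hlt z Kz). set (m := s - f z). assert (0 < m) by (unfold m; lra).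
    destruct (Hf z Kz (Rmin (m / 2) (e * (m * m) / 2))) as [d [Hd H1]].
    { apply Rmin_glb_lt; [lra|]. assert (0 < m * m) by nra. nra. }
    exists d. split; auto. intros w Kw Hw. specialize (H1 w Kw Hw).
    destruct (Rlt_Rmin H1) as [h1 h2].
    set (n := s - f w).
    assert (m / 2 < n). { apply Rabs_def2 in h1. unfold n, m in *. lra. }
    fold m. replace (/ n - / m) with ((f w - f z) / (n * m)) by (unfold n, m in *; field; lra).
    unfold Rdiv. rewrite Rabs_mult, (Rabs_right (/ (n * m))) by (apply Rle_ge, Rlt_le, Rinv_0_lt_compat; nra).
    apply Rmult_lt_reg_r with (n * m); [nra|]. rewrite Rmult_assoc, Rinv_l by nra. rewrite Rmult_1_r.
    assert (m / 2 * m < n * m) by nra. assert (e * (m/2*m) < e * (n * m)) by nra. lra. }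
  assert (hM : 0 < M'). { eapply Rlt_le_trans; [|apply (HM' z0 Hz0)]. apply Rinv_0_lt_compat. assert (h := Hlt z0 Hz0). lra. }
  assert (s <= s - / M').
  { apply Hs2. intros r [z [Kz ->]]. assert (h' := Hlt z Kz).
    assert (/ M' <= s - f z); [|lra].
    rewrite <- (Rinv_inv (s - f z)). apply Rinv_le_contravar; auto. apply Rinv_0_lt_compat. lra. }
  assert (0 < / M') by (apply Rinv_0_lt_compat; auto). lra.
Qed.

(** * Goursat and the maximum principle *)

Lemma continuous_eps (f : R -> R) (t : R) :
  (forall eps, 0 < eps -> exists del, 0 < del /\ forall s, Rabs (s - t) < del -> Rabs (f s - f t) < eps) ->
  continuous f t.
Proof.
  intros H. apply continuity_pt_filterlim. intros e He.
  destruct (H e He) as [d [Hd H1]]. exists d. split; auto.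
  intros s [_ Hs]. apply H1. exact Hs.
Qed.

Lemma continuous_eps_inv (f : R -> R) (t : R) : continuous f t ->
  forall eps, 0 < eps -> exists del, 0 < del /\ forall s, Rabs (s - t) < del -> Rabs (f s - f t) < eps.
Proof.
  intros H e He. apply continuity_pt_filterlim in H. destruct (H e He) as [d [Hd H1]].
  exists d. split; auto. intros s Hs. destruct (Req_dec t s) as [->|n].
  - rewrite Rminus_diag, Rabs_R0. auto.
  - apply H1. split; [split; [exact I|exact n]|exact Hs].
Qed.

Lemma ccont_line_fst (f : C -> C) (g : R -> C) (t : R) :
  (forall s, Cmod (g s - g t) <= Rabs (s - t)) -> ccont f (g t) -> continuous (fun s => fst (f (g s))) t.
Proof.
  intros Hg Hf. apply continuous_eps. intros e He. destruct (Hf e He) as [d [Hd H]]. exists d. split; auto.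
  intros s Hs. eapply Rle_lt_trans; [apply (Rabs_Re_sub_le (f (g s)) (f (g t)))|]. apply H.
  eapply Rle_lt_trans; [apply Hg|auto].
Qed.

Lemma ccont_line_snd (f : C -> C) (g : R -> C) (t : R) :
  (forall s, Cmod (g s - g t) <= Rabs (s - t)) -> ccont f (g t) -> continuous (fun s => snd (f (g s))) t.
Proof.
  intros Hg Hf. apply continuous_eps. intros e He. destruct (Hf e He) as [d [Hd H]]. exists d. split; auto.
  intros s Hs. eapply Rle_lt_trans; [apply (Rabs_Im_sub_le (f (g s)) (f (g t)))|]. apply H.
  eapply Rle_lt_trans; [apply Hg|auto].
Qed.

Lemma hline_dist (y s t : R) : Cmod ((s, y) - (t, y))%C <= Rabs (s - t).
Proof.
  eapply Rle_trans; [apply Cmod_le_fst_snd|]. simpl.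
  replace (y + - y) with 0 by ring. rewrite Rabs_R0. unfold Rminus. lra.
Qed.

Lemma vline_dist (x s t : R) : Cmod ((x, s) - (x, t))%C <= Rabs (s - t).
Proof.
  eapply Rle_trans; [apply Cmod_le_fst_snd|]. simpl.
  replace (x + - x) with 0 by ring. rewrite Rabs_R0. unfold Rminus. lra.
Qed.

Lemma RInt_close (f : R -> R) (a b c M : R) : a <= b -> ex_RInt f a b ->
  (forall t, a <= t <= b -> Rabs (f t - c) <= M) -> Rabs (RInt f a b - c * (b - a)) <= M * (b - a).
Proof.
  intros Hab Hf H.
  assert (E : RInt f a b - c * (b - a) = RInt (fun t => f t - c) a b).
  { rewrite (RInt_minus f (fun _ => c)); auto; [|apply ex_RInt_const].
    rewrite RInt_const. unfold minus, plus, opp, scal; simpl. unfold mult; simpl. ring. }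
  rewrite E. rewrite Rmult_comm. apply abs_RInt_le_const; auto.
  apply (ex_RInt_minus f (fun _ => c)); auto. apply ex_RInt_const.
Qed.

Section Goursat.
Variable f : C -> C.

(** [J1 + J2] is the imaginary part of the integral of f dz around the rectangle, counterclockwise,
    split into horizontal and vertical sides. On vertical sides it integrates the real part of [f],
    the quantity averaged in [circle_max]. *)
Let J1 x1 x2 y1 y2 := RInt (fun s => snd (f (s, y1)) - snd (f (s, y2))) x1 x2.
Let J2 x1 x2 y1 y2 := RInt (fun t => fst (f (x2, t)) - fst (f (x1, t))) y1 y2.

Lemma ex_J1 x1 x2 y1 y2 : x1 <= x2 ->
  (forall s, x1 <= s <= x2 -> ccont f (s, y1) /\ ccont f (s, y2)) ->
  ex_RInt (fun s => snd (f (s, y1)) - snd (f (s, y2))) x1 x2.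
Proof.
  intros Hx H. apply (@ex_RInt_continuous R_CompleteNormedModule). intros s Hs.
  rewrite Rmin_left, Rmax_right in Hs by auto. destruct (H s Hs).
  apply (continuous_minus (fun s => snd (f (s, y1))) (fun s => snd (f (s, y2)))).
  - apply (ccont_line_snd f (fun s => (s, y1))); auto. intros; apply hline_dist.
  - apply (ccont_line_snd f (fun s => (s, y2))); auto. intros; apply hline_dist.
Qed.

Lemma ex_J2 x1 x2 y1 y2 : y1 <= y2 ->
  (forall t, y1 <= t <= y2 -> ccont f (x1, t) /\ ccont f (x2, t)) ->
  ex_RInt (fun t => fst (f (x2, t)) - fst (f (x1, t))) y1 y2.
Proof.
  intros Hx H. apply (@ex_RInt_continuous R_CompleteNormedModule). intros s Hs.
  rewrite Rmin_left, Rmax_right in Hs by auto. destruct (H s Hs).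
  apply (continuous_minus (fun s => fst (f (x2, s))) (fun s => fst (f (x1, s)))).
  - apply (ccont_line_fst f (fun s => (x2, s))); auto. intros; apply vline_dist.
  - apply (ccont_line_fst f (fun s => (x1, s))); auto. intros; apply vline_dist.
Qed.

Lemma RInt_add2 (g1 g2 g : R -> R) (a b : R) : ex_RInt g1 a b -> ex_RInt g2 a b ->
  (forall s, g s = g1 s + g2 s) -> RInt g a b = RInt g1 a b + RInt g2 a b.
Proof.
  intros h1 h2 E. rewrite <- (RInt_plus g1 g2) by auto. apply RInt_ext. intros s _. apply E.
Qed.

Lemma J1_split x1 x2 x3 y1 y2 y3 : x1 <= x2 <= x3 -> y1 <= y2 <= y3 ->
  (forall s t, x1 <= s <= x3 -> y1 <= t <= y3 -> ccont f (s, t)) ->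
  J1 x1 x3 y1 y3 = J1 x1 x2 y1 y2 + J1 x2 x3 y1 y2 + J1 x1 x2 y2 y3 + J1 x2 x3 y2 y3.
Proof.
  intros Hx Hy H. unfold J1.
  rewrite (RInt_add2 (fun s => snd (f (s, y1)) - snd (f (s, y2))) (fun s => snd (f (s, y2)) - snd (f (s, y3)))).
    rewrite <- (RInt_Chasles (fun s => snd (f (s, y1)) - snd (f (s, y2))) x1 x2 x3).
    rewrite <- (RInt_Chasles (fun s => snd (f (s, y2)) - snd (f (s, y3))) x1 x2 x3).
    unfold plus; simpl. ring.
    all: try (apply ex_J1; [lra|]; intros s Hs; split; apply H; lra).
    intros; ring.
Qed.

Lemma J2_split x1 x2 x3 y1 y2 y3 : x1 <= x2 <= x3 -> y1 <= y2 <= y3 ->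
  (forall s t, x1 <= s <= x3 -> y1 <= t <= y3 -> ccont f (s, t)) ->
  J2 x1 x3 y1 y3 = J2 x1 x2 y1 y2 + J2 x2 x3 y1 y2 + J2 x1 x2 y2 y3 + J2 x2 x3 y2 y3.
Proof.
  intros Hx Hy H. unfold J2.
  rewrite (RInt_add2 (fun s => fst (f (x2, s)) - fst (f (x1, s))) (fun s => fst (f (x3, s)) - fst (f (x2, s)))).
    rewrite <- (RInt_Chasles (fun s => fst (f (x2, s)) - fst (f (x1, s))) y1 y2 y3).
    rewrite <- (RInt_Chasles (fun s => fst (f (x3, s)) - fst (f (x2, s))) y1 y2 y3).
    unfold plus; simpl. ring.
    all: try (apply ex_J2; [lra|]; intros s Hs; split; apply H; lra).
    intros; ring.
Qed.

(** Goursat's argument in the form of Cousin's lemma: the bound [eps * h^2] on a rectangle of scale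
    [h] adds up under quartering, and differentiability at a point gives it for all small rectangles
    containing that point. *)
Lemma goursat (X Y a b : R) : 0 < a -> 0 < b ->
  (forall s t, X <= s <= X + a -> Y <= t <= Y + b -> exists d, cder f (s, t) d) ->
  J1 X (X + a) Y (Y + b) + J2 X (X + a) Y (Y + b) = 0.
Proof.
  intros Ha Hb Hd.
  assert (Hc : forall s t, X <= s <= X + a -> Y <= t <= Y + b -> ccont f (s, t)).
  { intros s t hs ht. destruct (Hd s t hs ht) as [d h]. eapply cder_ccont; eauto. }
  assert (K : forall eps, 0 < eps -> Rabs (J1 X (X + a * 1) Y (Y + b * 1) + J2 X (X + a * 1) Y (Y + b * 1)) <= eps * (1 * 1)).
  { intros eps Heps.
    apply (cousin a b (fun x y h => Rabs (J1 x (x + a * h) y (y + b * h) + J2 x (x + a * h) y (y + b * h)) <= eps * (h * h)) X Y 1); try lra.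
    - intros x y h Hh h1 h2 h3 h4 P1 P2 P3 P4.
      assert (0 < a * (h / 2)) by (apply Rmult_lt_0_compat; lra).
      assert (0 < b * (h / 2)) by (apply Rmult_lt_0_compat; lra).
      assert (e1 : x + a * (h / 2) + a * (h / 2) = x + a * h) by field.
      assert (e2 : y + b * (h / 2) + b * (h / 2) = y + b * h) by field.
      rewrite e1 in P2. rewrite e2 in P3. rewrite e1, e2 in P4.
      rewrite (J1_split x (x + a * (h / 2)) (x + a * h) y (y + b * (h / 2)) (y + b * h)); try lra.
      rewrite (J2_split x (x + a * (h / 2)) (x + a * h) y (y + b * (h / 2)) (y + b * h)); try lra.
      2: intros; apply Hc; lra. 2: intros; apply Hc; lra.
      apply Rabs_le_between in P1. apply Rabs_le_between in P2. apply Rabs_le_between in P3. apply Rabs_le_between in P4.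
      apply Rabs_le. lra.
    - intros x0 y0 hx0 hy0. destruct (Hd x0 y0) as [d Hder]; [lra|lra|].
      set (e' := eps / (2 * (a + b) * (a + b))).
      assert (He' : 0 < e') by (apply Rdiv_lt_0_compat; nra).
      destruct (Hder e' He') as [del [Hdel Hder']].
      exists (del / (a + b)). split; [apply Rdiv_lt_0_compat; lra|].
      intros x y h Hh h1 h2 h3 h4 hx hy.
      assert (hah : 0 < a * h) by nra. assert (hbh : 0 < b * h) by nra.
      assert (Hsm : (a + b) * h < del).
      { destruct Hh as [_ Hh]. apply Rmult_lt_compat_l with (r := a + b) in Hh; [|lra].
        replace ((a + b) * (del / (a + b))) with del in Hh by (field; lra). auto. }
      assert (Hclose : forall s t, x <= s <= x + a * h -> y <= t <= y + b * h ->
         Cmod (f (s, t) - f (x0, y0) - d * ((s, t) - (x0, y0))) <= e' * ((a + b) * h)).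
      { intros s t hs ht.
        assert (Cmod ((s, t) - (x0, y0)) <= (a + b) * h).
        { eapply Rle_trans; [apply Cmod_le_fst_snd|]. simpl.
          assert (Rabs (s + - x0) <= a * h) by (apply Rabs_le; lra).
          assert (Rabs (t + - y0) <= b * h) by (apply Rabs_le; lra). lra. }
        eapply Rle_trans; [apply Hder'; lra|]. apply Rmult_le_compat_l; lra. }
      (* The linear part of [f] contributes [fst d] times the area, with opposite signs in [B1] and
         [B2]; in the sum only the two error terms remain, and [e'] was chosen so that they add up
         to [eps * h^2]. *)
      assert (B1 : Rabs (J1 x (x + a * h) y (y + b * h) - (- (fst d * (b * h))) * (x + a * h - x)) <= 2 * (e' * ((a + b) * h)) * (x + a * h - x)).
      { apply RInt_close; [lra| |].
        - apply ex_J1; [lra|]. intros s Hs. split; apply Hc; lra.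
        - intros s Hs.
          assert (A1 := Hclose s y Hs ltac:(lra)). assert (A2 := Hclose s (y + b * h) Hs ltac:(lra)).
          assert (S1 := Cmod_snd_le (f (s, y) - f (x0, y0) - d * ((s, y) - (x0, y0)))).
          assert (S2 := Cmod_snd_le (f (s, y + b * h) - f (x0, y0) - d * ((s, y + b * h) - (x0, y0)))).
          simpl in S1, S2.
          assert (S1' := Rle_trans _ _ _ S1 A1). assert (S2' := Rle_trans _ _ _ S2 A2).
          apply Rabs_le_between in S1'. apply Rabs_le_between in S2'. apply Rabs_le. nra. }
      assert (B2 : Rabs (J2 x (x + a * h) y (y + b * h) - (fst d * (a * h)) * (y + b * h - y)) <= 2 * (e' * ((a + b) * h)) * (y + b * h - y)).
      { apply RInt_close; [lra| |].
        - apply ex_J2; [lra|]. intros s Hs. split; apply Hc; lra.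
        - intros t Ht.
          assert (A1 := Hclose x t ltac:(lra) Ht). assert (A2 := Hclose (x + a * h) t ltac:(lra) Ht).
          assert (S1 := Cmod_fst_le (f (x, t) - f (x0, y0) - d * ((x, t) - (x0, y0)))).
          assert (S2 := Cmod_fst_le (f (x + a * h, t) - f (x0, y0) - d * ((x + a * h, t) - (x0, y0)))).
          simpl in S1, S2.
          assert (S1' := Rle_trans _ _ _ S1 A1). assert (S2' := Rle_trans _ _ _ S2 A2).
          apply Rabs_le_between in S1'. apply Rabs_le_between in S2'. apply Rabs_le. nra. }
      assert (E : 2 * (e' * ((a + b) * h)) * (x + a * h - x) + 2 * (e' * ((a + b) * h)) * (y + b * h - y) = eps * (h * h)).
      { unfold e'. field. lra. }
      apply Rabs_le_between in B1. apply Rabs_le_between in B2. apply Rabs_le.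
      lra. }
  rewrite !Rmult_1_r in K. apply NNPP. intros n. apply Rabs_pos_lt in n.
  specialize (K _ (Rdiv_lt_0_compat _ 2 n Rlt_0_2)). lra.
Qed.
End Goursat.

(** * The complex exponential and the maximum principle on circles *)

Lemma der0_small (f : R -> R) (l : R) : derivable_pt_lim f 0 l -> forall eps, 0 < eps ->
  exists del, 0 < del /\ forall h, Rabs h < del -> Rabs (f h - f 0 - l * h) <= eps * Rabs h.
Proof.
  intros H e He. destruct (H e He) as [d Hd]. exists d. split; [apply cond_pos|].
  intros h Hh. destruct (Req_dec h 0) as [->|n].
  - replace (f 0 - f 0 - l * 0) with 0 by ring. rewrite Rabs_R0. lra.
  - specialize (Hd h n Hh). rewrite Rplus_0_l in Hd.
    replace (f h - f 0 - l * h) with (((f h - f 0) / h - l) * h) by (field; auto).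
    rewrite Rabs_mult. apply Rmult_le_compat_r; [apply Rabs_pos|lra].
Qed.

Lemma Cexp_plus (z w : C) : Cexp (z + w)%C = (Cexp z * Cexp w)%C.
Proof.
  unfold Cexp, Cmult, Cplus; simpl. rewrite exp_plus, cos_plus, sin_plus. f_equal; ring.
Qed.

Lemma Cmod_Cexp (z : C) : Cmod (Cexp z) = exp (fst z).
Proof.
  assert (h := Cmod_sq (Cexp z)). simpl in h.
  assert (h1 := sin2_cos2 (snd z)). unfold Rsqr in h1.
  assert (h2 := Cmod_ge_0 (Cexp z)). assert (h3 := exp_pos (fst z)).
  apply Rsqr_inj; auto; [lra|]. unfold Rsqr. rewrite h. nra.
Qed.

Lemma cder_Cexp (z : C) : cder Cexp z (Cexp z).
Proof.
  assert (H0 : cder Cexp 0 1).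
  (* The remainders of the real and the imaginary part are bounded by 4 and 5 multiples of [e' * m],
     hence the 9. *)
  { intros e He. set (e' := Rmin 1 (e / 9)).
    assert (he' : 0 < e') by (apply Rmin_glb_lt; lra).
    assert (e1 : e' <= 1) by apply Rmin_l. assert (e2 : e' <= e / 9) by apply Rmin_r.
    destruct (der0_small exp 1 derivable_pt_lim_exp_0 e' he') as [d1 [Hd1 H1]].
    assert (c0 := derivable_pt_lim_cos 0). rewrite sin_0, Ropp_0 in c0.
    assert (s0 := derivable_pt_lim_sin 0). rewrite cos_0 in s0.
    destruct (der0_small cos 0 c0 e' he') as [d2 [Hd2 H2]].
    destruct (der0_small sin 1 s0 e' he') as [d3 [Hd3 H3]].
    exists (Rmin (Rmin d1 d2) (Rmin d3 e')). split.
    { apply Rmin_glb_lt; apply Rmin_glb_lt; lra. }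
    intros w Hw. replace (w - 0)%C with w in * by ring.
    destruct (Rlt_Rmin Hw) as [w1 w2].
    destruct (Rlt_Rmin w1) as [w3 w4].
    destruct (Rlt_Rmin w2) as [w5 w6].
    destruct w as [x y]. set (m := Cmod (x, y)) in *.
    assert (hx : Rabs x <= m) by apply (Cmod_fst_le (x, y)). assert (hy : Rabs y <= m) by apply (Cmod_snd_le (x, y)).
    specialize (H1 x ltac:(lra)). specialize (H2 y ltac:(lra)). specialize (H3 y ltac:(lra)).
    rewrite exp_0 in H1. rewrite cos_0 in H2. rewrite sin_0 in H3.
    eapply Rle_trans; [apply Cmod_le_fst_snd|]. unfold Cexp, Cminus, Cmult, Cplus, Copp, RtoC; simpl.
    rewrite exp_0, cos_0, sin_0.
    assert (hxx := Rabs_pos x).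
    set (ex := exp x) in *. set (cy := cos y) in *. set (sy := sin y) in *.
    assert (A1 : Rabs (ex - 1 - 1 * x) <= e' * m) by (eapply Rle_trans; [apply H1|]; apply Rmult_le_compat_l; lra).
    assert (A2 : Rabs (cy - 1 - 0 * y) <= e' * m) by (eapply Rle_trans; [apply H2|]; apply Rmult_le_compat_l; lra).
    assert (A3 : Rabs (sy - 0 - 1 * y) <= e' * m) by (eapply Rle_trans; [apply H3|]; apply Rmult_le_compat_l; lra).
    assert (hex : Rabs (ex - 1) <= 2 * m).
    { apply Rabs_le_between in A1. apply Rabs_le_between in hx. apply Rabs_le. nra. }
    replace (ex * cy + - (1 * 1) + - (1 * x - 0 * y)) with ((ex - 1 - 1 * x) + (cy - 1 - 0*y) + (ex - 1) * (cy - 1 - 0*y)) by ring.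
    replace (ex * sy + - (1 * 0) + - (1 * y + 0 * x)) with ((sy - 0 - 1*y) + (ex - 1) * (sy - 0 - 1*y) + (ex - 1) * y) by ring.
    assert (B1 : Rabs ((ex - 1) * (cy - 1 - 0*y)) <= 2 * (e' * m)).
    { rewrite Rabs_mult. apply Rmult_le_compat; auto using Rabs_pos. lra. }
    assert (B2 : Rabs ((ex - 1) * (sy - 0 - 1*y)) <= 2 * (e' * m)).
    { rewrite Rabs_mult. apply Rmult_le_compat; auto using Rabs_pos. lra. }
    assert (B3 : Rabs ((ex - 1) * y) <= 2 * m * e').
    { rewrite Rabs_mult. apply Rmult_le_compat; auto using Rabs_pos. lra. }
    apply Rabs_le_between in A1. apply Rabs_le_between in A2. apply Rabs_le_between in A3.
    apply Rabs_le_between in B1. apply Rabs_le_between in B2. apply Rabs_le_between in B3.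
    assert (e' * m <= e / 9 * m) by (apply Rmult_le_compat_r; lra).
    assert (Rabs ((ex - 1 - 1 * x) + (cy - 1 - 0*y) + (ex - 1) * (cy - 1 - 0*y)) <= 4 * (e' * m)) by (apply Rabs_le; lra).
    assert (Rabs ((sy - 0 - 1*y) + (ex - 1) * (sy - 0 - 1*y) + (ex - 1) * y) <= 5 * (e' * m)) by (apply Rabs_le; lra).
    lra. }
  apply cder_ext_loc with (f := fun w => (Cexp z * Cexp (w - z))%C) (r := 1); [lra| |].
  - intros w _. rewrite <- Cexp_plus. f_equal. ring.
  - apply cder_eq with (Cexp z * (1 * (1 - 0)))%C; [|ring]. apply cder_scal.
    apply (cder_comp Cexp (fun w => w - z)%C).
    + apply cder_minus; [apply cder_id|apply cder_const].
    + replace (z - z)%C with (RtoC 0) by ring. exact H0.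
Qed.

(* In the chart c + exp the circles become vertical segments of length 2 pi; by Goursat and
   periodicity the integral of f over them does not depend on the radius. *)
Lemma circle_max (f : C -> C) (c : C) (r M : R) : 0 < r ->
  (forall z : C, 0 < Cmod (z - c) <= r -> exists d, cder f z d) -> ccont f c ->
  (forall z : C, Cmod (z - c) = r -> Re (f z) <= M) -> Re (f c) <= M.
Proof.
  intros Hr Hd Hc HM. apply Rnot_lt_le. intros Hlt.
  set (e := (Re (f c) - M) / 2).
  assert (He : 0 < e) by (unfold e; lra).
  destruct (Hc e He) as [del [Hdel Hcont]].
  set (s := Rmin (ln r) (ln (del / 2)) - 1).
  assert (Hs1 : s < ln r) by (unfold s; assert (h := Rmin_l (ln r) (ln (del / 2))); lra).
  assert (Hs2 : exp s < del).
  { apply Rlt_trans with (del / 2); [|lra]. rewrite <- (exp_ln (del / 2)) by lra. apply exp_increasing.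
    unfold s; assert (h := Rmin_r (ln r) (ln (del / 2))); lra. }
  set (g := fun z => f (c + Cexp z)%C).
  assert (Hmod : forall z, Cmod (c + Cexp z - c)%C = exp (fst z)).
  { intros z. replace (c + Cexp z - c)%C with (Cexp z) by ring. apply Cmod_Cexp. }
  assert (Hg : forall x t, s <= x <= s + (ln r - s) -> 0 <= t <= 0 + 2 * PI -> exists d, cder g (x, t) d).
  { intros x t Hx _. destruct (Hd (c + Cexp (x, t))%C) as [d D].
    - rewrite Hmod. simpl. split; [apply exp_pos|]. rewrite <- (exp_ln r) by auto.
      destruct (Req_dec x (ln r)) as [->|]; [lra|]. left. apply exp_increasing. lra.
    - exists (d * (0 + Cexp (x, t)))%C. unfold g. apply (cder_comp f (fun z => c + Cexp z)%C); auto.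
      apply cder_plus; [apply cder_const|apply cder_Cexp]. }
  assert (HPI := PI_RGT_0).
  assert (G := goursat g s 0 (ln r - s) (2 * PI) ltac:(lra) ltac:(lra) Hg). simpl in G.
  assert (Hper : forall x, g (x, 0 + 2 * PI) = g (x, 0)).
  { intros x. unfold g, Cexp. simpl. rewrite Rplus_0_l, cos_2PI, sin_2PI, cos_0, sin_0. auto. }
  assert (E1 : RInt (fun x => snd (g (x, 0)) - snd (g (x, 0 + 2 * PI))) s (s + (ln r - s)) = 0).
  { rewrite (RInt_ext _ (fun _ => 0)).
    - rewrite RInt_const. unfold scal; simpl; unfold mult; simpl. ring.
    - intros x _. rewrite Hper. apply Rminus_diag. }
  rewrite E1, Rplus_0_l in G.
  assert (L : RInt (fun t => fst (g (s + (ln r - s), t)) - fst (g (s, t))) 0 (0 + 2 * PI) <= RInt (fun _ => - e) 0 (0 + 2 * PI)).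
  { apply RInt_le; [lra| |apply ex_RInt_const|].
    - apply ex_J2; [lra|]. intros t Ht. split.
      + destruct (Hg s t) as [d D]; [lra|lra|]. eapply cder_ccont; eauto.
      + destruct (Hg (s + (ln r - s)) t) as [d D]; [lra|lra|]. eapply cder_ccont; eauto.
    - intros t Ht.
      assert (A1 : fst (g (s + (ln r - s), t)) <= M).
      { apply HM. rewrite Hmod. simpl. replace (s + (ln r - s)) with (ln r) by ring. apply exp_ln; auto. }
      assert (A2 : Re (f c) - fst (g (s, t)) < e).
      { eapply Rle_lt_trans; [apply Re_sub_le|]. rewrite Cmod_sym. apply Hcont. rewrite Hmod. exact Hs2. }
      unfold e in *. lra. }
  rewrite G, RInt_const in L. unfold scal in L; simpl in L; unfold mult in L; simpl in L. nra.
Qed.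

(** * Mean value inequality, maximum modulus, open mapping *)

Lemma path_growth (phi psi : R -> R) (a b : R) : a <= b ->
  (forall t, a <= t <= b -> exists l l', derivable_pt_lim phi t l /\ derivable_pt_lim psi t l' /\ l <= l') ->
  phi b - phi a <= psi b - psi a.
Proof.
  intros Hab H. destruct (Req_dec a b) as [->|n]; [lra|].
  assert (H' : forall t, exists l, a <= t <= b -> derivable_pt_lim (fun x => psi x - phi x) t l /\ 0 <= l).
  { intros t. destruct (classic (a <= t <= b)) as [h|h]; [|exists 0; tauto].
    destruct (H t h) as [l [l' [h1 [h2 h3]]]]. exists (l' - l). intros _. split; [|lra].
    apply (derivable_pt_lim_minus psi phi); auto. }
  destruct (choice _ H') as [D HD].
  destruct (MVT_cor2 (fun x => psi x - phi x) D a b) as [c [Hc1 Hc2]]; [lra|intros c Hc; apply HD; auto|].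
  destruct (HD c) as [_ h]; [lra|]. simpl in Hc1. assert (0 <= D c * (b - a)) by (apply Rmult_le_pos; lra). lra.
Qed.

Lemma line_der (f : C -> C) (v u d : C) (t : R) : cder f (v + RtoC t * u) d ->
  derivable_pt_lim (fun s => fst (f (v + RtoC s * u)%C)) t (fst (d * u)%C).
Proof.
  intros H e He. assert (hu := Cmod_ge_0 u).
  destruct (H (e / (2 * (Cmod u + 1)))) as [del [Hdel Hd]]; [apply Rdiv_lt_0_compat; lra|].
  assert (hd : 0 < del / (Cmod u + 1)) by (apply Rdiv_lt_0_compat; lra).
  exists (mkposreal _ hd). simpl. intros h n Hh.
  specialize (Hd (v + RtoC (t + h) * u)%C).
  replace (v + RtoC (t + h) * u - (v + RtoC t * u))%C with (RtoC h * u)%C in Hd by (rewrite RtoC_plus; ring).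
  rewrite Cmod_mult, Cmod_R in Hd.
  assert (hh : Rabs h * Cmod u < del).
  { apply Rle_lt_trans with (Rabs h * (Cmod u + 1)). apply Rmult_le_compat_l; [apply Rabs_pos|lra].
    apply Rlt_div_r in Hh; [|lra]. auto. }
  specialize (Hd hh).
  assert (F := Cmod_fst_le (f (v + RtoC (t + h) * u) - f (v + RtoC t * u) - d * (RtoC h * u))%C).
  assert (F' := Rle_trans _ _ _ F Hd). simpl in F'. simpl.
  match goal with |- Rabs ((?A - ?B) / h - ?D) < e =>
    replace ((A - B) / h - D) with ((A - B - h * D) * / h) by (field; auto); set (X := A - B - h * D) end.
  rewrite Rabs_mult, Rabs_inv.
  assert (hp : 0 < Rabs h) by (apply Rabs_pos_lt; auto).
  assert (F2 : Rabs X <= e / (2 * (Cmod u + 1)) * (Rabs h * Cmod u)).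
  { eapply Rle_trans; [|apply F']. right. f_equal. unfold X. ring. }
  apply Rle_lt_trans with (e / (2 * (Cmod u + 1)) * Cmod u).
  - apply Rmult_le_reg_r with (Rabs h); auto. rewrite Rmult_assoc, Rinv_l, Rmult_1_r by lra. lra.
  - apply Rmult_lt_reg_r with (2 * (Cmod u + 1)); [lra|].
    replace (e / (2 * (Cmod u + 1)) * Cmod u * (2 * (Cmod u + 1))) with (e * Cmod u) by (field; lra). nra.
Qed.

Lemma mean_value_ineq (f : C -> C) (v u : C) (L : R) :
  (forall t, 0 <= t <= 1 -> exists d, cder f (v + RtoC t * (u - v)) d /\ Cmod d <= L) ->
  Cmod (f u - f v) <= L * Cmod (u - v).
Proof.
  intros H. destruct (unimodular_align (f u - f v)) as [c [hc hr]].
  assert (P := path_growth (fun s => fst (c * f (v + RtoC s * (u - v)))%C) (fun s => s * (L * Cmod (u - v))) 0 1 Rle_0_1).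
  assert (P' : fst (c * f (v + RtoC 1 * (u - v)))%C - fst (c * f (v + RtoC 0 * (u - v)))%C <= 1 * (L * Cmod (u - v)) - 0 * (L * Cmod (u - v))).
  { apply P. intros t Ht. destruct (H t Ht) as [d [D hd]].
    exists (fst (c * d * (u - v))%C), (1 * (L * Cmod (u - v)) + t * 0). split; [|split].
    - apply (line_der (fun z => c * f z)%C). apply cder_scal; auto.
    - apply (derivable_pt_lim_mult (fun s => s) (fun _ => L * Cmod (u - v))).
      apply derivable_pt_lim_id. apply derivable_pt_lim_const.
    - assert (h := Cmod_fst_le (c * d * (u - v))%C). rewrite !Cmod_mult, hc, Rmult_1_l in h.
      assert (h2 := Rle_abs (fst (c * d * (u - v))%C)).
      assert (Cmod d * Cmod (u - v) <= L * Cmod (u - v)) by (apply Rmult_le_compat_r; auto using Cmod_ge_0). lra. }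
  replace (v + RtoC 1 * (u - v))%C with u in P' by ring. replace (v + RtoC 0 * (u - v))%C with v in P' by ring.
  rewrite <- hr. unfold Re. replace (fst (c * (f u - f v))%C) with (fst (c * f u)%C - fst (c * f v)%C) by (simpl; ring). lra.
Qed.

Definition ccont_on (K : C -> Prop) (f : C -> C) : Prop :=
  forall z : C, K z -> forall eps, 0 < eps -> exists del, 0 < del /\
    forall w : C, K w -> Cmod (w - z) < del -> Cmod (f w - f z) < eps.

Lemma Cmod_sq_expand (a w : C) :
  Cmod w * Cmod w = Cmod a * Cmod a + Cmod (w - a) * Cmod (w - a) + 2 * fst (Cconj a * (w - a))%C.
Proof. rewrite !Cmod_sq. simpl. ring. Qed.

Lemma Rabs_Cmod_sub (z w : C) : Rabs (Cmod z - Cmod w) <= Cmod (z - w).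
Proof.
  assert (h1 := Cmod_sub_le z w). assert (h2 := Cmod_sub_le w z). rewrite Cmod_sym in h2. apply Rabs_le. lra.
Qed.

(* Maximise |phi| + eps |z|^2: at an interior maximum this violates [circle_max]. *)
Lemma max_modulus (K : C -> Prop) (phi : C -> C) (B M : R) : closedC K -> (forall z, K z -> Cmod z <= B) ->
  ccont_on K phi ->
  (forall z : C, K z -> Cmod (phi z) <= M \/ exists s, 0 < s /\ (forall w : C, Cmod (w - z) <= s -> K w) /\
     (forall w : C, 0 < Cmod (w - z) <= s -> exists d, cder phi w d) /\ ccont phi z) ->
  forall z, K z -> Cmod (phi z) <= M.
Proof.
  intros Hcl HB Hc H z1 Kz1. apply Rnot_lt_le. intros Hlt.
  assert (HB0 : 0 <= B) by (eapply Rle_trans; [apply Cmod_ge_0|apply (HB z1 Kz1)]).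
  set (e := (Cmod (phi z1) - M) / (2 * (B * B + 1))).
  assert (He : 0 < e) by (apply Rdiv_lt_0_compat; nra).
  assert (Hrc : rcont_on K (fun z => Cmod (phi z) + e * (Cmod z * Cmod z))).
  { intros z Kz eps Heps. destruct (Hc z Kz (eps / 2)) as [d [Hd H1]]; [lra|].
    exists (Rmin d (eps / (4 * e * (B + 1)))). split.
    - apply Rmin_glb_lt; auto. apply Rdiv_lt_0_compat; auto. nra.
    - intros w Kw Hw. specialize (H1 w Kw (Rlt_Rmin_l Hw)).
      assert (H2 := Rlt_Rmin_r Hw).
      assert (A1 := Rabs_Cmod_sub (phi w) (phi z)). assert (A2 := Rabs_Cmod_sub w z).
      assert (b1 := HB z Kz). assert (b2 := HB w Kw). assert (b3 := Cmod_ge_0 z). assert (b4 := Cmod_ge_0 w).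
      assert (A3 : Rabs (e * (Cmod w * Cmod w) - e * (Cmod z * Cmod z)) <= e * (2 * (B + 1)) * Cmod (w - z)).
      { replace (e * (Cmod w * Cmod w) - e * (Cmod z * Cmod z)) with (e * (Cmod w + Cmod z) * (Cmod w - Cmod z)) by ring.
        rewrite Rabs_mult. apply Rmult_le_compat; auto using Rabs_pos.
        rewrite Rabs_right by nra. nra. }
      assert (A4 : e * (2 * (B + 1)) * Cmod (w - z) < eps / 2).
      { apply Rmult_lt_compat_l with (r := e * (2 * (B + 1))) in H2; [|nra].
        replace (e * (2 * (B + 1)) * (eps / (4 * e * (B + 1)))) with (eps / 2) in H2 by (field; lra). auto. }
      apply Rabs_le_between in A1. apply Rabs_le_between in A3. apply Rabs_def1; lra. }
  destruct (rcont_max K _ B Hcl HB Hrc) as [a [Ka Hmax]]; [eauto|]. simpl in Hmax.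
  assert (ha := Hmax z1 Kz1). assert (ba := HB a Ka). assert (ba0 := Cmod_ge_0 a).
  assert (E : e * (B * B + 1) = (Cmod (phi z1) - M) / 2) by (unfold e; field; nra).
  assert (Cmod a * Cmod a <= B * B) by nra.
  assert (Hbig : M < Cmod (phi a)) by nra.
  destruct (H a Ka) as [h|[s [Hs [HK [Hder Hca]]]]]; [lra|].
  destruct (unimodular_align (phi a)) as [c [hc hr]].
  (* By [Cmod_sq_expand] the added term is the harmonic part of [e * |w|^2] at [a]. The rest,
     [e * |w - a|^2], is constant on the circle and forces a strict drop by [e * s^2]. *)
  assert (Q : Re (c * phi a + RtoC (2 * e) * (Cconj a * (a - a)))%C <= Cmod (phi a) - e * (s * s)).
  { apply (circle_max (fun w => c * phi w + RtoC (2 * e) * (Cconj a * (w - a)))%C a s); auto.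
    - intros z Hz. destruct (Hder z Hz) as [d D]. eexists. apply cder_plus. apply cder_scal, D.
      apply cder_scal, cder_scal. apply cder_minus; [apply cder_id|apply cder_const].
    - apply ccont_plus. apply ccont_mult; [apply ccont_const|auto].
      eapply cder_ccont. apply cder_scal, cder_scal. apply cder_minus; [apply cder_id|apply cder_const].
    - intros w Hw. assert (hm := Hmax w ltac:(apply HK; lra)).
      rewrite (Cmod_sq_expand a w) in hm. rewrite Hw in hm.
      assert (h1 := Cmod_fst_le (c * phi w)%C). rewrite Cmod_mult, hc, Rmult_1_l in h1.
      assert (h2 := Rle_abs (fst (c * phi w)%C)).
      unfold Re. set (X := (Cconj a * (w - a))%C) in *.
      replace (fst (c * phi w + RtoC (2 * e) * X)%C) with (fst (c * phi w)%C + 2 * e * fst X) by (simpl; ring). nra. }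
  replace (c * phi a + RtoC (2 * e) * (Cconj a * (a - a)))%C with (c * phi a)%C in Q by ring.
  rewrite hr in Q. assert (0 < e * (s * s)) by (apply Rmult_lt_0_compat; nra). lra.
Qed.

Lemma closed_ball_closed (c : C) (r : R) : closedC (fun z => Cmod (z - c) <= r).
Proof.
  intros z n. apply Rnot_le_lt in n. exists (Cmod (z - c) - r). split; [lra|].
  intros w Hw h. assert (t := Cmod_triangle3 z w c). rewrite Cmod_sym in Hw. lra.
Qed.

Lemma ball_bounded (c : C) (r : R) : forall z : C, Cmod (z - c) <= r -> Cmod z <= Cmod c + r.
Proof. intros z Hz. assert (h := Cmod_sub_le z c). lra. Qed.

(* At an interior minimum of |f - u| a nonzero derivative gives a descent direction. *)
Lemma open_map_disc (f : C -> C) (c u : C) (r mu : R) : 0 < r ->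
  (forall z : C, Cmod (z - c) <= r -> exists d : C, d <> 0 /\ cder f z d) ->
  (forall z : C, Cmod (z - c) = r -> mu <= Cmod (f z - f c)) -> Cmod (u - f c) < mu / 2 ->
  exists z : C, Cmod (z - c) < r /\ f z = u.
Proof.
  intros Hr Hd Hmu Hu.
  destruct (rcont_max (fun z => Cmod (z - c) <= r) (fun z => - Cmod (f z - u)) (Cmod c + r)) as [a [Ka Hmax]].
  - apply closed_ball_closed.
  - apply ball_bounded.
  - intros z Kz e He. destruct (Hd z Kz) as [d [_ D]]. apply cder_ccont in D. destruct (D e He) as [del [Hdel H]].
    exists del. split; auto. intros w _ Hw. eapply Rle_lt_trans; [|apply (H w Hw)].
    replace (- Cmod (f w - u) - - Cmod (f z - u)) with (- (Cmod (f w - u) - Cmod (f z - u))) by ring.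
    rewrite Rabs_Ropp. eapply Rle_trans; [apply Rabs_Cmod_sub|].
    right. f_equal. ring.
  - exists c. rewrite Cmod_self. lra.
  - assert (Hmin : forall z : C, Cmod (z - c) <= r -> Cmod (f a - u) <= Cmod (f z - u)).
    { intros z Kz. specialize (Hmax z Kz). simpl in Hmax. lra. } clear Hmax.
    assert (hc := Hmin c ltac:(rewrite Cmod_self; lra)). rewrite (Cmod_sym (f c)) in hc.
    assert (Hin : Cmod (a - c) < r).
    { apply Rnot_le_lt. intros h. assert (hb := Hmu a ltac:(lra)).
      assert (t := Cmod_triangle3 (f a) u (f c)). lra. }
    exists a. split; auto. apply Cmod_sub_eq_0. destruct (Rle_lt_or_eq_dec _ _ (Cmod_ge_0 (f a - u))) as [hp|]; auto. exfalso.
    destruct (Hd a Ka) as [d [nd D]]. assert (hd : 0 < Cmod d) by (apply Cmod_gt_0; auto).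
    destruct (D (Cmod d / 2)) as [del [Hdel Hder]]; [lra|].
    set (m := Cmod (f a - u)) in *.
    (* A Newton step towards [u], shortened by [tau] so that it stays in the disc and within the
       range [del] of the derivative estimate. The error being at most half the gain, [|f - u|]
       drops by at least [tau * m / 2]. *)
    set (tau := Rmin (1 / 2) (Rmin ((r - Cmod (a - c)) / 2) (del / 2) / (m / Cmod d))).
    assert (hq : 0 < m / Cmod d) by (apply Rdiv_lt_0_compat; auto).
    assert (ht0 : 0 < tau).
    { apply Rmin_glb_lt; [lra|]. apply Rdiv_lt_0_compat; auto. apply Rmin_glb_lt; lra. }
    assert (ht1 : tau <= 1 / 2) by apply Rmin_l.
    assert (ht2 : tau * (m / Cmod d) <= Rmin ((r - Cmod (a - c)) / 2) (del / 2)).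
    { apply Rle_trans with (Rmin ((r - Cmod (a - c)) / 2) (del / 2) / (m / Cmod d) * (m / Cmod d)).
      apply Rmult_le_compat_r; [lra|apply Rmin_r]. right. field. lra. }
    set (w := (a - RtoC tau * ((f a - u) / d))%C).
    assert (Ew : (w - a)%C = (- (RtoC tau * ((f a - u) / d)))%C) by (unfold w; ring).
    assert (Hw : Cmod (w - a) = tau * (m / Cmod d)).
    { rewrite Ew, Cmod_opp, Cmod_mult, Cmod_R, Rabs_right by lra. rewrite Cmod_div by auto. auto. }
    assert (hr1 := Rmin_l ((r - Cmod (a - c)) / 2) (del / 2)). assert (hr2 := Rmin_r ((r - Cmod (a - c)) / 2) (del / 2)).
    assert (Kw : Cmod (w - c) <= r). { assert (t := Cmod_triangle3 w a c). lra. }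
    specialize (Hder w ltac:(lra)). specialize (Hmin w Kw).
    assert (t := Cmod_triangle (f w - f a - d * (w - a)) (RtoC (1 - tau) * (f a - u))).
    replace (f w - f a - d * (w - a) + RtoC (1 - tau) * (f a - u))%C with (f w - u)%C in t.
    2:{ rewrite Ew, RtoC_minus. field. auto. }
    rewrite Cmod_mult, Cmod_R, Rabs_right in t by lra. fold m in t.
    rewrite Hw in Hder. replace (Cmod d / 2 * (tau * (m / Cmod d))) with (tau * m / 2) in Hder by (field; lra).
    assert (0 < tau * m) by nra. lra.
Qed.

(** * Inverse branches and the Bloch bound *)

Lemma closure_C (U : C -> Prop) (z : C) :
  closure U z <-> forall eps, 0 < eps -> exists w : C, U w /\ Cmod (w - z) < eps.
Proof.
  split; intros H e He; destruct (H e He) as [w [h1 h2]]; exists w; split; auto.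
  - rewrite Cnorm_Cmod in h2. exact h2.
  - rewrite Cnorm_Cmod. exact h2.
Qed.

Lemma closure_self (U : C -> Prop) (z : C) : U z -> closure U z.
Proof. intros h. apply closure_C. intros e He. exists z. rewrite Cmod_self. auto. Qed.

Lemma closure_closed (U : C -> Prop) (z : C) :
  (forall eps, 0 < eps -> exists w : C, closure U w /\ Cmod (w - z) < eps) -> closure U z.
Proof.
  intros H. apply closure_C. intros e He. destruct (H (e / 2)) as [w [h1 h2]]; [lra|].
  destruct (proj1 (closure_C U w) h1 (e / 2)) as [v [h3 h4]]; [lra|]. exists v. split; auto.
  assert (t := Cmod_triangle3 v w z). lra.
Qed.

Lemma closedC_closure (U : C -> Prop) : closedC (closure U).
Proof.
  intros z n. apply NNPP. intros hn. apply n. apply closure_closed. intros e He.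
  apply NNPP. intros h. apply hn. exists e. split; auto. intros w Hw cw. apply h. eauto.
Qed.

Lemma pow2_small (K e : R) : 0 < e -> exists N, K / 2 ^ N < e.
Proof.
  intros He. assert (hp : forall n, 0 < 2 ^ n) by (intros; apply pow_lt; lra).
  destruct (Pow_x_infinity 2) with (b := Rabs K / e + 1) as [N HN]; [rewrite Rabs_right; lra|].
  exists N. specialize (HN N (Nat.le_refl _)). rewrite Rabs_right in HN by (apply Rle_ge, pow_le; lra).
  apply Rmult_lt_reg_r with (2 ^ N); auto. unfold Rdiv at 1. rewrite Rmult_assoc, Rinv_l, Rmult_1_r by (apply Rgt_not_eq, hp).
  assert (h : Rabs K / e < 2 ^ N) by lra. apply Rmult_lt_compat_l with (r := e) in h; auto.
  replace (e * (Rabs K / e)) with (Rabs K) in h by (field; lra). assert (q := Rle_abs K). lra.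
Qed.

Lemma Cauchy_geom (a : nat -> C) (K : R) : (forall n, Cmod (a (S n) - a n) <= K / 2 ^ n) ->
  exists l : C, forall n, Cmod (a n - l) <= 2 * K / 2 ^ n.
Proof.
  intros H.
  assert (hp : forall n, 0 < 2 ^ n) by (intros; apply pow_lt; lra).
  assert (Hnk : forall n k, Cmod (a (n + k)%nat - a n) <= 2 * K / 2 ^ n - 2 * K / 2 ^ (n + k)).
  { intros n k. induction k.
    - rewrite Nat.add_0_r, Cmod_self. lra.
    - rewrite Nat.add_succ_r. assert (t := Cmod_triangle3 (a (S (n + k))) (a (n + k)%nat) (a n)).
      specialize (H (n + k)%nat).
      assert (2 * K / 2 ^ (n + k) - 2 * K / 2 ^ S (n + k) = K / 2 ^ (n + k)) by (simpl; field; apply Rgt_not_eq, hp). lra. }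
  assert (HK : 0 <= K).
  { specialize (H 0%nat). simpl in H. assert (h := Cmod_ge_0 (a 1%nat - a 0%nat)). lra. }
  assert (Hb : forall n m, (n <= m)%nat -> Cmod (a m - a n) <= 2 * K / 2 ^ n).
  { intros n m l. assert (h := Hnk n (m - n)%nat). replace (n + (m - n))%nat with m in h by lia.
    assert (0 <= 2 * K / 2 ^ m) by (apply Rle_mult_inv_pos; [lra|auto]). lra. }
  assert (Hcc : forall phi : C -> R, (forall u v, Rabs (phi u - phi v) <= Cmod (u - v)) -> Cauchy_crit (fun n => phi (a n))).
  { intros phi Hphi e He. destruct (pow2_small (2 * K) (e / 2)) as [N HN]; [lra|]. exists N. intros n m hn hm. unfold Rdist.
    eapply Rle_lt_trans; [apply Hphi|].
    assert (t := Cmod_triangle3 (a n) (a N) (a m)). assert (h1 := Hb N n hn). assert (h2 := Hb N m hm).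
    rewrite Cmod_sym in h2. lra. }
  destruct (Rcomplete.R_complete _ (Hcc fst Rabs_Re_sub_le)) as [lx Hx].
  destruct (Rcomplete.R_complete _ (Hcc snd Rabs_Im_sub_le)) as [ly Hy].
  exists (lx, ly). intros n. apply Rnot_lt_le. intros hl.
  set (e := Cmod (a n - (lx, ly)) - 2 * K / 2 ^ n) in *.
  destruct (Hx (e / 2)) as [N1 H1]; [unfold e; lra|]. destruct (Hy (e / 2)) as [N2 H2]; [unfold e; lra|].
  set (m := (n + N1 + N2)%nat). specialize (H1 m ltac:(unfold m; lia)). specialize (H2 m ltac:(unfold m; lia)).
  unfold Rdist in H1, H2. assert (h := Hb n m ltac:(unfold m; lia)). rewrite Cmod_sym in h.
  assert (t := Cmod_triangle3 (a n) (a m) (lx, ly)). assert (q := Cmod_le_fst_snd (a m - (lx, ly))). simpl in q.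
  unfold Rminus in H1, H2. unfold e in *. lra.
Qed.

Lemma halfplane_nbhd (u w : C) : Cmod (w - u) < Re u -> 0 < Re w.
Proof. intros h. assert (t := Re_sub_le u w). rewrite Cmod_sym in t. lra. Qed.

Lemma Re_segment (u v : C) (t : R) : 0 <= t <= 1 -> 0 < Re u -> 0 < Re v -> 0 < Re (v + RtoC t * (u - v))%C.
Proof.
  intros Ht hu hv. unfold Re in *. simpl.
  replace (fst v + (t * (fst u + - fst v) - 0 * (snd u + - snd v))) with ((1 - t) * fst v + t * fst u) by ring.
  destruct (Req_dec t 0) as [->|]; [lra|]. assert (0 < t * fst u) by (apply Rmult_lt_0_compat; lra).
  assert (0 <= (1 - t) * fst v) by (apply Rmult_le_pos; lra). lra.
Qed.

(** The interface through which the analysis sees a single tract. [tm_no2pi] is the form in which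
    injectivity of exp is used: it limits both the discs contained in a tract (Bloch) and the length
    of vertical cuts. *)
Record tract_map (T : C -> Prop) (F : C -> C) : Prop := {
  tm_open : forall z, T z -> exists r, 0 < r /\ forall w : C, Cmod (w - z) < r -> T w;
  tm_der : forall z, T z -> exists d, cder F z d /\ 2 <= Cmod d;
  tm_inj : forall z w, T z -> T w -> F z = F w -> z = w;
  tm_pos : forall z, T z -> 0 < Re (F z);
  tm_surj : forall u, 0 < Re u -> exists z, T z /\ F z = u;
  tm_cont : ccont_on (closure T) F;
  tm_no2pi : forall w : C, T w -> T (w + (0, 2 * PI)%R)%C -> False }.

Section Inverse.
Variables (T : C -> Prop) (F : C -> C).
Hypothesis HT : tract_map T F.

Let g (u : C) : C := epsilon (inhabits (RtoC 0)) (fun w => T w /\ F w = u).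

Lemma g_spec u : 0 < Re u -> T (g u) /\ F (g u) = u.
Proof. intros h. apply (epsilon_spec (inhabits (RtoC 0)) (fun w => T w /\ F w = u)). apply HT. auto. Qed.

Lemma g_left w : T w -> g (F w) = w.
Proof. intros h. destruct (g_spec (F w)) as [h1 h2]; [apply HT; auto|]. apply (tm_inj _ _ HT); auto. Qed.

(** By injectivity the image of a small circle around [g u] keeps a distance [m > 0] from [u];
    [open_map_disc] then finds, for every value within [m / 2] of [u], a preimage inside the circle,
    and that preimage is the value of [g]. *)
Lemma g_ccont u : 0 < Re u -> ccont g u.
Proof.
  intros Hu e He. destruct (g_spec u Hu) as [Tz Fz]. set (z := g u) in *.
  destruct (tm_open _ _ HT z Tz) as [r0 [Hr0 HO]].
  set (r := Rmin e (r0 / 2)). assert (Hr : 0 < r) by (apply Rmin_glb_lt; lra).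
  assert (r1 : r <= e) by apply Rmin_l. assert (r2 : r <= r0 / 2) by apply Rmin_r.
  assert (HTr : forall w : C, Cmod (w - z) <= r -> T w) by (intros w Hw; apply HO; lra).
  destruct (rcont_max (fun w => Cmod (w - z) = r) (fun w => - Cmod (F w - F z)) (Cmod z + r)) as [a [Ka Hmax]].
  - intros w n. exists (Rabs (Cmod (w - z) - r)). split; [apply Rabs_pos_lt; lra|].
    intros w' Hw' h. assert (t := Rabs_Cmod_sub (w - z) (w' - z)).
    replace (w - z - (w' - z))%C with (w - w')%C in t by ring. rewrite h, (Cmod_sym w w') in t. lra.
  - intros w Hw. apply ball_bounded. lra.
  - intros w Kw e' He'. destruct (tm_der _ _ HT w) as [d [D _]]; [apply HTr; lra|]. apply cder_ccont in D.
    destruct (D e' He') as [del [Hdel H]]. exists del. split; auto. intros v _ Hv.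
    eapply Rle_lt_trans; [|apply (H v Hv)].
    replace (- Cmod (F v - F z) - - Cmod (F w - F z)) with (- (Cmod (F v - F z) - Cmod (F w - F z))) by ring.
    rewrite Rabs_Ropp. eapply Rle_trans; [apply Rabs_Cmod_sub|]. right. f_equal. ring.
  - exists (z + RtoC r)%C. replace (z + RtoC r - z)%C with (RtoC r) by ring. rewrite Cmod_R. apply Rabs_right. lra.
  - simpl in Hmax. set (m := Cmod (F a - F z)) in *.
    assert (Hm : 0 < m).
    { apply Cmod_gt_0. apply Csub_ne. intros h. apply (tm_inj _ _ HT) in h; auto; [|apply HTr; lra].
      rewrite h, Cmod_self in Ka. lra. }
    exists (m / 2). split; [lra|]. intros v Hv.
    destruct (open_map_disc F z v r m) as [w [h1 h2]]; auto.
    + intros w Hw. destruct (tm_der _ _ HT w) as [d [D hd]]; [apply HTr; lra|]. exists d. split; auto.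
      apply Cmod_gt_0. lra.
    + intros w Hw. specialize (Hmax w Hw). lra.
    + rewrite Fz. lra.
    + rewrite <- h2, g_left by (apply HTr; lra). lra.
Qed.

Lemma g_cder u : 0 < Re u -> exists d, cder g u d /\ Cmod d <= 1 / 2 /\ d <> 0.
Proof.
  intros Hu. destruct (g_spec u Hu) as [Tz Fz]. destruct (tm_der _ _ HT (g u) Tz) as [d [D hd]].
  assert (hd0 : d <> 0) by (apply Cmod_gt_0; lra).
  set (s := slope F (g u) d).
  exists (/ d)%C. split.
  - apply cder_eq with (/ s (g u))%C; [|unfold s; rewrite slope_at; auto].
    apply (cder_of_slope g (fun v => / s (g v))%C u (Re u) Hu).
    + intros v Hv. apply halfplane_nbhd in Hv. destruct (g_spec v Hv) as [Tv Fv].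
      assert (E := slope_eq F (g u) d (g v)). rewrite Fz, Fv in E. fold s in E.
      destruct (classic (s (g v) = 0)) as [h|h].
      * exfalso. rewrite h in E. assert (v = u). { replace v with ((v - u) + u)%C by ring. rewrite E. ring. }
        subst v. unfold s in h. rewrite slope_at in h. auto.
      * rewrite E. field. auto.
    + apply (ccont_comp Cinv (fun v => s (g v))).
      * apply (ccont_comp s g). apply g_ccont; auto. apply slope_ccont; auto.
      * apply ccont_inv. unfold s. rewrite slope_at. auto.
  - rewrite Cmod_inv by auto. split.
    + replace (1 / 2) with (/ 2) by field. apply Rinv_le_contravar; lra.
    + apply Cmod_gt_0. rewrite Cmod_inv by auto. apply Rinv_0_lt_compat. lra.
Qed.

Lemma expand_T z w : T z -> T w -> 2 * Cmod (z - w) <= Cmod (F z - F w).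
Proof.
  intros Tz Tw. assert (h := mean_value_ineq g (F w) (F z) (1 / 2)).
  rewrite !g_left in h by auto. assert (H : Cmod (z - w) <= 1 / 2 * Cmod (F z - F w)); [|lra].
  apply h. intros t Ht. destruct (g_cder (F w + RtoC t * (F z - F w))%C) as [d [D [hd _]]]; [|eauto].
  apply Re_segment; auto; apply HT; auto.
Qed.

Lemma expand_cl z w : closure T z -> closure T w -> 2 * Cmod (z - w) <= Cmod (F z - F w).
Proof.
  intros Cz Cw. apply Rnot_lt_le. intros hl. set (e := (2 * Cmod (z - w) - Cmod (F z - F w)) / 8).
  assert (He : 0 < e) by (unfold e; lra).
  destruct (tm_cont _ _ HT z Cz e He) as [d1 [Hd1 H1]]. destruct (tm_cont _ _ HT w Cw e He) as [d2 [Hd2 H2]].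
  destruct (proj1 (closure_C T z) Cz (Rmin d1 e)) as [z' [Tz' hz']]; [apply Rmin_glb_lt; auto|].
  destruct (proj1 (closure_C T w) Cw (Rmin d2 e)) as [w' [Tw' hw']]; [apply Rmin_glb_lt; auto|].
  destruct (Rlt_Rmin hz') as [a1 a2].
  destruct (Rlt_Rmin hw') as [b1 b2].
  specialize (H1 z' (closure_self _ _ Tz') a1). specialize (H2 w' (closure_self _ _ Tw') b1).
  assert (X := expand_T z' w' Tz' Tw').
  assert (t1 := Cmod_triangle3 (F z') (F z) (F w')). assert (t2 := Cmod_triangle3 (F z) (F w) (F w')).
  assert (t3 := Cmod_triangle3 z z' w). assert (t4 := Cmod_triangle3 z' w' w).
  rewrite (Cmod_sym z z') in t3. rewrite (Cmod_sym (F w) (F w')) in t2. unfold e in *. lra.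
Qed.

Lemma inj_cl z w : closure T z -> closure T w -> F z = F w -> z = w.
Proof.
  intros Cz Cw E. apply Cmod_sub_eq_0. assert (h := expand_cl z w Cz Cw). rewrite E, Cmod_self in h.
  assert (h2 := Cmod_ge_0 (z - w)). lra.
Qed.

Lemma Re_F_cl z : closure T z -> 0 <= Re (F z).
Proof.
  intros Cz. apply Rnot_lt_le. intros hl. destruct (tm_cont _ _ HT z Cz (- Re (F z))) as [d [Hd H]]; [lra|].
  destruct (proj1 (closure_C T z) Cz d Hd) as [w [Tw hw]].
  specialize (H w (closure_self _ _ Tw) hw). assert (h := tm_pos _ _ HT w Tw). assert (h2 := Re_sub_le (F w) (F z)). lra.
Qed.

Lemma interior_cl z : closure T z -> 0 < Re (F z) -> T z.
Proof.
  intros Cz h. destruct (g_spec (F z) h) as [h1 h2]. rewrite <- (inj_cl (g (F z)) z); auto. apply closure_self; auto.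
Qed.

(** Boundary values come from contraction: the preimages of [u + 2^-n] form a Cauchy sequence
    because the inverse branch shrinks distances by 1/2, and continuity of [F] on the closure
    identifies the limit. *)
Lemma surj_cl u : 0 <= Re u -> exists w, closure T w /\ F w = u.
Proof.
  intros Hu.
  assert (hp : forall n, 0 < 2 ^ n) by (intros; apply pow_lt; lra).
  set (v := fun n => (u + RtoC (/ 2 ^ n))%C).
  assert (Hv : forall n, 0 < Re (v n)).
  { intros n. unfold v, Re in *. simpl. assert (h := Rinv_0_lt_compat _ (hp n)). lra. }
  set (a := fun n => g (v n)).
  destruct (Cauchy_geom a 1) as [l Hl].
  { intros n. unfold a. destruct (g_spec (v n) (Hv n)) as [h1 h2]. destruct (g_spec (v (S n)) (Hv (S n))) as [h3 h4].
    assert (X := expand_T _ _ h3 h1). rewrite h2, h4 in X.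
    assert (E : (v (S n) - v n)%C = RtoC (- / 2 ^ S n)).
    { unfold v. replace (u + RtoC (/ 2 ^ S n) - (u + RtoC (/ 2 ^ n)))%C with (RtoC (/ 2 ^ S n) - RtoC (/ 2 ^ n))%C by ring.
      rewrite <- RtoC_minus. f_equal. simpl. field. apply Rgt_not_eq, hp. }
    rewrite E, Cmod_R, Rabs_Ropp, Rabs_right in X by (apply Rle_ge, Rlt_le, Rinv_0_lt_compat, hp).
    assert (/ 2 ^ S n <= / 2 ^ n). { apply Rinv_le_contravar; auto. simpl. assert (h := hp n). lra. }
    unfold Rdiv. assert (h := Cmod_ge_0 (g (v (S n)) - g (v n))). lra. }
  assert (Cl : closure T l).
  { apply closure_C. intros e He. destruct (pow2_small (2 * 1) e He) as [N HN]. exists (a N). split.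
    apply (g_spec (v N) (Hv N)). specialize (Hl N). lra. }
  exists l. split; auto. apply Cmod_small_eq. intros e He.
  destruct (tm_cont _ _ HT l Cl (e / 2)) as [d [Hd H]]; [lra|].
  destruct (pow2_small (2 * 1) (Rmin d (e / 2))) as [N HN]; [apply Rmin_glb_lt; lra|].
  destruct (Rlt_Rmin HN) as [N1 N2].
  destruct (g_spec (v N) (Hv N)) as [h1 h2].
  specialize (H (a N) (closure_self _ _ h1)). specialize (Hl N). specialize (H ltac:(lra)).
  unfold a in H. rewrite h2 in H. assert (t := Cmod_triangle3 (F l) (v N) u). rewrite (Cmod_sym (F l) (v N)) in t.
  assert (E : Cmod (v N - u) = / 2 ^ N).
  { unfold v. replace (u + RtoC (/ 2 ^ N) - u)%C with (RtoC (/ 2 ^ N)) by ring.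
    rewrite Cmod_R, Rabs_right; auto. apply Rle_ge, Rlt_le, Rinv_0_lt_compat, hp. }
  unfold Rdiv in N2. lra.
Qed.

End Inverse.

(** The inverse branch on the closed half-plane: by [inj_cl] and [surj_cl] the choice there is
    unique. Outside the closed half-plane the value is arbitrary. *)
Definition tinv (T : C -> Prop) (F : C -> C) (u : C) : C :=
  epsilon (inhabits (RtoC 0)) (fun w => closure T w /\ F w = u).

Section Inverse2.
Variables (T : C -> Prop) (F : C -> C).
Hypothesis HT : tract_map T F.
Local Notation G := (tinv T F).

Lemma tinv_spec u : 0 <= Re u -> closure T (G u) /\ F (G u) = u.
Proof.
  intros h. apply (epsilon_spec (inhabits (RtoC 0)) (fun w => closure T w /\ F w = u)). apply surj_cl; auto.
Qed.

Lemma tinv_left w : closure T w -> G (F w) = w.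
Proof.
  intros h. destruct (tinv_spec (F w)) as [h1 h2]; [apply (Re_F_cl T F); auto|]. apply (inj_cl T F); auto.
Qed.

Lemma tinv_int u : 0 < Re u -> T (G u).
Proof.
  intros h. destruct (tinv_spec u) as [h1 h2]; [lra|]. apply (interior_cl T F); auto. rewrite h2. auto.
Qed.

Lemma F_tinv u : 0 <= Re u -> F (G u) = u.
Proof. apply tinv_spec. Qed.

Lemma tinv_lip u v : 0 <= Re u -> 0 <= Re v -> Cmod (G u - G v) <= Cmod (u - v) / 2.
Proof.
  intros hu hv. destruct (tinv_spec u hu) as [h1 h2]. destruct (tinv_spec v hv) as [h3 h4].
  assert (X := expand_cl T F HT _ _ h1 h3). rewrite h2, h4 in X. lra.
Qed.

Lemma tinv_cder u : 0 < Re u -> exists d, cder G u d /\ Cmod d <= 1 / 2 /\ d <> 0.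
Proof.
  intros Hu. destruct (g_cder T F HT u Hu) as [d [D hd]]. exists d. split; auto.
  eapply cder_ext_loc; [apply Hu| |apply D]. intros w Hw. apply halfplane_nbhd in Hw.
  destruct (g_spec T F HT w Hw) as [h1 h2]. destruct (tinv_spec w) as [h3 h4]; [lra|].
  apply (inj_cl T F); auto. apply closure_self; auto. rewrite h2, h4. auto.
Qed.

Lemma tinv_ccont u : 0 < Re u -> ccont G u.
Proof. intros h. destruct (tinv_cder u h) as [d [D _]]. eapply cder_ccont; eauto. Qed.

End Inverse2.

(** [bloch_step] produces a disc of radius [|G'| * r / 64] inside the tract, and such a disc has
    radius at most pi, which gives [64 * PI]; the other factor 2 arises because [bloch_iterate]
    starts with [r = Re u / 2]. *)
Definition bloch_const : R := 128 * PI.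

Lemma bloch_const_pos : 0 < bloch_const.
Proof. unfold bloch_const. assert (h := PI_RGT_0). lra. Qed.

Section Bloch.
Variables (T : C -> Prop) (F : C -> C).
Hypothesis HT : tract_map T F.
Local Notation G := (tinv T F).

Let dG (u : C) : C := epsilon (inhabits (RtoC 0)) (fun d => cder G u d /\ Cmod d <= 1 / 2 /\ d <> 0).

Lemma dG_spec u : 0 < Re u -> cder G u (dG u) /\ Cmod (dG u) <= 1 / 2 /\ dG u <> 0.
Proof.
  intros h. apply (epsilon_spec (inhabits (RtoC 0)) (fun d => cder G u d /\ Cmod d <= 1 / 2 /\ d <> 0)).
  apply tinv_cder; auto.
Qed.

Lemma cder_shift (f : C -> C) (a z d : C) : cder f (a + z) d -> cder (fun w => f (a + w)%C) z d.
Proof.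
  intros H. apply cder_eq with (d * (0 + 1))%C; [|ring]. apply (cder_comp f (fun w => a + w)%C); auto.
  apply cder_plus; [apply cder_const|apply cder_id].
Qed.

Lemma disc_halfplane u v r : r <= Re u -> Cmod (v - u) < r -> 0 < Re v.
Proof. intros h1 h2. apply (halfplane_nbhd u). lra. Qed.

(** A Cauchy estimate that avoids second derivatives. The function [psi z = G (a + z) - G (u + z)]
    has derivative [dG a - dG u] at 0, and the mean value inequality bounds it by [2 * m * |a - u|]
    for [|z| <= r / 2]. The maximum principle for the slope of [psi] at 0 divides its oscillation by
    the radius [r / 2]. *)
Lemma bloch_lip u r m a : 0 < r -> r <= Re u -> (forall v : C, Cmod (v - u) < r -> Cmod (dG v) <= 2 * m) ->
  Cmod (a - u) < r / 2 -> Cmod (dG a - dG u) <= 8 * m / r * Cmod (a - u).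
Proof.
  intros Hr Hru Hm Ha.
  assert (Hin : forall v : C, Cmod (v - u) < r -> 0 < Re v) by (intros v hv; apply (disc_halfplane u v r); auto).
  destruct (unimodular_align (dG a - dG u)) as [c [hc hre]].
  set (psi := fun z => (G (a + z) - G (u + z))%C).
  assert (Hps : forall z : C, Cmod z <= r / 2 -> cder psi z (dG (a + z) - dG (u + z))).
  { intros z Hz. apply cder_minus; apply cder_shift; apply dG_spec; apply Hin.
    - replace (a + z - u)%C with ((a - u) + z)%C by ring. assert (t := Cmod_triangle (a - u) z). lra.
    - replace (u + z - u)%C with z by ring. lra. }
  set (d0 := (dG (a + 0) - dG (u + 0))%C).
  assert (H0 : cder psi 0 d0) by (apply Hps; rewrite Cmod_0; lra).
  assert (Q : Re (c * slope psi 0 d0 0)%C <= 8 * m / r * Cmod (a - u)).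
  { apply (circle_max (fun z => c * slope psi 0 d0 z)%C 0 (r / 2)); [lra| | |].
    - intros z Hz. replace (z - 0)%C with z in Hz by ring.
      assert (nz : z <> 0) by (apply Cmod_gt_0; lra).
      destruct (slope_cder psi 0 d0 z _ nz (Hps z ltac:(lra))) as [e' E]. eexists. apply cder_scal, E.
    - apply ccont_mult; [apply ccont_const|]. apply slope_ccont; auto.
    - intros z Hz. replace (z - 0)%C with z in Hz by ring.
      assert (nz : z <> 0) by (apply Cmod_gt_0; lra).
      assert (h := Cmod_fst_le (c * slope psi 0 d0 z)%C). rewrite Cmod_mult, hc, Rmult_1_l in h.
      assert (h2 := Rle_abs (fst (c * slope psi 0 d0 z)%C)). unfold Re.
      rewrite slope_ne in * by auto. replace (z - 0)%C with z in * by ring.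
      rewrite Cmod_div in h by auto. rewrite Hz in h.
      assert (B : Cmod (psi z - psi 0) <= 4 * m * Cmod (a - u)).
      { assert (B1 : forall y : C, Cmod y <= r / 2 -> Cmod (G (a + y) - G (u + y)) <= 2 * m * Cmod (a - u)).
        { intros y Hy. replace (a - u)%C with ((a + y) - (u + y))%C by ring.
          apply mean_value_ineq. intros t Ht.
          set (p := (u + y + RtoC t * (a + y - (u + y)))%C).
          assert (hp : Cmod (p - u) < r).
          { unfold p. replace (u + y + RtoC t * (a + y - (u + y)) - u)%C with (y + RtoC t * (a - u))%C by ring.
            assert (tr := Cmod_triangle y (RtoC t * (a - u))). rewrite Cmod_mult, Cmod_R, Rabs_right in tr by lra.
            assert (t * Cmod (a - u) <= 1 * Cmod (a - u)) by (apply Rmult_le_compat_r; [apply Cmod_ge_0|lra]). lra. }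
          exists (dG p). split; [apply dG_spec; auto|auto]. }
        assert (b1 := B1 z ltac:(lra)). assert (b2 := B1 0 ltac:(rewrite Cmod_0; lra)).
        assert (t := Cmod_le_add (psi z) (psi 0)). unfold psi in *. lra. }
      apply Rle_trans with (4 * m * Cmod (a - u) / (r / 2)); [|right; field; lra].
      assert (Cmod (psi z - psi 0) / (r / 2) <= 4 * m * Cmod (a - u) / (r / 2)).
      { apply Rmult_le_compat_r; auto. apply Rlt_le, Rinv_0_lt_compat. lra. } lra. }
  rewrite slope_at in Q. unfold d0 in Q. replace (a + 0)%C with a in Q by ring. replace (u + 0)%C with u in Q by ring.
  rewrite hre in Q. exact Q.
Qed.

(** For [|v - u| <= r / 16], [bloch_lip] keeps [dG v] within [m / 2] of [dG u], so the image of that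
    circle stays at distance [m * r / 32] from [G u], and the tract contains a disc of half this
    radius. If the radius exceeded pi, the disc would contain [G u - i pi] and [G u + i pi], against
    [tm_no2pi]. *)
Lemma bloch_step u r : 0 < r -> r <= Re u ->
  (forall v : C, Cmod (v - u) < r -> Cmod (dG v) <= 2 * Cmod (dG u)) -> Cmod (dG u) * r <= 64 * PI.
Proof.
  intros Hr Hru Hm. set (m := Cmod (dG u)) in *. apply Rnot_lt_le. intros hl.
  assert (HPI := PI_RGT_0). assert (hm : 0 < m) by (apply Rnot_le_lt; intros h; assert (m * r <= 0) by nra; lra).
  assert (Hin : forall v : C, Cmod (v - u) < r -> 0 < Re v) by (intros v hv; apply (disc_halfplane u v r); auto).
  assert (L : forall v : C, Cmod (v - u) <= r / 16 -> m / 2 * Cmod (v - u) <= Cmod (G v - G u)).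
  { intros v Hv. assert (M := mean_value_ineq (fun w => G w - dG u * w)%C u v (m / 2)). simpl in M.
    assert (M' : Cmod (G v - dG u * v - (G u - dG u * u)) <= m / 2 * Cmod (v - u)).
    { apply M. intros t Ht. set (p := (u + RtoC t * (v - u))%C).
      assert (hp : Cmod (p - u) <= r / 16).
      { unfold p. replace (u + RtoC t * (v - u) - u)%C with (RtoC t * (v - u))%C by ring.
        rewrite Cmod_mult, Cmod_R, Rabs_right by lra. nra. }
      exists (dG p - dG u * 1)%C. split.
      - apply cder_minus. apply dG_spec. apply Hin. lra. apply cder_scal, cder_id.
      - replace (dG p - dG u * 1)%C with (dG p - dG u)%C by ring.
        eapply Rle_trans; [apply (bloch_lip u r m p); auto; lra|].
        apply Rle_trans with (8 * m / r * (r / 16)); [|right; field; lra].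
        apply Rmult_le_compat_l; auto. apply Rle_mult_inv_pos; lra. }
    assert (t := Cmod_sub_le (dG u * (v - u)) (- (G v - dG u * v - (G u - dG u * u)))).
    replace (dG u * (v - u) - - (G v - dG u * v - (G u - dG u * u)))%C with (G v - G u)%C in t by ring.
    rewrite Cmod_opp, Cmod_mult in t. fold m in t. lra. }
  assert (Hcov : forall w : C, Cmod (w - G u) < m * r / 32 / 2 -> T w).
  { intros w Hw. destruct (open_map_disc G u w (r / 16) (m * r / 32)) as [z [h1 h2]]; auto; [lra| | |].
    - intros z Hz. destruct (dG_spec z) as [h1 [_ h2]]; [apply Hin; lra|]. eauto.
    - intros z Hz. eapply Rle_trans; [|apply (L z); lra]. rewrite Hz. right. field.
    - rewrite <- h2. apply tinv_int; auto. apply Hin. lra. }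
  assert (hpi : forall s, Rabs s = PI -> T (G u + (0, s)%R)%C).
  { intros s Hs. apply Hcov. assert (E0 : forall b : C, (G u + b - G u)%C = b) by (intros; ring). rewrite E0.
    eapply Rle_lt_trans; [apply Cmod_le_fst_snd|]. simpl. rewrite Rabs_R0, Hs. lra. }
  apply (tm_no2pi _ _ HT (G u + (0, - PI)%R)%C).
  - apply hpi. rewrite Rabs_Ropp. apply Rabs_right. lra.
  - replace (G u + (0, (- PI)%R) + (0, (2 * PI)%R))%C with (G u + (0, PI)%R)%C.
    apply hpi. apply Rabs_right. lra.
    unfold Cplus; simpl. f_equal; ring.
Qed.

(* If |G'| more than doubles nearby, move there and halve the radius; this stops since |G'| <= 1/2. *)
Lemma bloch_iterate n : forall u r, 0 < r -> 2 * r <= Re u -> 1 <= 2 ^ n * Cmod (dG u) -> Cmod (dG u) * r <= 64 * PI.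
Proof.
  induction n; intros u r Hr Hru Hn.
  - simpl in Hn. destruct (dG_spec u) as [_ [h _]]; lra.
  - destruct (classic (exists v : C, Cmod (v - u) < r /\ 2 * Cmod (dG u) < Cmod (dG v))) as [[v [h1 h2]]|h].
    + assert (Hv : Cmod (dG v) * (r / 2) <= 64 * PI).
      { apply IHn; [lra| |].
        - assert (t := Re_sub_le u v). rewrite Cmod_sym in t. lra.
        - simpl in Hn. assert (0 < 2 ^ n) by (apply pow_lt; lra). nra. }
      nra.
    + apply bloch_step; auto; [lra|]. intros v Hv. apply Rnot_lt_le. intros hl. apply h. eauto.
Qed.

Lemma tinv_der_bound u : 0 < Re u -> exists d, cder G u d /\ Cmod d <= bloch_const / Re u.
Proof.
  intros Hu. destruct (dG_spec u Hu) as [h1 [_ h2]]. exists (dG u). split; auto.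
  apply Cmod_gt_0 in h2. destruct (pow2_small 1 (Cmod (dG u)) h2) as [N HN].
  assert (B : Cmod (dG u) * (Re u / 2) <= 64 * PI).
  { apply (bloch_iterate N); try lra. assert (hp : 0 < 2 ^ N) by (apply pow_lt; lra).
    apply Rmult_lt_compat_l with (r := 2 ^ N) in HN; auto. replace (2 ^ N * (1 / 2 ^ N)) with 1 in HN by (field; lra). lra. }
  apply Rmult_le_reg_r with (Re u); auto. unfold Rdiv, bloch_const. rewrite Rmult_assoc, Rinv_l by lra. lra.
Qed.

Lemma tinv_horizontal_bound y x1 x2 : 0 < x1 -> x1 <= x2 -> Cmod (G (x2, y) - G (x1, y)) <= bloch_const * (ln x2 - ln x1).
Proof.
  intros h1 h2. destruct (unimodular_align (G (x2, y) - G (x1, y))) as [c [hc hr]].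
  assert (E : forall s, ((0, y)%R + RtoC s * RtoC 1)%C = (s, y)).
  { intros s. unfold Cplus, Cmult, RtoC; simpl. f_equal; ring. }
  assert (P := path_growth (fun s => fst (c * G ((0, y)%R + RtoC s * RtoC 1))%C) (fun s => bloch_const * ln s) x1 x2 h2).
  assert (P' : fst (c * G ((0, y)%R + RtoC x2 * RtoC 1))%C - fst (c * G ((0, y)%R + RtoC x1 * RtoC 1))%C <= bloch_const * ln x2 - bloch_const * ln x1).
  { apply P. intros t Ht. destruct (tinv_der_bound (t, y)) as [d [D hd]]; [unfold Re; simpl; lra|].
    exists (fst (c * d * RtoC 1)%C), (bloch_const * / t). split; [|split].
    - apply (line_der (fun z => c * G z)%C). apply cder_scal. rewrite E. auto.
    - apply (derivable_pt_lim_scal ln bloch_const). apply derivable_pt_lim_ln. lra.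
    - assert (h := Cmod_fst_le (c * d * RtoC 1)%C). rewrite !Cmod_mult, hc, Cmod_1, Rmult_1_l, Rmult_1_r in h.
      assert (h3 := Rle_abs (fst (c * d * RtoC 1)%C)). unfold Re in hd. simpl fst in hd at 1. unfold Rdiv in hd. lra. }
  rewrite !E in P'. rewrite <- hr. unfold Re.
  replace (fst (c * (G (x2, y) - G (x1, y)))%C) with (fst (c * G (x2, y))%C - fst (c * G (x1, y))%C) by (simpl; ring). lra.
Qed.

Lemma tinv_vertical_bound x y1 y2 : 0 < x -> Cmod (G (x, y2) - G (x, y1)) <= bloch_const * (Rabs (y2 - y1) / x).
Proof.
  intros hx. apply Rle_trans with (bloch_const / x * Cmod ((x, y2) - (x, y1))%C).
  - apply mean_value_ineq. intros t Ht.
    replace ((x, y1) + RtoC t * ((x, y2) - (x, y1)))%C with ((x, y1 + t * (y2 - y1))%R : C).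
    + destruct (tinv_der_bound (x, y1 + t * (y2 - y1))) as [d [D hd]]; [exact hx|]. exists d. split; auto.
    + unfold Cplus, Cmult, Cminus, Copp, RtoC; simpl. f_equal; ring.
  - assert (h := vline_dist x y2 y1). assert (0 < bloch_const / x) by (apply Rdiv_lt_0_compat; auto; apply bloch_const_pos).
    replace (bloch_const * (Rabs (y2 - y1) / x)) with (bloch_const / x * Rabs (y2 - y1)) by (field; lra).
    apply Rmult_le_compat_l; lra.
Qed.

(* Hyperbolic length of the path from u to v that crosses at the larger of the two real parts. *)
Definition hyp_dist (u v : C) : R := Rabs (Im u - Im v) / Rmax (Re u) (Re v) + Rabs (ln (Re u) - ln (Re v)).

Lemma tinv_hyp_bound u v : 0 < Re u -> 0 < Re v -> Cmod (G u - G v) <= bloch_const * hyp_dist u v.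
Proof.
  assert (W : forall u v, 0 < Re u -> Re u <= Re v -> Cmod (G u - G v) <= bloch_const * hyp_dist u v).
  { intros [x1 y1] [x2 y2]. unfold hyp_dist, Re, Im; simpl. intros h1 h2. rewrite Rmax_right by auto.
    assert (t := Cmod_triangle3 (G (x1, y1)) (G (x2, y1)) (G (x2, y2))).
    assert (A := tinv_horizontal_bound y1 x1 x2 h1 h2). rewrite Cmod_sym in A. assert (B := tinv_vertical_bound x2 y2 y1 ltac:(lra)).
    assert (ln x1 <= ln x2) by (destruct h2 as [h2| ->]; [left; apply ln_increasing; auto|lra]).
    rewrite (Rabs_left1 (ln x1 - ln x2)) by lra. lra. }
  intros hu hv. destruct (Rle_dec (Re u) (Re v)); [auto|].
  rewrite Cmod_sym. eapply Rle_trans; [apply W; lra|]. unfold hyp_dist.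
  rewrite (Rabs_minus_sym (Im v)), (Rabs_minus_sym (ln (Re v))), Rmax_comm. lra.
Qed.

End Bloch.

(** * Schwarz-Pick for the half-plane and similarity of tract maps *)

Definition ccw (K : C -> Prop) (f : C -> C) (z : C) : Prop :=
  forall eps, 0 < eps -> exists del, 0 < del /\
    forall w : C, K w -> Cmod (w - z) < del -> Cmod (f w - f z) < eps.

(** Making [f] constant off [K] turns continuity relative to [K] into continuity at [z], so the
    rules for [ccont] carry over to boundary points. *)
Definition freeze (K : C -> Prop) (f : C -> C) (z w : C) : C :=
  if excluded_middle_informative (K w) then f w else f z.

Lemma freeze_at K f z : freeze K f z z = f z.
Proof. unfold freeze. destruct (excluded_middle_informative (K z)); auto. Qed.

Lemma ccw_freeze K f z : ccw K f z <-> ccont (freeze K f z) z.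
Proof.
  split; intros H e He; destruct (H e He) as [d [Hd H1]]; exists d; split; auto; intros w.
  - intros Hw. rewrite freeze_at. unfold freeze. destruct (excluded_middle_informative (K w)); auto.
    rewrite Cmod_self. auto.
  - intros Kw Hw. specialize (H1 w Hw). rewrite freeze_at in H1. unfold freeze in H1.
    destruct (excluded_middle_informative (K w)); tauto.
Qed.

Lemma ccont_ccw K f z : ccont f z -> ccw K f z.
Proof. intros H e He. destruct (H e He) as [d [Hd H1]]. exists d. auto. Qed.

Lemma ccw_plus K f g z : ccw K f z -> ccw K g z -> ccw K (fun w => f w + g w)%C z.
Proof.
  rewrite !ccw_freeze. intros Hf Hg. eapply ccont_ext_loc; [apply Rlt_0_1| |apply ccont_plus; [apply Hf|apply Hg]].
  intros w _. simpl. unfold freeze. destruct (excluded_middle_informative (K w)); auto.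
Qed.

Lemma ccw_mult K f g z : ccw K f z -> ccw K g z -> ccw K (fun w => f w * g w)%C z.
Proof.
  rewrite !ccw_freeze. intros Hf Hg. eapply ccont_ext_loc; [apply Rlt_0_1| |apply ccont_mult; [apply Hf|apply Hg]].
  intros w _. simpl. unfold freeze. destruct (excluded_middle_informative (K w)); auto.
Qed.

Lemma ccw_comp K f g z : ccw K g z -> ccont f (g z) -> ccw K (fun w => f (g w)) z.
Proof.
  rewrite !ccw_freeze. intros Hg Hf.
  eapply ccont_ext_loc; [apply Rlt_0_1| |apply (ccont_comp f (freeze K g z)); [apply Hg|rewrite freeze_at; auto]].
  intros w _. simpl. unfold freeze. destruct (excluded_middle_informative (K w)); auto.
Qed.

Lemma ccw_mono (K K' : C -> Prop) f z : (forall w, K w -> K' w) -> ccw K' f z -> ccw K f z.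
Proof. intros h H e He. destruct (H e He) as [d [Hd H1]]. exists d. auto. Qed.

(** Holomorphic self-maps of the half-plane, continuous up to the boundary, which preserve the
    boundary line; [hm_proper] says that they fix infinity. *)
Record halfplane_map (h : C -> C) : Prop := {
  hm_pos : forall u, 0 < Re u -> 0 < Re (h u);
  hm_bd : forall u, Re u = 0 -> Re (h u) = 0;
  hm_cont : ccont_on (fun u => 0 <= Re u) h;
  hm_der : forall u, 0 < Re u -> exists d, cder h u d;
  hm_proper : forall M, exists R0, forall u, 0 <= Re u -> R0 <= Cmod u -> M <= Cmod (h u) }.

(** The identity behind the pseudo-hyperbolic distance [|p - q| / |p + Cconj q|]: it is less than 1
    in the half-plane and equals 1 when [p] is on the boundary. *)
Lemma Cmod_reflect (p q : C) : Cmod (p + Cconj q) * Cmod (p + Cconj q) = Cmod (p - q) * Cmod (p - q) + 4 * Re p * Re q.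
Proof. rewrite !Cmod_sq. unfold Re. simpl. ring. Qed.

Lemma Cmod_reflect_bd (p q : C) : Re p = 0 -> Cmod (p + Cconj q) = Cmod (p - q).
Proof.
  intros h. assert (E := Cmod_reflect p q). rewrite h in E.
  assert (h1 := Cmod_ge_0 (p - q)). assert (h2 := Cmod_ge_0 (p + Cconj q)). nra.
Qed.

Lemma halfplane_closed_disc_closed R0 : closedC (fun u => 0 <= Re u /\ Cmod u <= R0).
Proof.
  intros z n. destruct (Rlt_dec (Re z) 0) as [h|h].
  - exists (- Re z). split; [lra|]. intros w Hw [h1 _]. assert (t := Re_sub_le w z). lra.
  -
    exists (Cmod z - R0). split; [lra|]. intros w Hw [_ h1]. assert (t := Cmod_sub_le z w). rewrite Cmod_sym in t. lra.
Qed.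

(** [u0] is a point where [phi] may be known only to be continuous, as for a slope. Diameter and arc
    are separate because the bounds on them have different reasons: boundary behaviour on the one,
    growth at infinity or interior estimates on the other. *)
Lemma max_modulus_half_disc (phi : C -> C) (u0 : C) (R0 M : R) :
  ccont_on (fun u => 0 <= Re u /\ Cmod u <= R0) phi ->
  (forall w, 0 < Re w -> w <> u0 -> exists d, cder phi w d) -> (forall w, 0 < Re w -> ccont phi w) ->
  (forall z, Re z = 0 -> Cmod z <= R0 -> Cmod (phi z) <= M) ->
  (forall z, 0 < Re z -> Cmod z = R0 -> Cmod (phi z) <= M) ->
  forall z, 0 <= Re z -> Cmod z <= R0 -> Cmod (phi z) <= M.
Proof.
  intros Hon Hd Hc B1 B2 u hu1 hu2.
  apply (max_modulus (fun u => 0 <= Re u /\ Cmod u <= R0) phi R0); auto.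
  - apply halfplane_closed_disc_closed.
  - intros z hz; apply hz.
  - intros z [hz1 hz2].
    destruct hz1 as [r1|r1]; [destruct hz2 as [r2|r2]|]; auto. right.
    assert (Hpun : exists e, 0 < e /\ forall w : C, 0 < Cmod (w - z) < e -> w <> u0).
    { destruct (classic (z = u0)) as [->|n].
      - exists 1. split; [lra|]. intros w hw ->. rewrite Cmod_self in hw. lra.
      - exists (Cmod (z - u0)). split; [apply Cmod_gt_0, Csub_ne; auto|]. intros w hw ->. rewrite Cmod_sym in hw. lra. }
    destruct Hpun as [e [he Hpun]].
    assert (s0 : 0 < Rmin (Rmin (Re z) (R0 - Cmod z)) e) by (repeat apply Rmin_glb_lt; lra).
    set (s := Rmin (Rmin (Re z) (R0 - Cmod z)) e / 2).
    assert (ss : s < Rmin (Rmin (Re z) (R0 - Cmod z)) e) by (unfold s; lra).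
    destruct (Rlt_Rmin ss) as [s1 s2]. destruct (Rlt_Rmin s1) as [s3 s4].
    exists s. split; [unfold s; lra|].
    assert (P : forall w : C, Cmod (w - z) <= s -> 0 < Re w) by (intros w Hw; apply (halfplane_nbhd z); lra).
    split; [|split; auto].
    + intros w Hw. assert (t1 := Cmod_sub_le w z). specialize (P w Hw). lra.
    + intros w Hw. apply Hd; [apply P; lra|]. apply Hpun. lra.
Qed.

Lemma near_one (b N eta : R) : 0 < eta -> 0 <= b -> b * (2 + eta) / eta + 1 <= N -> N + b <= (1 + eta) * (N - b).
Proof.
  intros He Hb HN.
  assert (h : b * (2 + eta) / eta * eta <= N * eta) by (apply Rmult_le_compat_r; lra).
  unfold Rdiv in h. rewrite Rmult_assoc, Rinv_l, Rmult_1_r in h by lra. nra.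
Qed.

(** The quotient [phi] of the pseudo-hyperbolic factors of [(h w, h u0)] and [(w, u0)] has modulus 1
    on the imaginary axis, and modulus tending to 1 at infinity since [h] is proper. The maximum
    principle on large half-discs gives [|phi| <= 1]; squaring and [Cmod_reflect] turn this into the
    form without denominators. *)
Lemma schwarz_pick (h : C -> C) (u0 u : C) : halfplane_map h -> 0 < Re u0 -> 0 < Re u ->
  Cmod (h u - h u0) * Cmod (h u - h u0) * (Re u * Re u0) <= Cmod (u - u0) * Cmod (u - u0) * (Re (h u) * Re (h u0)).
Proof.
  intros Hh Hu0 Hu.
  assert (hp0 := hm_pos _ Hh _ Hu0). assert (hp := hm_pos _ Hh _ Hu).
  set (psi := fun w => ((h w - h u0) * (w + Cconj u0) * / (h w + Cconj (h u0)))%C).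
  assert (Hnn : forall w, 0 <= Re w -> 0 <= Re (h w)).
  { intros w [hw|hw]; [left; apply (hm_pos _ Hh); auto|right; symmetry; apply (hm_bd _ Hh); auto]. }
  assert (Hden : forall p q : C, 0 <= Re p -> 0 < Re q -> (p + Cconj q)%C <> 0).
  { intros p q h1 h2 e. assert (Re (p + Cconj q)%C = Re p + Re q) by (unfold Re; simpl; auto). rewrite e in H. unfold Re in *. simpl in H. lra. }
  assert (Hden' : forall w, 0 <= Re w -> (h w + Cconj (h u0))%C <> 0) by (intros w hw; apply Hden; auto).
  assert (psi0 : psi u0 = 0) by (unfold psi; ring).
  assert (Hpd : forall w, 0 < Re w -> exists d, cder psi w d).
  { intros w hw. destruct (hm_der _ Hh w hw) as [d D].
    destruct (cder_div (fun w => (h w - h u0) * (w + Cconj u0))%C (fun w => h w + Cconj (h u0))%C w ((d - 0) * (w + Cconj u0) + (h w - h u0) * (1 + 0)) (d + 0)) as [e E].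
    - apply (cder_mult (fun w => h w - h u0)%C (fun w => w + Cconj u0)%C).
      + apply cder_minus; auto. apply cder_const.
      + apply cder_plus; [apply cder_id|apply cder_const].
    - apply cder_plus; auto. apply cder_const.
    - apply Hden'. lra.
    - exists e. exact E. }
  destruct (Hpd u0 Hu0) as [d0 D0]. set (phi := slope psi u0 d0).
  assert (Hval : forall w, w <> u0 -> 0 <= Re w ->
     Cmod (phi w) = Cmod (h w - h u0) * Cmod (w + Cconj u0) / Cmod (h w + Cconj (h u0)) / Cmod (w - u0)).
  { intros w nw hw. unfold phi. rewrite slope_ne by auto. rewrite psi0.
    replace (psi w - 0)%C with (psi w) by ring. rewrite Cmod_div by (apply Csub_ne; auto).
    unfold psi. rewrite !Cmod_mult, Cmod_inv by auto. unfold Rdiv. ring. }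
  assert (Hphid : forall w, 0 < Re w -> w <> u0 -> exists d, cder phi w d).
  { intros w hw nw. destruct (Hpd w hw) as [e E]. apply (slope_cder psi u0 d0 w e); auto. }
  assert (Hphic : forall w, 0 < Re w -> ccont phi w).
  { intros w hw. destruct (classic (w = u0)) as [->|nw]; [apply slope_ccont; auto|].
    destruct (Hphid w hw nw) as [e E]. eapply cder_ccont; eauto. }
  assert (Hle : forall e, 0 < e -> Cmod (phi u) <= 1 + e).
  { intros e He. set (eta := Rmin 1 (e / 3)). assert (eta0 : 0 < eta) by (apply Rmin_glb_lt; lra).
    assert (eta1 : eta <= 1) by apply Rmin_l. assert (eta2 : eta <= e / 3) by apply Rmin_r.
    set (b := Cmod (h u0)). set (c := Cmod u0).
    destruct (hm_proper _ Hh (b * (2 + eta) / eta + 1)) as [R1 HR1].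
    set (R0 := Rmax (Rmax R1 (Cmod u)) (c * (2 + eta) / eta + 1)).
    assert (R01 := Rmax_l (Rmax R1 (Cmod u)) (c * (2 + eta) / eta + 1)).
    assert (R02 := Rmax_r (Rmax R1 (Cmod u)) (c * (2 + eta) / eta + 1)).
    assert (R03 := Rmax_l R1 (Cmod u)). assert (R04 := Rmax_r R1 (Cmod u)). fold R0 in R01, R02.
    assert (hb : 0 <= b) by apply Cmod_ge_0. assert (hc : 0 <= c) by apply Cmod_ge_0.
    apply (max_modulus_half_disc phi u0 R0); auto; try lra.
    - intros z [hz1 hz2]. destruct hz1 as [hz1|hz1].
      + apply (ccont_ccw _ phi z). auto.
      + change (ccw (fun u => 0 <= Re u /\ Cmod u <= R0) phi z).
        apply ccw_mono with (K' := fun u => 0 <= Re u); [tauto|].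
        assert (nz : z <> u0) by (intros ->; lra).
        assert (X : ccw (fun w => 0 <= Re w) (fun w => psi w * / (w - u0))%C z).
        { assert (hid : ccw (fun w => 0 <= Re w) (fun w => w) z) by apply ccont_ccw, ccont_id.
          assert (hcst : forall q, ccw (fun w => 0 <= Re w) (fun _ => q) z) by (intros; apply ccont_ccw, ccont_const).
          assert (hh : ccw (fun w => 0 <= Re w) h z) by (exact (hm_cont _ Hh z ltac:(lra))).
          apply ccw_mult. unfold psi. apply ccw_mult. apply ccw_mult.
          - apply ccw_plus; auto.
          - apply ccw_plus; auto.
          - apply (ccw_comp _ Cinv (fun w => h w + Cconj (h u0))%C). apply ccw_plus; auto. apply ccont_inv, Hden'. lra.
          - apply (ccw_comp _ Cinv (fun w => w - u0)%C). apply ccw_plus; auto. apply ccont_inv, Csub_ne; auto. }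
        intros e' He'. destruct (X e' He') as [d [Hd H]].
        exists (Rmin d (Cmod (z - u0))). split; [apply Rmin_glb_lt; auto; apply Cmod_gt_0, Csub_ne; auto|].
        intros w Kw Hw. destruct (Rlt_Rmin Hw) as [w1 w2].
        assert (nw : w <> u0). { intros ->. rewrite Cmod_sym in w2. lra. }
        unfold phi. rewrite !slope_ne by auto. specialize (H w Kw w1).
        rewrite psi0. unfold Cdiv. replace (psi w - 0)%C with (psi w) by ring. replace (psi z - 0)%C with (psi z) by ring. exact H.
    - intros z ez _. assert (nz : z <> u0) by (intros ->; lra).
      rewrite Hval by (auto; lra).
      rewrite (Cmod_reflect_bd z u0 ez), (Cmod_reflect_bd (h z) (h u0)) by (apply (hm_bd _ Hh); auto).
      assert (q1 : 0 < Cmod (z - u0)) by (apply Cmod_gt_0, Csub_ne; auto).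
      assert (q2 : 0 < Cmod (h z - h u0)).
      { apply Cmod_gt_0, Csub_ne. intros e1. assert (q := hm_bd _ Hh z ez). rewrite e1 in q. lra. }
      apply Rle_trans with 1; [|lra]. right. field. lra.
    - intros z r1 ez.
      assert (B1 := near_one b (Cmod (h z)) eta eta0 hb ltac:(apply HR1; lra)).
      assert (B2 := near_one c (Cmod z) eta eta0 hc ltac:(lra)).
      assert (cc : 0 <= c * (2 + eta) / eta) by (apply Rle_mult_inv_pos; auto; nra).
      assert (bb : 0 <= b * (2 + eta) / eta) by (apply Rle_mult_inv_pos; auto; nra).
      assert (bN := HR1 z ltac:(lra) ltac:(lra)).
      assert (zN : 0 < Cmod z - c) by nra. assert (hN : 0 < Cmod (h z) - b) by nra.
      assert (nz : z <> u0) by (intros ->; unfold c in zN; lra).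
      rewrite Hval by (auto; lra).
      assert (a1 := Cmod_le_add (h z) (h u0)). fold b in a1.
      assert (a2 := Cmod_triangle z (Cconj u0)). rewrite Cmod_conj in a2. fold c in a2.
      assert (a3 := Cmod_sub_le z u0). fold c in a3.
      assert (a4 := Cmod_sub_le (h z) (- Cconj (h u0))). rewrite Cmod_opp, Cmod_conj in a4. fold b in a4.
      replace (h z - - Cconj (h u0))%C with (h z + Cconj (h u0))%C in a4 by ring.
      set (A := Cmod (h z - h u0)) in *. set (Bq := Cmod (z + Cconj u0)) in *. set (D := Cmod (h z + Cconj (h u0))) in *. set (E := Cmod (z - u0)) in *.
      assert (hA : 0 <= A) by apply Cmod_ge_0. assert (hB : 0 <= Bq) by apply Cmod_ge_0.
      assert (A <= (1 + eta) * D) by (assert (q := Rmult_le_compat_l (1 + eta) _ _ ltac:(lra) a4); lra).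
      assert (Bq <= (1 + eta) * E) by (assert (q := Rmult_le_compat_l (1 + eta) _ _ ltac:(lra) a3); lra).
      assert (D0' : 0 < D) by lra. assert (E0' : 0 < E) by lra.
      assert (A * Bq <= ((1 + eta) * D) * ((1 + eta) * E)) by (apply Rmult_le_compat; auto).
      apply Rle_trans with ((1 + eta) * (1 + eta)); [|nra].
      apply Rmult_le_reg_r with (D * E); [nra|].
      replace (A * Bq / D / E * (D * E)) with (A * Bq) by (field; lra). lra. }
  destruct (classic (u = u0)) as [->|nu]; [rewrite !Cmod_self; lra|].
  assert (H1 : Cmod (phi u) <= 1).
  { apply Rnot_lt_le. intros hl. specialize (Hle ((Cmod (phi u) - 1) / 2)). lra. }
  rewrite Hval in H1 by (auto; lra).
  assert (q1 : 0 < Cmod (u - u0)) by (apply Cmod_gt_0, Csub_ne; auto).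
  assert (q2 : 0 < Cmod (h u + Cconj (h u0))) by (apply Cmod_gt_0, Hden'; lra).
  assert (S1 := Cmod_reflect u u0). assert (S2 := Cmod_reflect (h u) (h u0)).
  set (A := Cmod (h u - h u0)) in *. set (Bq := Cmod (u + Cconj u0)) in *. set (D := Cmod (h u + Cconj (h u0))) in *. set (E := Cmod (u - u0)) in *.
  assert (H2 : A * Bq <= E * D).
  { apply Rmult_le_compat_r with (r := D * E) in H1; [|nra]. replace (A * Bq / D / E * (D * E)) with (A * Bq) in H1 by (field; lra). lra. }
  assert (hA : 0 <= A) by apply Cmod_ge_0. assert (hB : 0 <= Bq) by apply Cmod_ge_0.
  assert (H3 : (A * Bq) * (A * Bq) <= (E * D) * (E * D)) by (apply Rmult_le_compat; auto; nra).
  assert (H4 : (A * A) * (Bq * Bq) <= (E * E) * (D * D)) by lra. rewrite S1, S2 in H4. lra.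
Qed.

(* Two mutually inverse self-maps are hyperbolic isometries; letting one point tend to infinity,
   an isometry fixing infinity scales all real parts by the same factor. *)
Lemma halfplane_similarity (h k : C -> C) : halfplane_map h -> halfplane_map k ->
  (forall u, 0 < Re u -> k (h u) = u) ->
  exists a, 0 < a /\ forall u v, 0 < Re u -> 0 < Re v ->
    Re (h u) = a * Re u /\ Cmod (h u - h v) = a * Cmod (u - v).
Proof.
  intros Hh Hk Hkh.
  assert (E : forall u v, 0 < Re u -> 0 < Re v ->
    Cmod (h u - h v) * Cmod (h u - h v) * (Re u * Re v) = Cmod (u - v) * Cmod (u - v) * (Re (h u) * Re (h v))).
  { intros u v hu hv. apply Rle_antisym; [apply schwarz_pick; auto|].
    assert (P := schwarz_pick k (h v) (h u) Hk (hm_pos _ Hh v hv) (hm_pos _ Hh u hu)).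
    rewrite !Hkh in P by auto. lra. }
  assert (L : forall u v, 0 < Re u -> 0 < Re v -> Re (h v) / Re v <= Re (h u) / Re u).
  { intros u v hu hv. assert (pu := hm_pos _ Hh u hu). assert (pv := hm_pos _ Hh v hv).
    set (A := Re (h u) / Re u). set (B := Re (h v) / Re v).
    assert (hA : 0 < A) by (apply Rdiv_lt_0_compat; auto). assert (hB : 0 < B) by (apply Rdiv_lt_0_compat; auto).
    assert (eA : Re (h u) = A * Re u) by (unfold A; field; lra).
    assert (eB : Re (h v) = B * Re v) by (unfold B; field; lra).
    apply Rnot_lt_le. intros hl.
    (* Replacing distances to the far point [t] by those from 0 costs a factor at most
       [(1 + eta)^4 <= 1 + 15 * eta] in the comparison below; this [eta] keeps it under [B / A]. *)
    set (eta := Rmin 1 ((B / A - 1) / 16)).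
    assert (hBA : 1 < B / A). { apply Rmult_lt_reg_r with A; auto. unfold Rdiv. rewrite Rmult_assoc, Rinv_l by lra. lra. }
    assert (eta0 : 0 < eta) by (apply Rmin_glb_lt; lra).
    assert (eta1 : eta <= 1) by apply Rmin_l. assert (eta2 : eta <= (B / A - 1) / 16) by apply Rmin_r.
    set (b := Cmod u + Cmod v + Cmod (h u) + Cmod (h v)).
    assert (n1 := Cmod_ge_0 u). assert (n2 := Cmod_ge_0 v). assert (n3 := Cmod_ge_0 (h u)). assert (n4 := Cmod_ge_0 (h v)).
    assert (hb : 0 <= b) by (unfold b; lra).
    set (Q := b * (2 + eta) / eta + 1).
    assert (Q0 : 0 <= b * (2 + eta) / eta) by (apply Rle_mult_inv_pos; auto; nra).
    assert (Qb : b < Q). { unfold Q. apply Rle_lt_trans with (b * (2 + eta) / eta); [|lra].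
      apply Rle_div_r; [auto|]. nra. }
    destruct (hm_proper _ Hh Q) as [R1 HR1].
    set (t := Rmax R1 Q). assert (t1 : R1 <= t) by apply Rmax_l. assert (t2 : Q <= t) by apply Rmax_r.
    assert (ht : 0 < t) by (unfold Q in *; lra).
    assert (Rt : Re (RtoC t) = t) by reflexivity. assert (Ct : Cmod (RtoC t) = t) by (rewrite Cmod_R, Rabs_right; lra).
    assert (hN := HR1 (RtoC t) ltac:(lra) ltac:(lra)). set (N := Cmod (h (RtoC t))) in *.
    assert (B1 := near_one b N eta eta0 hb hN). assert (B2 := near_one b t eta eta0 hb t2).
    assert (Eu := E u (RtoC t) hu ltac:(lra)). assert (Ev := E v (RtoC t) hv ltac:(lra)).
    rewrite eA, Rt in Eu. rewrite eB, Rt in Ev.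
    assert (ph := hm_pos _ Hh (RtoC t) ltac:(lra)). set (X := Re (h (RtoC t))) in *.
    assert (u1 : N - b <= Cmod (h u - h (RtoC t))) by (assert (q := Cmod_sub_le (h (RtoC t)) (h u)); rewrite Cmod_sym in q; unfold N, b; lra).
    assert (v1 : Cmod (h v - h (RtoC t)) <= N + b) by (assert (q := Cmod_le_add (h v) (h (RtoC t))); unfold N, b; lra).
    assert (u2 : Cmod (u - RtoC t) <= t + b) by (assert (q := Cmod_le_add u (RtoC t)); rewrite Ct in q; unfold b; lra).
    assert (v2 : t - b <= Cmod (v - RtoC t)) by (assert (q := Cmod_sub_le (RtoC t) v); rewrite Cmod_sym, Ct in q; unfold b; lra).
    set (hu' := Cmod (h u - h (RtoC t))) in *. set (hv' := Cmod (h v - h (RtoC t))) in *.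
    set (u' := Cmod (u - RtoC t)) in *. set (v' := Cmod (v - RtoC t)) in *.
    assert (hv0 : 0 <= hv') by apply Cmod_ge_0. assert (u0 : 0 <= u') by apply Cmod_ge_0.
    assert (hu0 : 0 < hu') by (unfold Q in *; lra). assert (v0 : 0 < v') by (unfold Q in *; lra).
    assert (Eu' : hu' * hu' * t = u' * u' * (A * X)) by (apply Rmult_eq_reg_r with (Re u); lra).
    assert (Ev' : hv' * hv' * t = v' * v' * (B * X)) by (apply Rmult_eq_reg_r with (Re v); lra).
    assert (S1 : hv' <= (1 + eta) * hu') by (assert (q := Rmult_le_compat_l (1 + eta) _ _ ltac:(lra) u1); lra).
    assert (S2 : u' <= (1 + eta) * v') by (assert (q := Rmult_le_compat_l (1 + eta) _ _ ltac:(lra) v2); lra).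
    assert (C2 : (hv' * u') * (hv' * u') * A = (hu' * v') * (hu' * v') * B).
    { apply Rmult_eq_reg_r with (t * X); [|nra].
      replace (hv' * u' * (hv' * u') * A * (t * X)) with ((hv' * hv' * t) * (u' * u' * (A * X))) by ring.
      rewrite <- Eu', Ev'. ring. }
    assert (S3 : hv' * u' <= ((1 + eta) * hu') * ((1 + eta) * v')) by (apply Rmult_le_compat; auto).
    set (y := hu' * v') in *. set (x := hv' * u') in *. assert (y0 : 0 < y) by (unfold y; nra).
    assert (x0 : 0 <= x) by (unfold x; nra).
    assert (S3' : x <= ((1 + eta) * (1 + eta)) * y) by (unfold y; lra).
    assert (q3 : (1 + eta) * (1 + eta) <= 1 + 3 * eta) by nra.
    assert (S4 : x <= (1 + 3 * eta) * y) by (apply Rmult_le_compat_r with (r := y) in q3; lra).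
    assert (S5 : x * x <= ((1 + 3 * eta) * y) * ((1 + 3 * eta) * y)) by (apply Rmult_le_compat; auto).
    assert (S6 : x * x <= (1 + 15 * eta) * (y * y)).
    { assert ((1 + 3 * eta) * (1 + 3 * eta) <= 1 + 15 * eta) by nra. assert (0 < y * y) by nra. nra. }
    assert (S7 : y * y * B <= (1 + 15 * eta) * (y * y) * A) by (rewrite <- C2; apply Rmult_le_compat_r; lra).
    assert (S8 : B <= (1 + 15 * eta) * A) by (apply Rmult_le_reg_r with (y * y); nra).
    assert (S9 : A * eta <= (B - A) / 16).
    { apply Rle_trans with (A * ((B / A - 1) / 16)); [apply Rmult_le_compat_l; lra|]. right. field. lra. }
    lra. }
  set (a := Re (h (RtoC 1)) / Re (RtoC 1)).
  assert (h1 : 0 < Re (RtoC 1)) by (unfold Re; simpl; lra).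
  assert (ha : 0 < a) by (apply Rdiv_lt_0_compat; auto; apply (hm_pos _ Hh); auto).
  assert (S : forall u, 0 < Re u -> Re (h u) = a * Re u).
  { intros u hu. assert (e : Re (h u) / Re u = a) by (apply Rle_antisym; apply L; auto).
    rewrite <- e. field. lra. }
  exists a. split; auto. intros u v hu hv. split; auto.
  assert (e := E u v hu hv). rewrite !S in e by auto.
  assert (q1 := Cmod_ge_0 (h u - h v)). assert (q2 := Cmod_ge_0 (u - v)).
  set (x := Cmod (h u - h v)) in *. set (y := Cmod (u - v)) in *.
  assert (e2 : x * x = (a * y) * (a * y)).
  { apply Rmult_eq_reg_r with (Re u * Re v); [|nra]. rewrite e. ring. }
  assert (0 <= a * y) by nra. apply Rsqr_inj; auto.
Qed.

Section Proper.
Variables (T : C -> Prop) (F : C -> C).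
Hypothesis HT : tract_map T F.
Local Notation G := (tinv T F).

Lemma F_bounded B : exists M, forall z, closure T z -> Cmod z <= B -> Cmod (F z) <= M.
Proof.
  destruct (rcont_bounded (fun z => closure T z /\ Cmod z <= B) (fun z => Cmod (F z)) B) as [M HM].
  - intros z n. destruct (classic (closure T z)) as [h|h].
    + assert (B < Cmod z) by (apply Rnot_le_lt; intros h'; apply n; auto).
      exists (Cmod z - B). split; [lra|]. intros w Hw [_ hw]. assert (t := Cmod_sub_le z w). rewrite Cmod_sym in t. lra.
    + destruct (closedC_closure T z h) as [r [Hr H]]. exists r. split; auto. intros w Hw [hw _]. apply (H w); auto.
  - tauto.
  - intros z [Cz _] e He. destruct (tm_cont _ _ HT z Cz e He) as [d [Hd H]]. exists d. split; auto.
    intros w [Cw _] Hw. eapply Rle_lt_trans; [apply Rabs_Cmod_sub|]. auto.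
  - exists M. intros z h1 h2. apply HM. auto.
Qed.

Lemma tinv_proper M : exists R0, forall u, 0 <= Re u -> R0 <= Cmod u -> M <= Cmod (G u).
Proof.
  destruct (F_bounded M) as [M' HM']. exists (M' + 1). intros u hu hR. apply Rnot_lt_le. intros hl.
  destruct (tinv_spec T F HT u hu) as [h1 h2]. specialize (HM' (G u) h1 ltac:(lra)). rewrite h2 in HM'. lra.
Qed.
End Proper.

Lemma translate_closure (T1 T2 : C -> Prop) (tau : C) : (forall w : C, T1 w -> T2 (w + tau)%C) ->
  forall w : C, closure T1 w -> closure T2 (w + tau)%C.
Proof.
  intros H w Cw. apply closure_C. intros e He. destruct (proj1 (closure_C T1 w) Cw e He) as [v [h1 h2]].
  exists (v + tau)%C. split; auto. replace (v + tau - (w + tau))%C with (v - w)%C by ring. auto.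
Qed.

Lemma translate_halfplane_map (T1 T2 : C -> Prop) (F : C -> C) (tau : C) : tract_map T1 F -> tract_map T2 F ->
  (forall w : C, T1 w <-> T2 (w + tau)%C) -> halfplane_map (fun u => F (tinv T1 F u + tau)%C).
Proof.
  intros H1 H2 Htr.
  assert (Hcl : forall w : C, closure T1 w -> closure T2 (w + tau)%C) by (apply translate_closure; intros; apply Htr; auto).
  constructor.
  - intros u hu. apply (tm_pos _ _ H2). apply Htr. apply tinv_int; auto.
  - intros u hu. destruct (tinv_spec T1 F H1 u) as [h1 h2]; [lra|].
    assert (h3 := Re_F_cl T2 F H2 _ (Hcl _ h1)).
    destruct h3 as [h3|h3]; auto. exfalso. apply (interior_cl T2 F H2) in h3; auto. apply Htr in h3.
    apply (tm_pos _ _ H1) in h3. rewrite h2 in h3. lra.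
  - intros u hu e He. destruct (tinv_spec T1 F H1 u hu) as [h1 h2].
    destruct (tm_cont _ _ H2 (tinv T1 F u + tau)%C (Hcl _ h1) e He) as [d [Hd H]]. exists d. split; auto.
    intros w hw Hw. destruct (tinv_spec T1 F H1 w hw) as [h3 h4]. apply H; auto.
    replace (tinv T1 F w + tau - (tinv T1 F u + tau))%C with (tinv T1 F w - tinv T1 F u)%C by ring.
    assert (q := tinv_lip T1 F H1 w u hw hu). lra.
  - intros u hu. destruct (tinv_cder T1 F H1 u hu) as [d [D _]].
    destruct (tm_der _ _ H2 (tinv T1 F u + tau)%C) as [d' [D' _]]; [apply Htr, tinv_int; auto|].
    exists (d' * (d + 0))%C. apply (cder_comp F (fun u => tinv T1 F u + tau)%C); auto.
    apply cder_plus; auto. apply cder_const.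
  (* If [F (z + tau)] is bounded, the contraction of the inverse branch of [T2] bounds [z + tau],
     and then [F_bounded] in [T1] bounds [u = F z]. *)
  - intros M. destruct (F_bounded T1 F H1 (Cmod (tinv T2 F (RtoC 0)) + Rabs M + Cmod tau)) as [M' HM'].
    exists (M' + 1). intros u hu hR. apply Rnot_lt_le. intros hl.
    destruct (tinv_spec T1 F H1 u hu) as [h1 h2]. set (z := tinv T1 F u) in *.
    assert (q := tinv_left T2 F H2 _ (Hcl _ h1)).
    assert (q2 := tinv_lip T2 F H2 (F (z + tau)%C) (RtoC 0) (Re_F_cl T2 F H2 _ (Hcl _ h1)) ltac:(unfold Re; simpl; lra)).
    rewrite q in q2. replace (F (z + tau)%C - 0)%C with (F (z + tau)%C) in q2 by ring.
    assert (t := Cmod_sub_le (z + tau)%C (tinv T2 F (RtoC 0))). assert (t2 := Cmod_sub_le z (- tau)%C).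
    rewrite Cmod_opp in t2. replace (z - - tau)%C with (z + tau)%C in t2 by ring.
    assert (t3 := Rle_abs M). assert (t4 := Rabs_pos M).
    specialize (HM' z h1 ltac:(lra)). rewrite h2 in HM'. lra.
Qed.

(** Going back by the branch of [T1], translating and applying [F] is an automorphism of the
    half-plane that fixes infinity, with inverse of the same kind; [halfplane_similarity] applies.
    This is the only relation between the values of [F] on two tracts. *)
Lemma tract_similarity (T1 T2 : C -> Prop) (F : C -> C) (tau : C) : tract_map T1 F -> tract_map T2 F ->
  (forall w : C, T1 w <-> T2 (w + tau)%C) ->
  exists a, 0 < a /\ forall z w : C, T1 z -> T1 w ->
    Re (F (z + tau)%C) = a * Re (F z) /\ Cmod (F (z + tau)%C - F (w + tau)%C) = a * Cmod (F z - F w).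
Proof.
  intros H1 H2 Htr.
  assert (Htr' : forall w : C, T2 w <-> T1 (w + - tau)%C).
  { intros w. rewrite Htr. replace (w + - tau + tau)%C with w by ring. tauto. }
  destruct (halfplane_similarity (fun u => F (tinv T1 F u + tau)%C) (fun u => F (tinv T2 F u + - tau)%C)) as [a [ha H]].
  - apply (translate_halfplane_map T1 T2); auto.
  - apply (translate_halfplane_map T2 T1); auto.
  - intros u hu. assert (h := tinv_int T1 F H1 u hu). apply Htr in h.
    rewrite (tinv_left T2 F H2) by (apply closure_self; auto).
    replace (tinv T1 F u + tau + - tau)%C with (tinv T1 F u) by ring. apply F_tinv; auto. lra.
  - exists a. split; auto. intros z w Tz Tw.
    specialize (H (F z) (F w) (tm_pos _ _ H1 z Tz) (tm_pos _ _ H1 w Tw)).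
    rewrite !(tinv_left T1 F H1) in H by (apply closure_self; auto). exact H.
Qed.

(** * Bounds uniform over all tracts *)

Definition period (n : Z) : C := (0, 2 * PI * IZR n).

Lemma Re_add_period (w : C) n : Re (w + period n)%C = Re w.
Proof. unfold Re; simpl. ring. Qed.

Lemma tract_translate (T0 : C -> Prop) n (w : C) : tract T0 0 w <-> tract T0 n (w + period n)%C.
Proof.
  unfold tract.
  replace (Csub w (0, 2 * PI * IZR 0)) with w.
  - replace (Csub (w + period n)%C (0, 2 * PI * IZR n)) with w; [tauto|].
    unfold Csub, period, Cplus; destruct w; simpl; f_equal; ring.
  - unfold Csub; destruct w; simpl; f_equal; ring.
Qed.

Section Setup.
Variables (T0 : C -> Prop) (F : C -> C).
Hypothesis HF : Blog_n_translates T0 F.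

Lemma blog_tract n : tract_map (tract T0 n) F.
Proof.
  destruct HF as [[HO _] [_ [_ [_ [_ [Hc [He Hd]]]]]]].
  destruct (Hc n) as [Hhol [Hinj [Hpos [Hsurj Hcont]]]].
  constructor.
  - intros z Tz. unfold tract in Tz. destruct (HO _ Tz) as [r [Hr H]]. exists r. split; [lra|].
    intros w Hw. unfold tract. apply H. rewrite Cnorm_Cmod.
    replace (Csub (Csub w (0, 2 * PI * IZR n)) (Csub z (0, 2 * PI * IZR n))) with (w - z)%C; auto.
    unfold Csub, Cminus, Cplus, Copp; simpl. f_equal; ring.
  - intros z Tz. destruct (Hhol z Tz) as [d D]. exists d. split; [apply has_cderiv_cder; auto|].
    specialize (Hd n z d Tz D). rewrite Cnorm_Cmod in Hd. lra.
  - exact Hinj.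
  - intros z Tz. apply Hpos. auto.
  - intros u hu. destruct (Hsurj u) as [w hw]; [lra|]. eauto.
  - intros z Cz e Hep. destruct (Hcont z Cz e) as [d [Hd' H]]; [lra|]. exists d. split; [lra|].
    intros w Cw Hw. specialize (H w Cw). rewrite !Cnorm_Cmod in H. apply H. exact Hw.
  - intros w T1 T2.
    assert (E : w = (w + (0, 2 * PI)%R)%C).
    { apply (He n); auto. unfold Cexp, Cplus; simpl. rewrite Rplus_0_r, cos_plus, sin_plus, cos_2PI, sin_2PI. f_equal; ring. }
    apply (f_equal snd) in E. simpl in E. assert (h := PI_RGT_0). lra.
Qed.

Lemma blog_similarity n : exists a, 0 < a /\ forall z w : C, tract T0 0 z -> tract T0 0 w ->
    Re (F (z + period n)%C) = a * Re (F z) /\ Cmod (F (z + period n)%C - F (w + period n)%C) = a * Cmod (F z - F w).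
Proof.
  apply (tract_similarity (tract T0 0) (tract T0 n)); try apply blog_tract. intros w. apply tract_translate.
Qed.

Lemma blog_lower : exists m, forall n w, closure (tract T0 n) w -> m <= Re w.
Proof.
  destruct HF as [_ [[m Hm] _]]. exists m. intros n w Cw. apply Rnot_lt_le. intros hl.
  destruct (proj1 (closure_C (tract T0 n) w) Cw (m - Re w)) as [v [Tv hv]]; [lra|].
  assert (h := Hm _ Tv). unfold Re at 1, Csub in h. simpl in h.
  assert (t := Re_sub_le v w). unfold Re in *. lra.
Qed.

Hypothesis Hslope : forall n : Z, bounded_slope (tract T0 n).

(** The constants of tract 0 serve for all tracts, since translation by a period changes neither
    real parts nor differences of imaginary parts. *)
Lemma blog_slope : exists alpha beta, 0 < alpha /\ 0 < beta /\
  forall n w1 w2, closure (tract T0 n) w1 -> closure (tract T0 n) w2 ->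
  Rabs (Im w1 - Im w2) <= alpha * Rmax (Rmax (Re w1) (Re w2)) 0 + beta.
Proof.
  destruct (Hslope 0) as [al [be [ha [hb H]]]]. exists al, be. repeat split; auto; try lra.
  assert (H1 : forall n w1 w2, tract T0 n w1 -> tract T0 n w2 ->
    Rabs (Im w1 - Im w2) <= al * Rmax (Rmax (Re w1) (Re w2)) 0 + be).
  { intros n w1 w2 t1 t2.
    assert (Ht : forall w : C, tract T0 n w -> tract T0 0 (w + - period n)%C).
    { intros w hw. apply (tract_translate T0 n). replace (w + - period n + period n)%C with w by ring. auto. }
    assert (q := H _ _ (Ht _ t1) (Ht _ t2)). unfold Im, Re in *. simpl in q. rewrite !Ropp_0, !Rplus_0_r in q.
    replace (snd w1 + - (2 * PI * IZR n) - (snd w2 + - (2 * PI * IZR n))) with (snd w1 - snd w2) in q by ring. exact q. }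
  intros n w1 w2 c1 c2. apply Rnot_lt_le. intros hl.
  set (R := al * Rmax (Rmax (Re w1) (Re w2)) 0 + be) in *.
  set (e := (Rabs (Im w1 - Im w2) - R) / (2 * (2 + al))).
  assert (he : 0 < e) by (apply Rdiv_lt_0_compat; lra).
  assert (ee : e * (2 * (2 + al)) = Rabs (Im w1 - Im w2) - R) by (unfold e; field; lra).
  destruct (proj1 (closure_C (tract T0 n) w1) c1 e he) as [v1 [t1 h1]].
  destruct (proj1 (closure_C (tract T0 n) w2) c2 e he) as [v2 [t2 h2]].
  assert (q := H1 n v1 v2 t1 t2).
  assert (r1 := Re_sub_le v1 w1). assert (r2 := Re_sub_le v2 w2).
  assert (i1 := Rabs_Im_sub_le v1 w1). assert (i2 := Rabs_Im_sub_le v2 w2).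
  assert (mx : Rmax (Rmax (Re v1) (Re v2)) 0 <= Rmax (Rmax (Re w1) (Re w2)) 0 + e).
  { assert (m1 := Rmax_l (Re w1) (Re w2)). assert (m2 := Rmax_r (Re w1) (Re w2)).
    assert (m3 := Rmax_l (Rmax (Re w1) (Re w2)) 0). assert (m4 := Rmax_r (Rmax (Re w1) (Re w2)) 0).
    repeat apply Rmax_lub; lra. }
  assert (tr : Rabs (Im w1 - Im w2) <= Rabs (Im v1 - Im w1) + Rabs (Im v1 - Im v2) + Rabs (Im v2 - Im w2)).
  { split_Rabs; lra. }
  unfold R in *. nra.
Qed.

(** [tinv_proper] only says that the geodesic leaves every bounded set. As long as its real part is
    at most [B], bounded slope bounds its imaginary part as well, so it must leave to the right. *)
Lemma blog_ray n u B : 0 <= Re u -> exists t0, 0 <= t0 /\ forall t, t0 <= t -> B < Re (tinv (tract T0 n) F (u + RtoC t)%C).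
Proof.
  intros hu. destruct blog_slope as [al [be [ha [hb Hs]]]]. destruct blog_lower as [m Hm].
  assert (HT := blog_tract n). set (G := tinv (tract T0 n) F).
  set (S := Rmax (Rmax B (Re (G u))) 0).
  destruct (tinv_proper (tract T0 n) F HT (Rabs B + Rabs m + Rabs (Im (G u)) + (al * S + be) + 1)) as [R0 HR0].
  exists (Rabs R0). split; [apply Rabs_pos|]. intros t ht. apply Rnot_le_lt. intros hB.
  assert (t0 : 0 <= t) by (assert (h := Rabs_pos R0); lra).
  assert (hut : 0 <= Re (u + RtoC t)%C) by (unfold Re in *; simpl; lra).
  specialize (HR0 (u + RtoC t)%C hut). assert (hR : R0 <= Cmod (u + RtoC t)).
  { assert (h1 := Cmod_fst_le (u + RtoC t)%C). simpl in h1. assert (h2 := Rle_abs (fst u + t)). assert (h3 := Rle_abs R0). unfold Re in hu. lra. }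
  specialize (HR0 hR). fold G in HR0.
  destruct (tinv_spec (tract T0 n) F HT u hu) as [c1 _]. destruct (tinv_spec (tract T0 n) F HT (u + RtoC t)%C hut) as [c2 _].
  fold G in c1, c2, hB. assert (s := Hs n _ _ c2 c1). assert (l := Hm n _ c2).
  set (w := G (u + RtoC t)%C) in *.
  assert (mx : Rmax (Rmax (Re w) (Re (G u))) 0 <= S).
  { unfold S. assert (m1 := Rmax_l B (Re (G u))). assert (m2 := Rmax_r B (Re (G u))).
    assert (m3 := Rmax_l (Rmax B (Re (G u))) 0). assert (m4 := Rmax_r (Rmax B (Re (G u))) 0).
    repeat apply Rmax_lub; lra. }
  assert (al * Rmax (Rmax (Re w) (Re (G u))) 0 <= al * S) by (apply Rmult_le_compat_l; lra).
  assert (q := Cmod_le_fst_snd w).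
  assert (a1 : Rabs (fst w) <= Rabs B + Rabs m) by (unfold Re in *; unfold Rabs; repeat destruct Rcase_abs; lra).
  assert (a2 : Rabs (snd w) <= Rabs (Im (G u)) + (al * S + be)).
  { assert (Rabs (snd w) <= Rabs (Im (G u)) + Rabs (Im w - Im (G u))) by (unfold Im; unfold Rabs; repeat destruct Rcase_abs; lra). lra. }
  lra.
Qed.

Hypothesis Hwig : forall n : Z, bounded_wiggling (tract T0 n) F.

(** The similarity makes every geodesic of tract [n] the translate of one in tract 0, so [K] and
    [mu] do not depend on [n]. For tract 0 the starting point may lie on the boundary, which the
    gulf argument uses. *)
Lemma blog_wiggling : exists K mu, 1 < K /\ 0 < mu /\
  (forall u t, 0 <= Re u -> 0 <= t ->
     Rmax (Re (tinv (tract T0 0) F (u + RtoC t)%C)) 0 > Re (tinv (tract T0 0) F u) / K - mu) /\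
  (forall n u t, 0 < Re u -> 0 <= t ->
     Rmax (Re (tinv (tract T0 n) F (u + RtoC t)%C)) 0 > Re (tinv (tract T0 n) F u) / K - mu).
Proof.
  destruct (Hwig 0) as [K [mu [hK [hmu H]]]]. exists K, mu. repeat split; try lra.
  - intros u t hu ht. assert (HT := blog_tract 0).
    destruct (tinv_spec (tract T0 0) F HT u hu) as [c1 e1].
    destruct (tinv_spec (tract T0 0) F HT (u + RtoC t)%C) as [c2 e2]; [unfold Re in *; simpl; lra|].
    apply H; auto. split; auto. exists t. split; [lra|]. rewrite e1, e2. reflexivity.
  - intros n u t hu ht. assert (HT := blog_tract n). destruct (blog_similarity n) as [a [ha Hs]].
    set (G := tinv (tract T0 n) F).
    assert (hut : 0 < Re (u + RtoC t)%C) by (unfold Re in *; simpl; lra).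
    assert (Ht : forall v : C, 0 < Re v -> tract T0 0 (G v + - period n)%C).
    { intros v hv. apply (tract_translate T0 n). replace (G v + - period n + period n)%C with (G v) by ring. apply tinv_int; auto. }
    assert (h1 := Ht u hu). assert (h2 := Ht _ hut).
    set (z := (G u + - period n)%C) in *. set (w := (G (u + RtoC t) + - period n)%C) in *.
    assert (ez : (z + period n)%C = G u) by (unfold z; ring). assert (ew : (w + period n)%C = G (u + RtoC t)%C) by (unfold w; ring).
    destruct (Hs z w h1 h2) as [s1 s2]. destruct (Hs w z h2 h1) as [s3 _].
    rewrite ez, ew in *. unfold G in s1, s2, s3. assert (f1 := F_tinv (tract T0 n) F HT u ltac:(lra)). assert (f2 := F_tinv (tract T0 n) F HT (u + RtoC t)%C ltac:(lra)).
    rewrite f1 in s1, s2. rewrite f2 in s2, s3.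
    assert (E0 : (u - (u + RtoC t))%C = (- RtoC t)%C) by ring. rewrite E0 in s2.
    rewrite Cmod_opp, Cmod_R, Rabs_right in s2 by lra.
    assert (rz : Re z = Re (G u)) by (rewrite <- ez, Re_add_period; auto).
    assert (rw : Re w = Re (G (u + RtoC t)%C)) by (rewrite <- ew, Re_add_period; auto).
    rewrite <- rz, <- rw. apply H; [apply closure_self; auto|]. split; [apply closure_self; auto|].
    exists (t / a). split; [apply Rle_ge, Rle_mult_inv_pos; auto|].
    (* [F w] and [F z] are at distance [t / a], and their real parts already differ by [t / a];
       hence their imaginary parts agree and [w] lies on the geodesic from [z]. *)
    assert (dx : fst (F w) - fst (F z) = t / a).
    { unfold Re in s1, s3. simpl in s3. apply Rmult_eq_reg_l with a; [|lra].
      replace (a * (t / a)) with t by (field; lra). lra. }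
    assert (dm : Cmod (F z - F w) = t / a).
    { apply Rmult_eq_reg_l with a; [|lra]. replace (a * (t / a)) with t by (field; lra). lra. }
    assert (q := Cmod_sq (F z - F w)). rewrite dm in q. simpl in q.
    assert (dy : snd (F w) = snd (F z)).
    { assert (sq : (snd (F z) - snd (F w)) * (snd (F z) - snd (F w)) = 0).
      { assert (fst (F z) + - fst (F w) = - (t / a)) by lra. rewrite H0 in q. unfold Rminus. nra. }
      apply Rmult_integral in sq. lra. }
    destruct (F w) as [fx fy]. destruct (F z) as [gx gy]. simpl in *. unfold Cadd, Defs.RtoC; simpl. f_equal; lra.
Qed.

End Setup.

(** * Construction of the hair *)

Lemma lipschitz_continuity (f : R -> R) (L : R) : (forall a b, Rabs (f a - f b) <= L * Rabs (a - b)) -> continuity f.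
Proof.
  intros H x. apply continuity_pt_filterlim. apply continuous_eps. intros e He.
  assert (hL : 0 < Rabs L + 1) by (assert (h := Rabs_pos L); lra).
  exists (e / (Rabs L + 1)). split; [apply Rdiv_lt_0_compat; auto|]. intros s Hs.
  eapply Rle_lt_trans; [apply H|].
  apply Rmult_lt_compat_l with (r := Rabs L + 1) in Hs; auto.
  replace ((Rabs L + 1) * (e / (Rabs L + 1))) with e in Hs by (field; lra).
  assert (h1 := Rle_abs L). assert (h2 := Rabs_pos (s - x)). nra.
Qed.

Lemma exp_sub_ge (a b : R) : 0 <= a -> a <= b -> b - a <= exp b - exp a.
Proof.
  intros ha hab. replace (exp b) with (exp a * exp (b - a)) by (rewrite <- exp_plus; f_equal; ring).
  assert (h1 := exp_ineq1_le a). assert (h2 := exp_ineq1_le (b - a)). nra.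
Qed.

(* The inverse of d |-> ln((m(d) + d/(1+d))/x0), where m is the running maximum of rho; the
   bounded summand makes it strictly increasing. *)
Lemma running_max_inverse (rho : R -> R) (x0 L : R) : 0 <= L -> 2 * (L + 1) <= x0 -> rho 0 = x0 ->
  (forall a b, 0 <= a -> 0 <= b -> Rabs (rho a - rho b) <= L * Rabs (a - b)) ->
  (forall B, exists d, 0 <= d /\ B < rho d) ->
  exists del : R -> R, del 0 = 0 /\ (forall t, 0 <= t -> 0 <= del t) /\
    (forall t t', 0 <= t -> t <= t' -> 2 * (t' - t) <= del t' - del t) /\
    (forall t, 0 <= t -> forall eps, 0 < eps -> exists eta, 0 < eta /\
       forall t', 0 <= t' -> Rabs (t' - t) < eta -> Rabs (del t' - del t) < eps) /\
    (forall t, 0 <= t -> rho (del t) <= x0 * exp t /\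
       exists s, 0 <= s <= del t /\ x0 * exp t - 1 <= rho s).
Proof.
  intros HL Hx0 H0 Hlip Hunb.
  assert (Hmax : forall d, exists m, 0 <= d -> (forall s, 0 <= s <= d -> rho s <= m) /\ exists s, 0 <= s <= d /\ m = rho s).
  { intros d. destruct (Rle_dec 0 d) as [hd|hd]; [|exists 0; tauto].
    (* Clamping the argument at 0 gives a function continuous on the whole line. *)
    set (r' := fun x => rho (Rmax 0 x)).
    assert (Hc : continuity r').
    { apply (lipschitz_continuity r' L). intros a b. unfold r'. eapply Rle_trans; [apply Hlip; apply Rmax_l|].
      apply Rmult_le_compat_l; auto. unfold Rmax. destruct (Rle_dec 0 a), (Rle_dec 0 b); split_Rabs; lra. }
    destruct (continuity_ab_maj r' 0 d hd) as [M [h1 h2]]; [intros; apply Hc|].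
    exists (rho M). intros _. split; [|exists M; auto]. intros s Hs. specialize (h1 s Hs). unfold r' in h1.
    rewrite !Rmax_right in h1 by lra. auto. }
  destruct (choice _ Hmax) as [m Hm].
  set (Th := fun d => m d + d / (1 + d)).
  assert (Hm0 : m 0 = x0). { destruct (Hm 0 (Rle_refl 0)) as [_ [s [hs ->]]]. replace s with 0 by lra. auto. }
  assert (Hminc : forall d d', 0 <= d -> d <= d' -> 0 <= m d' - m d <= L * (d' - d)).
  { intros d d' hd hd'. destruct (Hm d hd) as [h1 [s [hs es]]]. destruct (Hm d') as [h2 [s' [hs' es']]]; [lra|]. split.
    - rewrite es. assert (rho s <= m d') by (apply h2; lra). lra.
    - destruct (Rle_dec s' d) as [c|c].
      + assert (rho s' <= m d) by (apply h1; lra). assert (0 <= L * (d' - d)) by (apply Rmult_le_pos; lra). lra.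
      + assert (h3 := h1 d ltac:(lra)). assert (h4 := Hlip s' d ltac:(lra) hd). rewrite (Rabs_right (s' - d)) in h4 by lra.
        apply Rabs_le_between in h4. assert (L * (s' - d) <= L * (d' - d)) by (apply Rmult_le_compat_l; lra). lra. }
  assert (Hfrac : forall d d', 0 <= d -> d < d' -> 0 < d' / (1 + d') - d / (1 + d) <= d' - d).
  { intros d d' hd hd'. replace (d' / (1 + d') - d / (1 + d)) with ((d' - d) / ((1 + d') * (1 + d))) by (field; lra).
    assert (1 <= (1 + d') * (1 + d)) by nra. split; [apply Rdiv_lt_0_compat; lra|].
    apply Rmult_le_reg_r with ((1 + d') * (1 + d)); [lra|]. unfold Rdiv. rewrite Rmult_assoc, Rinv_l by lra. nra. }
  assert (Hfr1 : forall d, 0 <= d -> 0 <= d / (1 + d) <= 1).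
  { intros d hd. split; [apply Rle_mult_inv_pos; lra|]. apply Rmult_le_reg_r with (1 + d); [lra|].
    unfold Rdiv. rewrite Rmult_assoc, Rinv_l by lra. lra. }
  assert (HTh : forall d d', 0 <= d -> d < d' -> 0 < Th d' - Th d <= (L + 1) * (d' - d)).
  { intros d d' hd hd'. unfold Th. assert (h1 := Hminc d d' hd ltac:(lra)). assert (h2 := Hfrac d d' hd hd'). lra. }
  assert (HTh0 : Th 0 = x0) by (unfold Th; rewrite Hm0; field).
  assert (Hsurj : forall y, exists d, x0 <= y -> 0 <= d /\ Th d = y).
  { intros y. destruct (Rle_dec x0 y) as [hy|hy]; [|exists 0; tauto].
    destruct (Hunb y) as [b [hb Hb]].
    assert (hTb : y < Th b). { unfold Th. destruct (Hm b hb) as [h1 _]. assert (h2 := h1 b ltac:(lra)). assert (h3 := Hfr1 b hb). lra. }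
    set (f := fun d => Th (Rmax 0 d) - y).
    assert (Hc : continuity f).
    { apply (lipschitz_continuity f (L + 1)). intros p q. unfold f.
      replace (Th (Rmax 0 p) - y - (Th (Rmax 0 q) - y)) with (Th (Rmax 0 p) - Th (Rmax 0 q)) by ring.
      assert (hp := Rmax_l 0 p). assert (hq := Rmax_l 0 q).
      assert (hpq : Rabs (Rmax 0 p - Rmax 0 q) <= Rabs (p - q)).
      { unfold Rmax. destruct (Rle_dec 0 p), (Rle_dec 0 q); split_Rabs; lra. }
      apply Rle_trans with ((L + 1) * Rabs (Rmax 0 p - Rmax 0 q)); [|apply Rmult_le_compat_l; lra].
      destruct (Rtotal_order (Rmax 0 p) (Rmax 0 q)) as [c|[c|c]].
      - assert (h := HTh _ _ hp c). rewrite !Rabs_left by lra. lra.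
      - rewrite c, !Rminus_diag, Rabs_R0. lra.
      - assert (h := HTh _ _ hq c). rewrite !Rabs_right by lra. lra. }
    destruct (IVT_cor f 0 b Hc hb) as [d [hd hf]].
    - unfold f. rewrite !Rmax_right by lra. rewrite HTh0. nra.
    - exists d. intros _. split; [lra|]. unfold f in hf. rewrite Rmax_right in hf by lra. lra. }
  destruct (choice _ Hsurj) as [inv Hinv].
  assert (Hexp : forall t, 0 <= t -> x0 <= x0 * exp t).
  { intros t ht. assert (h := exp_ineq1_le t). nra. }
  set (del := fun t => inv (x0 * exp t)).
  assert (Hdel : forall t, 0 <= t -> 0 <= del t /\ Th (del t) = x0 * exp t).
  { intros t ht. apply Hinv. auto. }
  assert (Hmono : forall t t', 0 <= t -> 0 <= t' -> Th (del t) <= Th (del t') -> del t <= del t').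
  { intros t t' ht ht' h. apply Rnot_lt_le. intros c. destruct (Hdel t' ht') as [h1 _]. assert (q := HTh _ _ h1 c). lra. }
  exists del. repeat split.
  - destruct (Hdel 0 (Rle_refl 0)) as [h1 h2]. rewrite exp_0, Rmult_1_r in h2.
    destruct (Req_dec (del 0) 0) as [e|n]; auto. assert (q := HTh 0 (del 0) (Rle_refl 0) ltac:(lra)). lra.
  - intros t ht. apply Hdel. auto.
  (* The doubling: [Th] is Lipschitz with constant [L + 1], while [x0 * exp t] grows at rate at
     least [x0 >= 2 * (L + 1)]. *)
  - intros t t' ht htt. destruct (Hdel t ht) as [h1 h2]. destruct (Hdel t') as [h3 h4]; [lra|].
    assert (e := exp_sub_ge t t' ht htt).
    assert (hle : Th (del t) <= Th (del t')) by (rewrite h2, h4; apply Rmult_le_compat_l; lra).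
    apply Hmono in hle; auto; [|lra].
    assert (q : Th (del t') - Th (del t) <= (L + 1) * (del t' - del t)).
    { destruct hle as [hle| ->]; [apply HTh; auto|lra]. }
    assert (x0 * (t' - t) <= x0 * (exp t' - exp t)) by (apply Rmult_le_compat_l; lra).
    assert ((L + 1) * (2 * (t' - t)) <= (L + 1) * (del t' - del t)).
    { assert ((2 * (L + 1)) * (t' - t) <= x0 * (t' - t)) by (apply Rmult_le_compat_r; lra). lra. }
    apply Rmult_le_reg_l with (L + 1); lra.
  - intros t ht eps Heps. destruct (Hdel t ht) as [h1 h2].
    assert (hup := HTh (del t) (del t + eps) h1 ltac:(lra)).
    (* If [del t - eps] is negative the lower estimate is automatic because [del t'] is nonnegative;
       the value 1 then only has to be positive. *)
    set (lo := if Rlt_dec (del t - eps) 0 then 1 else Th (del t) - Th (del t - eps)).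
    assert (hlo : 0 < lo).
    { unfold lo. destruct (Rlt_dec (del t - eps) 0); [lra|]. assert (q := HTh (del t - eps) (del t) ltac:(lra) ltac:(lra)). lra. }
    set (g := Rmin lo (Th (del t + eps) - Th (del t))).
    assert (hg : 0 < g) by (apply Rmin_glb_lt; lra).
    assert (g1 : g <= lo) by apply Rmin_l. assert (g2 : g <= Th (del t + eps) - Th (del t)) by apply Rmin_r.
    destruct (continuous_eps_inv exp t) with (eps := g / x0) as [eta [heta H]].
    { apply continuity_pt_filterlim. apply derivable_continuous_pt. apply derivable_pt_exp. }
    { apply Rdiv_lt_0_compat; lra. }
    exists eta. split; auto. intros t' ht' hh. specialize (H t' hh). destruct (Hdel t' ht') as [h3 h4].
    assert (hd : Rabs (x0 * exp t' - x0 * exp t) < g).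
    { rewrite <- Rmult_minus_distr_l, Rabs_mult, (Rabs_right x0) by lra.
      apply Rmult_lt_compat_l with (r := x0) in H; [|lra]. replace (x0 * (g / x0)) with g in H by (field; lra). auto. }
    rewrite <- h2, <- h4 in hd. apply Rabs_def2 in hd.
    apply Rabs_def1.
    + apply Rnot_le_lt. intros c. assert (Th (del t + eps) <= Th (del t')); [|lra].
      destruct (Req_dec (del t + eps) (del t')) as [->|n]; [lra|]. assert (q := HTh (del t + eps) (del t') ltac:(lra) ltac:(lra)). lra.
    + apply Rnot_le_lt. intros c. unfold lo in *. destruct (Rlt_dec (del t - eps) 0); [lra|].
      assert (Th (del t') <= Th (del t - eps)); [|lra].
      destruct (Req_dec (del t') (del t - eps)) as [->|n']; [lra|]. assert (q := HTh (del t') (del t - eps) ltac:(lra) ltac:(lra)). lra.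
  - destruct (Hdel t H) as [h1 h2]. destruct (Hm (del t) h1) as [h3 _]. assert (q := h3 (del t) ltac:(lra)).
    assert (q2 := Hfr1 (del t) h1). unfold Th in h2. lra.
  - destruct (Hdel t H) as [h1 h2]. destruct (Hm (del t) h1) as [_ [s [h3 h4]]]. exists s. split; auto.
    assert (q2 := Hfr1 (del t) h1). unfold Th in h2. lra.
Qed.

(** * Shadowing curves along the orbit *)

Section Hair.
Variables (T : nat -> C -> Prop) (F : C -> C) (z : nat -> C) (alpha beta K mu : R).
Hypothesis HT : forall k, tract_map (T k) F.
Hypothesis Halpha : 0 < alpha. Hypothesis Hbeta : 0 < beta. Hypothesis HK : 1 < K. Hypothesis Hmu : 0 < mu.
Hypothesis Hslope : forall k w1 w2, closure (T k) w1 -> closure (T k) w2 ->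
  Rabs (Im w1 - Im w2) <= alpha * Rmax (Rmax (Re w1) (Re w2)) 0 + beta.
Hypothesis Hwig : forall k u t, 0 < Re u -> 0 <= t ->
  Rmax (Re (tinv (T k) F (u + RtoC t)%C)) 0 > Re (tinv (T k) F u) / K - mu.
Hypothesis Hray : forall k u B, 0 < Re u -> exists t, 0 <= t /\ B < Re (tinv (T k) F (u + RtoC t)%C).
Hypothesis Hz : forall k, closure (T k) (z k).
Hypothesis HFz : forall k, F (z k) = z (S k).

(** Bloch's constant times a bound on a hyperbolic distance: slope contributes [alpha + beta] for
    the vertical part, and wiggling keeps the ratio of real parts below [2 * K]. *)
Definition shadow_const : R := bloch_const * (alpha + beta + ln (2 * K)).
(** The first summand yields the doubling in [running_max_inverse], whose Lipschitz constant is
    [bloch_const]. The next ones absorb the errors 1 and [mu] in the lower bound for real parts. The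
    last keeps the reparametrized geodesics at real part at least [2 * shadow_const + 1], so that
    points within [2 * shadow_const] of them stay in the half-plane and can be pulled back again. *)
Definition hair_threshold : R := 2 * (bloch_const + 1) + 2 + 2 * K * mu + 2 * K * (2 * shadow_const + 1).
Hypothesis HQ : forall k, hair_threshold <= Re (z k).

Local Notation C3 := shadow_const.
Local Notation G k := (tinv (T k) F).

Lemma shadow_const_pos : 0 < C3.
Proof.
  unfold shadow_const. assert (h := bloch_const_pos). assert (0 < ln (2 * K)) by (rewrite <- ln_1; apply ln_increasing; lra). nra.
Qed.

Lemma threshold_le k : 2 * (bloch_const + 1) <= Re (z k) /\ 2 + 2 * K * mu + 2 * K * (2 * C3 + 1) <= Re (z k) /\ 2 <= Re (z k).
Proof.
  assert (h := HQ k). unfold hair_threshold in h. assert (h1 := bloch_const_pos). assert (h2 := shadow_const_pos).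
  assert (0 < K * mu) by nra. assert (0 < K * (2 * C3 + 1)) by nra. repeat split; lra.
Qed.

(* E k d is the point at hyperbolic distance d from z k on the geodesic of T k from z k to infinity. *)
Let V k d : C := (Re (z k) * exp d, Im (z k)).
Let E k d : C := G k (V (S k) d).

Lemma V_pos k d : 0 < Re (V k d).
Proof. unfold V, Re at 1; simpl. assert (h := threshold_le k). assert (h1 := exp_pos d). apply Rmult_lt_0_compat; lra. Qed.

Lemma V_0 k : V k 0 = z k.
Proof. unfold V. rewrite exp_0, Rmult_1_r. destruct (z k); auto. Qed.

Lemma E_0 k : E k 0 = z k.
Proof. unfold E. rewrite V_0, <- HFz. apply tinv_left; auto. Qed.

Lemma E_lip k d d' : Cmod (E k d - E k d') <= bloch_const * Rabs (d - d').
Proof.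
  assert (W : forall d d', d' <= d -> Cmod (E k d - E k d') <= bloch_const * Rabs (d - d')).
  { intros a b h. unfold E, V. assert (hx := threshold_le (S k)).
    assert (q := tinv_horizontal_bound (T k) F (HT k) (Im (z (S k))) (Re (z (S k)) * exp b) (Re (z (S k)) * exp a)).
    rewrite Rabs_right by lra.
    rewrite !ln_mult, !ln_exp in q by (try apply exp_pos; lra).
    assert (he : exp b <= exp a) by (destruct h as [h| ->]; [left; apply exp_increasing; auto|lra]).
    assert (hb := exp_pos b). replace (a - b) with (ln (Re (z (S k))) + a - (ln (Re (z (S k))) + b)) by ring. apply q; nra. }
  destruct (Rle_dec d' d); [auto|]. rewrite Cmod_sym, Rabs_minus_sym. apply W. lra.
Qed.

Lemma E_cl k d : T k (E k d).
Proof. apply tinv_int; auto. apply V_pos. Qed.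

Lemma V_shift k d d' : d <= d' -> exists t, 0 <= t /\ V k d' = (V k d + RtoC t)%C.
Proof.
  intros h. exists (Re (z k) * (exp d' - exp d)). assert (hx := threshold_le k).
  assert (exp d <= exp d') by (destruct h as [h| ->]; [left; apply exp_increasing; auto|lra]). split; [nra|].
  unfold V, Cplus, RtoC; simpl. f_equal; ring.
Qed.

Lemma E_wig k d d' : d <= d' -> Rmax (Re (E k d')) 0 > Re (E k d) / K - mu.
Proof.
  intros h. unfold E. destruct (V_shift (S k) d d' h) as [t [ht ->]]. apply Hwig; auto. apply V_pos.
Qed.

Lemma E_unbounded k B : exists d, 0 <= d /\ B < Re (E k d).
Proof.
  destruct (Hray k (z (S k)) B) as [t [ht Ht]]; [assert (h := threshold_le (S k)); lra|].
  assert (hx := threshold_le (S k)). set (x := Re (z (S k))) in *.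
  exists (ln ((x + t) / x)).
  assert (h1 : 1 <= (x + t) / x).
  { apply Rle_div_r; [lra|]. lra. }
  split.
  - rewrite <- ln_1. destruct h1 as [h1| <-]; [left; apply ln_increasing; lra|lra].
  - unfold E, V. rewrite exp_ln by lra. fold x. replace (x * ((x + t) / x)) with (x + t) by (field; lra).
    replace ((x + t, Im (z (S k))) : C) with (z (S k) + RtoC t)%C; auto.
    unfold Cplus, RtoC, x, Re, Im; simpl. f_equal; ring.
Qed.

(** [del k] matches the geodesic with the horizontal ray: [E k (del k t)] has real part at most
    [Re (V k t)], and since an earlier point of the geodesic comes within 1 of that value, wiggling
    bounds it below by a fixed fraction. *)
Lemma delta_exists : exists del : nat -> R -> R, forall k, del k 0 = 0 /\ (forall t, 0 <= t -> 0 <= del k t) /\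
    (forall t t', 0 <= t -> t <= t' -> 2 * (t' - t) <= del k t' - del k t) /\
    (forall t, 0 <= t -> forall eps, 0 < eps -> exists eta, 0 < eta /\
       forall t', 0 <= t' -> Rabs (t' - t) < eta -> Rabs (del k t' - del k t) < eps) /\
    (forall t, 0 <= t -> Re (E k (del k t)) <= Re (z k) * exp t /\
       exists s, 0 <= s <= del k t /\ Re (z k) * exp t - 1 <= Re (E k s)).
Proof.
  assert (H := fun k => running_max_inverse (fun d => Re (E k d)) (Re (z k)) bloch_const (Rlt_le _ _ bloch_const_pos) (proj1 (threshold_le k))
    (f_equal Re (E_0 k)) (fun a b _ _ => Rle_trans _ _ _ (Rabs_Re_sub_le _ _) (E_lip k a b)) (E_unbounded k)).
  destruct (choice _ H) as [del Hdel]. exists del. exact Hdel.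
Qed.

Lemma shadowing_curves : exists (X : nat -> R -> C) (D : nat -> R -> R),
  (forall k t, 0 <= t -> closure (T k) (X k t) /\ F (X k t) = X (S k) t) /\
  (forall k, X k 0 = z k) /\
  (forall t, 0 <= t -> forall eps, 0 < eps -> exists eta, 0 < eta /\
       forall t', 0 <= t' -> Rabs (t' - t) < eta -> Cmod (X 0%nat t' - X 0%nat t) < eps) /\
  (forall t, D 0%nat t = t) /\ (forall k, D k 0 = 0) /\
  (forall k t t', 0 <= t -> t <= t' -> 2 ^ k * (t' - t) <= D k t' - D k t) /\
  (forall k t, 0 <= t -> Re (z k) * exp (D k t) / (2 * K) - 2 * C3 <= Re (X k t) <= Re (z k) * exp (D k t) + 2 * C3).
Proof.
  assert (hC3 := shadow_const_pos). assert (hCK := bloch_const_pos).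
  destruct delta_exists as [del Hdel].
  (* A point of the hair is labelled by its hyperbolic parameter [t] at step 0; [D k t] is its
     parameter at step [k]. *)
  set (D := fix D (k : nat) (t : R) : R := match k with O => t | S k => del k (D k t) end).
  assert (D0 : forall k, D k 0 = 0). { induction k; auto. simpl. rewrite IHk. apply Hdel. }
  assert (Dpos : forall k t, 0 <= t -> 0 <= D k t). { induction k; auto. intros t ht. simpl. apply Hdel. auto. }
  assert (Dexp : forall k t t', 0 <= t -> t <= t' -> 2 ^ k * (t' - t) <= D k t' - D k t).
  { induction k; intros t t' ht htt; simpl; [lra|]. assert (h := IHk t t' ht htt).
    destruct (Hdel k) as [_ [_ [h1 _]]].
    assert (0 <= 2 ^ k * (t' - t)) by (apply Rmult_le_pos; [apply pow_le; lra|lra]).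
    specialize (h1 (D k t) (D k t') (Dpos k t ht) ltac:(lra)). lra. }
  assert (Dcont : forall k t, 0 <= t -> forall eps, 0 < eps -> exists eta, 0 < eta /\
       forall t', 0 <= t' -> Rabs (t' - t) < eta -> Rabs (D k t' - D k t) < eps).
  { induction k; intros t ht eps Heps.
    - exists eps. auto.
    - destruct (Hdel k) as [_ [_ [_ [h1 _]]]]. destruct (h1 (D k t) (Dpos k t ht) eps Heps) as [eta [he H1]].
      destruct (IHk t ht eta he) as [eta' [he' H2]]. exists eta'. split; auto. intros t' ht' h. simpl. apply H1; auto. }
  (* [F] maps [e k t] to [V (S k) (D (S k) t)], which is at bounded hyperbolic distance from
     [e (S k) t]; [Hstep] is this statement pulled back by [G k]. *)
  set (e := fun k t => E k (D (S k) t)).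
  assert (Hx : forall k t, 0 <= t -> 2 <= Re (z k) * exp (D k t) /\ Re (z k) <= Re (z k) * exp (D k t)).
  { intros k t ht. assert (h := threshold_le k). assert (h1 := exp_ineq1_le (D k t)). assert (h2 := Dpos k t ht). split; nra. }
  assert (He : forall k t, 0 <= t -> Re (z k) * exp (D k t) / (2 * K) <= Re (e k t) <= Re (z k) * exp (D k t)).
  { intros k t ht. destruct (Hdel k) as [_ [_ [_ [_ h]]]]. destruct (h (D k t) (Dpos k t ht)) as [h1 [s [h2 h3]]].
    split; [|exact h1]. assert (w := E_wig k s (D (S k) t) ltac:(apply h2)). fold (e k t) in w.
    set (x := Re (z k) * exp (D k t)) in *. destruct (Hx k t ht) as [x1 x2]. fold x in x1, x2. assert (q := threshold_le k).
    assert (A1 : (x - 1) / K <= Re (E k s) / K) by (apply Rmult_le_compat_r; auto; left; apply Rinv_0_lt_compat; lra).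
    assert (A2 : x / (2 * K) <= (x - 1) / K - mu).
    { apply Rmult_le_reg_r with (2 * K); [lra|]. replace (x / (2 * K) * (2 * K)) with x by (field; lra).
      replace (((x - 1) / K - mu) * (2 * K)) with (2 * (x - 1) - 2 * K * mu) by (field; lra).
      assert (0 < 2 * K * (2 * C3 + 1)) by nra. lra. }
    assert (A3 : 0 < x / (2 * K)) by (apply Rdiv_lt_0_compat; lra).
    unfold Rmax in w. destruct (Rle_dec (Re (e k t)) 0); lra. }
  assert (Hbig : forall k t, 0 <= t -> 2 * C3 + 1 <= Re (z k) * exp (D k t) / (2 * K)).
  { intros k t ht. destruct (Hx k t ht) as [x1 x2]. assert (q := threshold_le k).
    apply Rmult_le_reg_r with (2 * K); [lra|].
    replace (Re (z k) * exp (D k t) / (2 * K) * (2 * K)) with (Re (z k) * exp (D k t)) by (field; lra).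
    assert (0 < K * mu) by nra. lra. }
  assert (Hstep : forall k t, 0 <= t -> Cmod (G k (e (S k) t) - e k t) <= C3).
  { intros k t ht. assert (b := Hbig (S k) t ht). destruct (He (S k) t ht) as [h1 h2]. destruct (Hx (S k) t ht) as [x1 x2].
    unfold e at 2, E. eapply Rle_trans; [apply tinv_hyp_bound; auto; [lra|apply V_pos]|].
    unfold shadow_const. apply Rmult_le_compat_l; [lra|]. unfold hyp_dist.
    set (x := Re (z (S k)) * exp (D (S k) t)) in *.
    assert (RV : Re (V (S k) (D (S k) t)) = x) by reflexivity. assert (IV : Im (V (S k) (D (S k) t)) = Im (z (S k))) by reflexivity.
    rewrite RV, IV, Rmax_right by lra.
    assert (sl := Hslope (S k) (e (S k) t) (z (S k)) (closure_self _ _ (E_cl (S k) _)) (Hz (S k))).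
    assert (mx : Rmax (Rmax (Re (e (S k) t)) (Re (z (S k)))) 0 <= x) by (repeat apply Rmax_lub; lra).
    assert (A : Rabs (Im (e (S k) t) - Im (z (S k))) / x <= alpha + beta).
    { apply Rle_div_l; [lra|].
      assert (alpha * Rmax (Rmax (Re (e (S k) t)) (Re (z (S k)))) 0 <= alpha * x) by (apply Rmult_le_compat_l; lra).
      assert (beta <= beta * x) by nra. lra. }
    assert (B : Rabs (ln (Re (e (S k) t)) - ln x) <= ln (2 * K)).
    { assert (l1 : ln (Re (e (S k) t)) <= ln x) by (destruct h2 as [h2| ->]; [left; apply ln_increasing; lra|lra]).
      assert (l2 : ln (x / (2 * K)) <= ln (Re (e (S k) t))) by (destruct h1 as [h1| <-]; [left; apply ln_increasing; lra|lra]).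
      unfold Rdiv in l2. rewrite ln_mult, ln_Rinv in l2 by (try apply Rinv_0_lt_compat; lra).
      rewrite Rabs_left1 by lra. lra. }
    lra. }
  (* [P j k t] is [e (k + j) t] pulled back [j] times along the orbit. Each pull-back halves
     Euclidean distances: the total displacement is at most [2 * C3], and convergence in [j] is
     geometric. *)
  set (P := fix P (j k : nat) (t : R) {struct j} : C := match j with O => e k t | S j => G k (P j (S k) t) end).
  assert (HPe : forall j k t, 0 <= t -> Cmod (P j k t - e k t) <= 2 * C3).
  { induction j; intros k t ht; simpl.
    - rewrite Cmod_self. lra.
    - assert (t1 := Cmod_triangle3 (G k (P j (S k) t)) (G k (e (S k) t)) (e k t)). assert (t2 := Hstep k t ht).
      assert (t3 := IHj (S k) t ht). assert (b := Hbig (S k) t ht). destruct (He (S k) t ht) as [h1 _].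
      assert (hR : 0 <= Re (P j (S k) t)). { assert (r := Re_sub_le (e (S k) t) (P j (S k) t)). rewrite Cmod_sym in r. lra. }
      assert (t4 := tinv_lip (T k) F (HT k) (P j (S k) t) (e (S k) t) hR ltac:(lra)). lra. }
  assert (HPpos : forall j k t, 0 <= t -> 0 <= Re (P j k t)).
  { intros j k t ht. assert (t3 := HPe j k t ht). assert (b := Hbig k t ht). destruct (He k t ht) as [h1 _].
    assert (r := Re_sub_le (e k t) (P j k t)). rewrite Cmod_sym in r. lra. }
  assert (HPstep : forall j k t, 0 <= t -> Cmod (P (S j) k t - P j k t) <= C3 / 2 ^ j).
  { induction j; intros k t ht.
    - simpl. assert (h := Hstep k t ht). lra.
    - change (Cmod (G k (P (S j) (S k) t) - G k (P j (S k) t)) <= C3 / 2 ^ S j).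
      assert (h := IHj (S k) t ht).
      assert (t4 := tinv_lip (T k) F (HT k) (P (S j) (S k) t) (P j (S k) t) (HPpos _ _ _ ht) (HPpos _ _ _ ht)).
      assert (C3 / 2 ^ S j = C3 / 2 ^ j / 2) by (simpl; field; apply pow_nonzero; lra). lra. }
  assert (HX : forall q : nat * R, exists l : C, 0 <= snd q -> forall j, Cmod (P j (fst q) (snd q) - l) <= 2 * C3 / 2 ^ j).
  { intros [k t]. simpl. destruct (Rle_dec 0 t) as [ht|ht]; [|exists (RtoC 0); tauto].
    destruct (Cauchy_geom (fun j => P j k t) C3) as [l Hl]; [intros; apply HPstep; auto|]. exists l. auto. }
  destruct (choice _ HX) as [X' HX']. set (X := fun k t => X' (k, t)).
  assert (HXP : forall k t, 0 <= t -> forall j, Cmod (P j k t - X k t) <= 2 * C3 / 2 ^ j) by (intros k t ht; apply (HX' (k, t)); auto).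
  assert (HXe : forall k t, 0 <= t -> Cmod (e k t - X k t) <= 2 * C3) by (intros k t ht; assert (h := HXP k t ht 0%nat); simpl in h; lra).
  assert (HXpos : forall k t, 0 <= t -> 0 <= Re (X k t)).
  { intros k t ht. assert (t3 := HXe k t ht). assert (b := Hbig k t ht). destruct (He k t ht) as [h1 _].
    assert (r := Re_sub_le (e k t) (X k t)). lra. }
  assert (HGX : forall k t, 0 <= t -> G k (X (S k) t) = X k t).
  { intros k t ht. apply Cmod_small_eq. intros eps Heps. destruct (pow2_small (2 * C3) (eps / 2)) as [N HN]; [lra|].
    assert (a1 := HXP (S k) t ht N). assert (a2 := HXP k t ht (S N)).
    change (P (S N) k t) with (G k (P N (S k) t)) in a2.
    assert (t4 := tinv_lip (T k) F (HT k) (P N (S k) t) (X (S k) t) (HPpos _ _ _ ht) (HXpos _ _ ht)).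
    assert (t5 := Cmod_triangle3 (G k (X (S k) t)) (G k (P N (S k) t)) (X k t)).
    rewrite (Cmod_sym (G k (X (S k) t)) (G k (P N (S k) t))) in t5.
    assert (2 * C3 / 2 ^ S N <= 2 * C3 / 2 ^ N).
    { apply Rmult_le_compat_l; [lra|]. assert (0 < 2 ^ N) by (apply pow_lt; lra). apply Rinv_le_contravar; auto; simpl; lra. } lra. }
  exists X, D. split; [|split; [|split; [|split; [|split; [|split]]]]]; auto.
  - intros k t ht. rewrite <- (HGX k t ht). apply tinv_spec; auto.
  - intros k. assert (he0 : forall k, e k 0 = z k). { intros k0. unfold e. rewrite D0. apply E_0. }
    assert (hP0 : forall j k, P j k 0 = z k).
    { induction j; intros k0; simpl; auto. rewrite IHj, <- HFz. apply tinv_left; auto. }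
    apply Cmod_small_eq. intros eps Heps. destruct (pow2_small (2 * C3) eps Heps) as [N HN].
    assert (a := HXP k 0 (Rle_refl 0) N). rewrite hP0, Cmod_sym in a. lra.
  - intros t ht eps Heps.
    assert (Pc : forall j k eps, 0 < eps -> exists eta, 0 < eta /\ forall t', 0 <= t' -> Rabs (t' - t) < eta -> Cmod (P j k t' - P j k t) < eps).
    { induction j; intros k ep Hep.
      - destruct (Dcont (S k) t ht (ep / bloch_const)) as [eta [he H]]; [apply Rdiv_lt_0_compat; auto|].
        exists eta. split; auto. intros t' ht' h. eapply Rle_lt_trans; [apply E_lip|].
        specialize (H t' ht' h). apply Rmult_lt_compat_l with (r := bloch_const) in H; auto.
        replace (bloch_const * (ep / bloch_const)) with ep in H by (field; lra). auto.
      - destruct (IHj (S k) ep Hep) as [eta [he H]]. exists eta. split; auto. intros t' ht' h. specialize (H t' ht' h).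
        assert (t4 := tinv_lip (T k) F (HT k) (P j (S k) t') (P j (S k) t) (HPpos _ _ _ ht') (HPpos _ _ _ ht)).
        change (Cmod (G k (P j (S k) t') - G k (P j (S k) t)) < ep).
        lra. }
    destruct (pow2_small (2 * C3) (eps / 4)) as [N HN]; [lra|].
    destruct (Pc N 0%nat (eps / 4)) as [eta [he H]]; [lra|]. exists eta. split; auto. intros t' ht' h. specialize (H t' ht' h).
    assert (a1 := HXP 0%nat t ht N). assert (a2 := HXP 0%nat t' ht' N).
    assert (t1 := Cmod_triangle3 (X 0%nat t') (P N 0%nat t') (X 0%nat t)).
    assert (t2 := Cmod_triangle3 (P N 0%nat t') (P N 0%nat t) (X 0%nat t)).
    rewrite (Cmod_sym (X 0%nat t') (P N 0%nat t')) in t1. lra.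
  - intros k t ht. destruct (He k t ht) as [h1 h2]. assert (h3 := HXe k t ht).
    assert (r1 := Re_sub_le (e k t) (X k t)). assert (r2 := Re_sub_le (X k t) (e k t)). rewrite Cmod_sym in r2. lra.
Qed.

End Hair.

(** * Cuts L_{zeta,a} of a tract *)

Definition pcont (g : R -> C) (p q : R) : Prop :=
  forall t, p <= t <= q -> forall eps, 0 < eps -> exists del, 0 < del /\
    forall s, p <= s <= q -> Rabs (s - t) < del -> Cmod (g s - g t) < eps.

Lemma locally_bounded (f : R -> R) (p q : R) : p <= q ->
  (forall t, p <= t <= q -> exists d M, 0 < d /\ forall s, p <= s <= q -> Rabs (s - t) < d -> f s <= M) ->
  exists M, forall t, p <= t <= q -> f t <= M.
Proof.
  intros Hpq Hloc.
  assert (K : forall t, p <= t <= q -> exists M, forall s, p <= s <= t -> f s <= M).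
  { apply real_induction; auto.
    - exists (f p). intros s hs. replace s with p by lra. lra.
    - intros t ht IH. destruct (IH t) as [M HM]; [lra|]. destruct (Hloc t) as [d [M' [hd H]]]; [lra|].
      exists d. split; auto. intros s hs hsq. exists (Rmax M M'). intros r hr.
      assert (m1 := Rmax_l M M'). assert (m2 := Rmax_r M M').
      destruct (Rle_dec r t); [specialize (HM r)|specialize (H r ltac:(lra) ltac:(rewrite Rabs_right; lra))]; lra.
    - intros t ht IH. destruct (Hloc t) as [d [M' [hd H]]]; [lra|].
      set (t' := Rmax p (t - d / 2)). assert (a1 := Rmax_l p (t - d / 2)). assert (a2 := Rmax_r p (t - d / 2)).
      assert (a3 : t' < t) by (apply Rmax_lub_lt; lra). fold t' in a1, a2.
      destruct (IH t') as [M HM]; [lra|]. exists (Rmax M M'). intros r hr.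
      assert (m1 := Rmax_l M M'). assert (m2 := Rmax_r M M').
      destruct (Rle_dec r t'); [specialize (HM r)|specialize (H r ltac:(lra) ltac:(apply Rabs_def1; lra))]; lra. }
  apply K. lra.
Qed.

Lemma path_bounds (v : R -> C) (p q : R) : p <= q -> pcont v p q -> (forall t, p <= t <= q -> 0 < Re (v t)) ->
  exists x0 Y, 0 < x0 /\ forall t, p <= t <= q -> x0 <= Re (v t) /\ Cmod (v t) <= Y.
Proof.
  intros Hpq Hc Hp.
  assert (Hloc : forall t, p <= t <= q -> exists d, 0 < d /\ forall s, p <= s <= q -> Rabs (s - t) < d ->
     Re (v t) / 2 <= Re (v s) /\ Cmod (v s) <= Cmod (v t) + Re (v t) / 2).
  { intros t ht. destruct (Hc t ht (Re (v t) / 2)) as [d [Hd H]]; [assert (h := Hp t ht); lra|]. exists d. split; auto.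
    intros s hs h. specialize (H s hs h). assert (r := Re_sub_le (v t) (v s)). rewrite Cmod_sym in r.
    assert (r2 := Cmod_sub_le (v s) (v t)). split; lra. }
  destruct (locally_bounded (fun t => Cmod (v t)) p q Hpq) as [Y HY].
  { intros t ht. destruct (Hloc t ht) as [d [hd H]]. exists d. eexists. split; auto. intros s hs h. apply H; auto. }
  destruct (locally_bounded (fun t => / Re (v t)) p q Hpq) as [M HM].
  { intros t ht. destruct (Hloc t ht) as [d [hd H]]. exists d. eexists. split; auto. intros s hs h.
    apply Rinv_le_contravar; [|apply H; eauto]. assert (h2 := Hp t ht). lra. }
  assert (hM : 0 < M) by (eapply Rlt_le_trans; [apply Rinv_0_lt_compat, (Hp p); lra|apply HM; lra]).
  exists (/ M), Y. split; [apply Rinv_0_lt_compat; auto|]. intros t ht. split; auto.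
  rewrite <- (Rinv_inv (Re (v t))). apply Rinv_le_contravar; auto. apply Rinv_0_lt_compat; auto.
Qed.

Lemma pcont_segment (x y : C) (a b : R) : pcont (fun t => x + RtoC t * (y - x))%C a b.
Proof.
  intros t _ e he. assert (hm := Cmod_ge_0 (y - x)). exists (e / (Cmod (y - x) + 1)). split; [apply Rdiv_lt_0_compat; lra|].
  intros s _ h. apply Rlt_div_r in h; [|lra].
  replace (x + RtoC s * (y - x) - (x + RtoC t * (y - x)))%C with ((RtoC s - RtoC t) * (y - x))%C by ring.
  rewrite <- RtoC_minus, Cmod_mult, Cmod_R. nra.
Qed.

(** The clause [r = 1 -> s = 1] says that the end of the segment is reached only at the last time.
    In [gulf_cut_exists] this end lies on the cut while all earlier points have to be strictly to
    its left. *)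
Lemma path_append (g : R -> C) (w' : C) : pcont g 0 1 ->
  exists g', pcont g' 0 1 /\ g' 0 = g 0 /\ g' 1 = w' /\ forall s, 0 <= s <= 1 ->
    (exists r, 0 <= r <= 1 /\ g' s = g r) \/
    (exists r, 0 <= r <= 1 /\ (r = 1 -> s = 1) /\ g' s = (g 1 + RtoC r * (w' - g 1))%C).
Proof.
  intros Hc. set (w := g 1).
  set (g' := fun s => if Rle_dec s (1/2) then g (2 * s) else (w + RtoC (2 * s - 1) * (w' - w))%C).
  assert (gl : forall s, s <= 1/2 -> g' s = g (2 * s)) by (intros s h; unfold g'; destruct (Rle_dec s (1/2)); [auto|lra]).
  assert (gr : forall s, 1/2 <= s -> g' s = (w + RtoC (2 * s - 1) * (w' - w))%C).
  { intros s h. unfold g'. destruct (Rle_dec s (1/2)); auto. replace s with (1/2) by lra.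
    replace (2 * (1/2)) with 1 by field. fold w. replace (1 - 1) with 0 by ring. ring. }
  exists g'. split; [|split; [|split]].
  - intros t ht e He.
    assert (Hr : exists d, 0 < d /\ forall s, 1/2 <= s <= 1 -> 1/2 <= t -> Rabs (s - t) < d -> Cmod (g' s - g' t) < e).
    { destruct (Rle_dec (1/2) t) as [c|c]; [|exists 1; split; [lra|intros; lra]].
      destruct (pcont_segment w w' 0 1 (2 * t - 1) ltac:(lra) e He) as [d [Hd H]]. exists (d / 2). split; [lra|]. intros s hs _ h.
      rewrite !gr by lra. apply H; [lra|]. replace (2 * s - 1 - (2 * t - 1)) with (2 * (s - t)) by ring.
      rewrite Rabs_mult, (Rabs_right 2) by lra. lra. }
    assert (Hl : exists d, 0 < d /\ forall s, 0 <= s <= 1/2 -> t <= 1/2 -> Rabs (s - t) < d -> Cmod (g' s - g' t) < e).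
    { destruct (Rle_dec t (1/2)) as [c|c]; [|exists 1; split; [lra|intros; lra]].
      destruct (Hc (2 * t) ltac:(lra) e He) as [d [Hd H]]. exists (d / 2). split; [lra|]. intros s hs _ h. rewrite !gl by lra.
      apply H; [lra|]. replace (2 * s - 2 * t) with (2 * (s - t)) by ring. rewrite Rabs_mult, (Rabs_right 2) by lra. lra. }
    destruct Hr as [d1 [hd1 H1]]. destruct Hl as [d2 [hd2 H2]].
    destruct (Rtotal_order t (1/2)) as [c|[c|c]].
    + exists (Rmin d2 (1/2 - t)). split; [apply Rmin_glb_lt; lra|]. intros s hs h.
      destruct (Rlt_Rmin h) as [q1 q2].
      apply Rabs_def2 in q2. apply H2; lra.
    + exists (Rmin d1 d2). split; [apply Rmin_glb_lt; lra|]. intros s hs h.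
      destruct (Rlt_Rmin h) as [q1 q2].
      destruct (Rle_dec s (1/2)); [apply H2|apply H1]; lra.
    + exists (Rmin d1 (t - 1/2)). split; [apply Rmin_glb_lt; lra|]. intros s hs h.
      destruct (Rlt_Rmin h) as [q1 q2].
      apply Rabs_def2 in q2. apply H1; lra.
  - rewrite gl by lra. f_equal. ring.
  - rewrite gr by lra. replace (2 * 1 - 1) with 1 by ring. ring.
  - intros s hs. destruct (Rle_dec s (1/2)).
    + left. exists (2 * s). split; [lra|]. apply gl; auto.
    + right. exists (2 * s - 1). split; [lra|]. split; [lra|]. apply gr. lra.
Qed.

Lemma segment_ball (c x y : C) (r t : R) : 0 <= t <= 1 -> Cmod (x - c) < r -> Cmod (y - c) < r ->
  Cmod (x + RtoC t * (y - x) - c) < r.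
Proof.
  intros ht hx hy. replace (x + RtoC t * (y - x) - c)%C with (RtoC (1 - t) * (x - c) + RtoC t * (y - c))%C by (rewrite RtoC_minus; ring).
  assert (q := Cmod_triangle (RtoC (1 - t) * (x - c)) (RtoC t * (y - c))).
  rewrite !Cmod_mult, !Cmod_R, !Rabs_right in q by lra.
  destruct (Req_dec t 0) as [->|]; [lra|].
  assert (t * Cmod (y - c) < t * r) by (apply Rmult_lt_compat_l; lra).
  assert ((1 - t) * Cmod (x - c) <= (1 - t) * r) by (apply Rmult_le_compat_l; lra). lra.
Qed.

Lemma Re_segment_eq (x y : C) (t : R) : Re (x + RtoC t * (y - x))%C = (1 - t) * Re x + t * Re y.
Proof. unfold Re; simpl. ring. Qed.

Section Gulf.
Variables (T : C -> Prop) (F : C -> C).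
Hypothesis HT : tract_map T F.
Local Notation G := (tinv T F).

Section Cut.
Variables (a y0 : R).
Hypothesis Hy0 : T (a, y0).
Local Notation L := (vline_component T a y0).

Lemma cut_base : L (a, y0).
Proof.
  split; auto. intros s hs. unfold Im in hs; simpl in hs. rewrite Rmin_left, Rmax_left in hs by lra. replace s with y0 by lra. auto.
Qed.

Lemma cut_in w : L w -> T w.
Proof.
  intros [h1 h2]. replace w with ((a, Im w) : C) by (destruct w; simpl; unfold Re, Im in *; simpl in *; subst; auto).
  apply h2. split; [apply Rmin_r|apply Rmax_r].
Qed.

Lemma cut_ext v w : L v -> Re w = a -> (forall s, Rmin (Im v) (Im w) <= s <= Rmax (Im v) (Im w) -> T (a, s)) -> L w.
Proof.
  intros [h1 h2] hw H. split; auto. intros s hs.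
  destruct (Rle_dec (Rmin y0 (Im v)) s); [destruct (Rle_dec s (Rmax y0 (Im v)))|].
  - apply h2; auto.
  - apply H. unfold Rmin, Rmax in *. repeat destruct Rle_dec; lra.
  - apply H. unfold Rmin, Rmax in *. repeat destruct Rle_dec; lra.
Qed.

Lemma cut_ball v w c r : L v -> Re w = a -> (forall x : C, Cmod (x - c) < r -> T x) -> Cmod (v - c) < r -> Cmod (w - c) < r -> L w.
Proof.
  intros Lv hw Hr hv hw'. apply (cut_ext v w); auto. intros s hs. apply Hr.
  destruct (Req_dec (Im v) (Im w)) as [e|n].
  - rewrite <- e, Rmin_left, Rmax_left in hs by lra. replace s with (Im v) by lra.
    destruct Lv as [h _]. rewrite <- h. destruct v; exact hv.
  - set (t := (s - Im v) / (Im w - Im v)).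
    assert (E : ((a, s) : C) = (v + RtoC t * (w - v))%C).
    { destruct Lv as [h _]. unfold Re, Im in *. destruct v as [v1 v2], w as [w1 w2]. simpl in *. subst.
      unfold t, Cplus, Cminus, Cmult, Copp, RtoC; simpl. f_equal; field; lra. }
    rewrite E. apply segment_ball; auto. unfold t.
    unfold Rmin, Rmax in hs. repeat destruct Rle_dec; try lra.
    + split; [apply Rle_mult_inv_pos; lra|]. apply Rmult_le_reg_r with (Im w - Im v); [lra|].
      unfold Rdiv. rewrite Rmult_assoc, Rinv_l by lra. lra.
    + replace ((s - Im v) / (Im w - Im v)) with ((Im v - s) / (Im v - Im w)) by (field; lra).
      split; [apply Rle_mult_inv_pos; lra|]. apply Rmult_le_reg_r with (Im v - Im w); [lra|].
      unfold Rdiv. rewrite Rmult_assoc, Rinv_l by lra. lra.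
Qed.

(** A longer cut would contain a vertical segment of length 2 pi, whose ends contradict
    [tm_no2pi]. *)
Lemma cut_short w : L w -> Rabs (Im w - y0) < 2 * PI.
Proof.
  intros [h1 h2]. assert (hp := PI_RGT_0). apply Rnot_le_lt. intros hl.
  destruct (Rle_dec y0 (Im w)) as [c|c].
  - rewrite Rabs_right in hl by lra. rewrite Rmin_left, Rmax_right in h2 by lra.
    apply (tm_no2pi _ _ HT (a, y0)); auto. unfold Cplus; simpl. rewrite Rplus_0_r. apply h2. lra.
  - rewrite Rabs_left in hl by lra. rewrite Rmin_right, Rmax_left in h2 by lra.
    apply (tm_no2pi _ _ HT (a, y0 - 2 * PI)).
    + apply h2. lra.
    + unfold Cplus; simpl. rewrite Rplus_0_r. replace (y0 - 2 * PI + 2 * PI) with y0 by ring. auto.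
Qed.

(** The cut may end on the boundary of [T], but it is short and [F] is continuous on the closure. So
    far out in the half-plane no crossing of its image can occur. *)
Lemma cut_F_bounded : exists M, forall w, L w -> Cmod (F w) <= M.
Proof.
  destruct (F_bounded T F HT (Rabs a + (Rabs y0 + 2 * PI))) as [M HM]. exists M. intros w Lw.
  apply HM; [apply closure_self, cut_in; auto|]. eapply Rle_trans; [apply Cmod_le_fst_snd|].
  assert (h := cut_short w Lw). destruct Lw as [h1 _]. unfold Re, Im in *. rewrite h1.
  assert (Rabs (snd w) <= Rabs y0 + Rabs (snd w - y0)) by (split_Rabs; lra). lra.
Qed.

(** * Crossing parity of a cut *)

Definition right_of (v : C) : bool := if Rle_dec a (Re (G v)) then true else false.

(* A Z/2-valued section that flips exactly when v crosses F(L). *)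
Definition flip_section (Q : C -> Prop) (s : C -> bool) : Prop :=
  forall b, Q b -> exists r (e : bool), 0 < r /\
    (L (G b) -> forall v, Q v -> Cmod (v - b) < r -> s v = xorb e (right_of v)) /\
    (~ L (G b) -> forall v, Q v -> Cmod (v - b) < r -> s v = e).

Lemma flip_mono (Q Q' : C -> Prop) s : (forall v, Q' v -> Q v) -> flip_section Q s -> flip_section Q' s.
Proof.
  intros h H b Qb. destruct (H b (h b Qb)) as [r [e [hr [h1 h2]]]]. exists r, e. repeat split; auto.
Qed.

(** Both sections flip at the same places, so their difference is locally constant on the overlap,
    hence constant [k] since the overlap is convex. Adding [k] to [s2] makes them agree there. *)
Lemma flip_glue (Q1 Q2 : C -> Prop) s1 s2 : closedC Q1 -> closedC Q2 ->
  (forall u v t, Q1 u -> Q2 u -> Q1 v -> Q2 v -> 0 <= t <= 1 -> Q1 (u + RtoC t * (v - u))%C /\ Q2 (u + RtoC t * (v - u))%C) ->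
  flip_section Q1 s1 -> flip_section Q2 s2 -> exists s, flip_section (fun v => Q1 v \/ Q2 v) s.
Proof.
  intros C1 C2 Hconv H1 H2.
  assert (Hk : exists k, forall v, Q1 v -> Q2 v -> s1 v = xorb k (s2 v)).
  { destruct (classic (exists u, Q1 u /\ Q2 u)) as [[u [u1 u2]]|n]; [|exists true; intros v v1 v2; exfalso; apply n; eauto].
    exists (xorb (s1 u) (s2 u)). intros v v1 v2.
    assert (K := locally_constant bool (fun t => xorb (s1 (u + RtoC t * (v - u))%C) (s2 (u + RtoC t * (v - u))%C)) 0 1 Rle_0_1).
    assert (E : xorb (s1 v) (s2 v) = xorb (s1 u) (s2 u)).
    { assert (e0 : (u + RtoC 0 * (v - u))%C = u) by ring. assert (e1 : (u + RtoC 1 * (v - u))%C = v) by ring.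
      assert (E' : xorb (s1 (u + RtoC 1 * (v - u))%C) (s2 (u + RtoC 1 * (v - u))%C) = xorb (s1 (u + RtoC 0 * (v - u))%C) (s2 (u + RtoC 0 * (v - u))%C)); [|rewrite e0, e1 in E'; exact E'].
      apply (fun h => K h 1); [|lra].
      intros t ht. set (b := (u + RtoC t * (v - u))%C). destruct (Hconv u v t u1 u2 v1 v2 ht) as [b1 b2]. fold b in b1, b2.
      destruct (H1 b b1) as [r1 [e1' [hr1 [h11 h12]]]]. destruct (H2 b b2) as [r2 [e2' [hr2 [h21 h22]]]].
      assert (hm := Cmod_ge_0 (v - u)). assert (hr : 0 < Rmin r1 r2) by (apply Rmin_glb_lt; auto).
      exists (Rmin r1 r2 / (Cmod (v - u) + 1)). split; [apply Rdiv_lt_0_compat; lra|].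
      intros s hs h. destruct (Hconv u v s u1 u2 v1 v2 hs) as [c1 c2]. set (c := (u + RtoC s * (v - u))%C) in *.
      assert (hc : Cmod (c - b) < Rmin r1 r2).
      { unfold c, b. replace (u + RtoC s * (v - u) - (u + RtoC t * (v - u)))%C with ((RtoC s - RtoC t) * (v - u))%C by ring.
        rewrite <- RtoC_minus, Cmod_mult, Cmod_R. apply Rlt_div_r in h; [|lra]. nra. }
      destruct (Rlt_Rmin hc) as [q1 q2].
      destruct (classic (L (G b))) as [l|l].
      - rewrite (h11 l c), (h21 l c), (h11 l b), (h21 l b) by (auto; rewrite Cmod_self; auto).
        destruct e1', e2', (right_of c), (right_of b); reflexivity.
      - rewrite (h12 l c), (h22 l c), (h12 l b), (h22 l b) by (auto; rewrite Cmod_self; auto). reflexivity. }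
    rewrite <- E. destruct (s1 v), (s2 v); reflexivity. }
  destruct Hk as [k Hk].
  set (s := fun v => if excluded_middle_informative (Q1 v) then s1 v else xorb k (s2 v)).
  assert (S1 : forall v, Q1 v -> s v = s1 v) by (intros v h; unfold s; destruct (excluded_middle_informative (Q1 v)); tauto).
  assert (S2 : forall v, Q2 v -> s v = xorb k (s2 v)).
  { intros v h. unfold s. destruct (excluded_middle_informative (Q1 v)); auto. }
  assert (X : forall x y, xorb (xorb k x) y = xorb k (xorb x y)) by (intros x y; destruct k, x, y; reflexivity).
  exists s. intros b Qb. destruct (classic (Q1 b)) as [b1|b1]; [destruct (classic (Q2 b)) as [b2|b2]|].
  - destruct (H1 b b1) as [r1 [e1' [hr1 [h11 h12]]]]. destruct (H2 b b2) as [r2 [e2' [hr2 [h21 h22]]]].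
    exists (Rmin r1 r2), e1'. split; [apply Rmin_glb_lt; auto|]. split; intros l v Qv hv;
    destruct (Rlt_Rmin hv) as [q1 q2].
    + assert (E : e1' = xorb k e2').
      { assert (q := Hk b b1 b2). rewrite (h11 l b), (h21 l b) in q by (auto; rewrite Cmod_self; auto).
        destruct k, e1', e2', (right_of b); simpl in *; congruence. }
      destruct Qv as [v1|v2]; [rewrite S1, (h11 l v)|rewrite S2, (h21 l v)]; auto. rewrite E, X. reflexivity.
    + assert (E : e1' = xorb k e2').
      { assert (q := Hk b b1 b2). rewrite (h12 l b), (h22 l b) in q by (auto; rewrite Cmod_self; auto). auto. }
      destruct Qv as [v1|v2]; [rewrite S1, (h12 l v)|rewrite S2, (h22 l v)]; auto.
  - destruct (H1 b b1) as [r1 [e1' [hr1 [h11 h12]]]]. destruct (C2 b b2) as [r2 [hr2 h2]].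
    exists (Rmin r1 r2), e1'. split; [apply Rmin_glb_lt; auto|]. split; intros l v Qv hv;
    destruct (Rlt_Rmin hv) as [q1 q2];
    (destruct Qv as [v1|v2]; [|exfalso; apply (h2 v); auto]); rewrite S1 by auto; auto.
  - assert (b2 : Q2 b) by tauto. destruct (H2 b b2) as [r2 [e2' [hr2 [h21 h22]]]]. destruct (C1 b b1) as [r1 [hr1 h1]].
    exists (Rmin r1 r2), (xorb k e2'). split; [apply Rmin_glb_lt; auto|]. split; intros l v Qv hv;
    destruct (Rlt_Rmin hv) as [q1 q2];
    (destruct Qv as [v1|v2]; [exfalso; apply (h1 v); auto|]); rewrite S2 by auto.
    + rewrite (h21 l v), X; auto.
    + rewrite (h22 l v); auto.
Qed.

(** Near a point of F(L) the function [right_of] is itself a section, because by [cut_ball] all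
    nearby points on the line [Re = a] belong to the same cut. Near any other point the cut is
    absent and a constant works. *)
Lemma flip_local (b : C) : 0 < Re b -> exists r, 0 < r /\ forall Q : C -> Prop,
  (forall v, Q v -> 0 < Re v /\ Cmod (v - b) < r) -> exists s, flip_section Q s.
Proof.
  intros hb. assert (Tb := tinv_int T F HT b hb). destruct (tm_open _ _ HT _ Tb) as [r0 [hr0 H0]].
  assert (Hc : forall v, 0 < Re v -> forall e, 0 < e -> exists d, 0 < d /\ forall w : C, Cmod (w - v) < d -> Cmod (G w - G v) < e).
  { intros v hv. apply tinv_ccont; auto. }
  destruct (classic (L (G b))) as [l|l].
  - destruct (Hc b hb r0 hr0) as [r [hr Hr]]. exists r. split; auto. intros Q HQ. exists right_of.
    intros b' Qb'. destruct (HQ b' Qb') as [p1 p2].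
    destruct (classic (L (G b'))) as [l'|l'].
    + exists 1, false. split; [lra|]. split; [|tauto]. intros _ v _ _. destruct (right_of v); reflexivity.
    + assert (na : Re (G b') <> a).
      { intros e. apply l'. apply (cut_ball (G b) (G b') (G b) r0); auto. rewrite Cmod_self. auto. }
      destruct (Hc b' p1 (Rabs (Re (G b') - a))) as [d [hd Hd]]; [apply Rabs_pos_lt; lra|].
      exists d, (right_of b'). split; auto. split; [tauto|]. intros _ v _ hv. specialize (Hd v hv).
      assert (q := Rabs_Re_sub_le (G v) (G b')). unfold right_of.
      destruct (Rle_dec a (Re (G v))), (Rle_dec a (Re (G b'))); auto; exfalso; unfold Rabs in *; repeat destruct Rcase_abs; lra.
  - assert (Hn : exists r1, 0 < r1 /\ forall w : C, Cmod (w - G b) < r1 -> ~ L w).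
    { destruct (Req_dec (Re (G b)) a) as [e|n].
      - exists r0. split; auto. intros w hw lw. apply l. apply (cut_ball w (G b) (G b) r0); auto. rewrite Cmod_self. auto.
      - exists (Rabs (Re (G b) - a)). split; [apply Rabs_pos_lt; lra|]. intros w hw [lw _].
        assert (q := Rabs_Re_sub_le w (G b)). rewrite lw, Rabs_minus_sym in q. lra. }
    destruct Hn as [r1 [hr1 H1]]. destruct (Hc b hb r1 hr1) as [r [hr Hr]]. exists r. split; auto. intros Q HQ. exists (fun _ => false).
    intros b' Qb'. destruct (HQ b' Qb') as [p1 p2]. exists 1, false. split; [lra|]. split; [|auto].
    intros l'. exfalso. apply (H1 (G b')); auto.
Qed.

Definition rect (x1 x2 y1 y2 : R) (v : C) : Prop := x1 <= Re v <= x2 /\ y1 <= Im v <= y2.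

Lemma rect_closed x1 x2 y1 y2 : closedC (rect x1 x2 y1 y2).
Proof.
  intros z n.
  assert (H : exists e, 0 < e /\ (Re z + e <= x1 \/ x2 + e <= Re z \/ Im z + e <= y1 \/ y2 + e <= Im z)).
  { destruct (Rlt_dec (Re z) x1); [exists (x1 - Re z); lra|]. destruct (Rlt_dec x2 (Re z)); [exists (Re z - x2); lra|].
    destruct (Rlt_dec (Im z) y1); [exists (y1 - Im z); lra|]. destruct (Rlt_dec y2 (Im z)); [exists (Im z - y2); lra|].
    exfalso. apply n. unfold rect. lra. }
  destruct H as [e [he H]]. exists e. split; auto. intros w hw [h1 h2].
  assert (q1 := Rabs_Re_sub_le w z). assert (q2 := Rabs_Im_sub_le w z).
  apply Rabs_le_between in q1. apply Rabs_le_between in q2. lra.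
Qed.

Lemma rect_convex x1 x2 y1 y2 u v t : rect x1 x2 y1 y2 u -> rect x1 x2 y1 y2 v -> 0 <= t <= 1 ->
  rect x1 x2 y1 y2 (u + RtoC t * (v - u))%C.
Proof.
  unfold rect, Re, Im. intros [h1 h2] [h3 h4] ht. simpl.
  replace (fst u + (t * (fst v + - fst u) - 0 * (snd v + - snd u))) with ((1 - t) * fst u + t * fst v) by ring.
  replace (snd u + (t * (snd v + - snd u) + 0 * (fst v + - fst u))) with ((1 - t) * snd u + t * snd v) by ring.
  repeat split; nra.
Qed.

(** Simple connectivity of the rectangle in the form of Cousin's lemma: local sections exist, and
    those on four quarters are glued first to a lower and an upper half, then along the common edge,
    every overlap being convex. *)
Lemma flip_rect x1 x2 y1 y2 : 0 < x1 -> x1 < x2 -> y1 < y2 -> exists s, flip_section (rect x1 x2 y1 y2) s.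
Proof.
  intros hx1 hx hy.
  assert (H : exists s, flip_section (rect x1 (x1 + (x2 - x1) * 1) y1 (y1 + (y2 - y1) * 1)) s).
  { set (A := x2 - x1). set (B := y2 - y1).
    apply (cousin A B (fun x y h => exists s, flip_section (rect x (x + A * h) y (y + B * h)) s) x1 y1 1); unfold A, B; try lra; fold A; fold B.
    -
      intros x y h hh _ _ _ _ [s1 H1] [s2 H2] [s3 H3] [s4 H4].
      assert (e1 : x + A * (h / 2) + A * (h / 2) = x + A * h) by field.
      assert (e2 : y + B * (h / 2) + B * (h / 2) = y + B * h) by field.
      rewrite e1 in H2. rewrite e2 in H3. rewrite e1, e2 in H4.
      set (xm := x + A * (h/2)) in *. set (ym := y + B * (h/2)) in *. set (xx := x + A * h) in *. set (yy := y + B * h) in *.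
      destruct (flip_glue (rect x xm y ym) (rect xm xx y ym) s1 s2 (rect_closed _ _ _ _) (rect_closed _ _ _ _)) as [sb Hb]; auto.
      { intros u v t a1 a2 a3 a4 ht. split; apply rect_convex; auto. }
      destruct (flip_glue (rect x xm ym yy) (rect xm xx ym yy) s3 s4 (rect_closed _ _ _ _) (rect_closed _ _ _ _)) as [st Ht]; auto.
      { intros u v t a1 a2 a3 a4 ht. split; apply rect_convex; auto. }
      apply (flip_mono _ (rect x xx y ym)) in Hb. 2:{ intros v [v1 v2]. unfold rect. destruct (Rle_dec (Re v) xm); lra. }
      apply (flip_mono _ (rect x xx ym yy)) in Ht. 2:{ intros v [v1 v2]. unfold rect. destruct (Rle_dec (Re v) xm); lra. }
      destruct (flip_glue (rect x xx y ym) (rect x xx ym yy) sb st (rect_closed _ _ _ _) (rect_closed _ _ _ _)) as [s Hs]; auto.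
      { intros u v t a1 a2 a3 a4 ht. split; apply rect_convex; auto. }
      exists s. apply (flip_mono _ (rect x xx y yy)) in Hs; auto. intros v [v1 v2]. unfold rect. destruct (Rle_dec (Im v) ym); lra.
    - intros x0 y0' hx0 hy0'. destruct (flip_local (x0, y0')) as [r [hr H]]; [unfold Re; simpl; lra|].
      assert (hA : 0 < A) by (unfold A; lra).
      exists (r / (A + B)). split; [apply Rdiv_lt_0_compat; lra|]. intros x y h hh a1 a2 a3 a4 a5 a6.
      apply H. intros v [v1 v2]. split; [lra|].
      eapply Rle_lt_trans; [apply Cmod_le_fst_snd|]. unfold Re, Im in *. simpl.
      assert (Rabs (fst v + - x0) <= A * h) by (apply Rabs_le; lra).
      assert (Rabs (snd v + - y0') <= B * h) by (apply Rabs_le; lra).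
      destruct hh as [hh1 hh2]. apply Rmult_lt_compat_l with (r := A + B) in hh2; [|lra].
      replace ((A + B) * (r / (A + B))) with r in hh2 by (field; lra). lra. }
  replace (x1 + (x2 - x1) * 1) with x2 in H by ring. replace (y1 + (y2 - y1) * 1) with y2 in H by ring. exact H.
Qed.

Lemma flip_path (Q : C -> Prop) s (v : R -> C) p q : flip_section Q s -> p <= q -> pcont v p q ->
  (forall t, p <= t <= q -> Q (v t) /\ ~ L (G (v t))) -> s (v q) = s (v p).
Proof.
  intros Hs hpq hv H. apply (locally_constant bool (fun t => s (v t)) p q hpq); [|lra].
  intros t ht. destruct (H t ht) as [h1 h2]. destruct (Hs _ h1) as [r [e [hr [_ h3]]]].
  destruct (hv t ht r hr) as [d [hd Hd]]. exists d. split; auto. intros x hx hxt.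
  rewrite (h3 h2 (v x)), (h3 h2 (v t)); auto. rewrite Cmod_self. auto. apply H; auto.
Qed.

End Cut.
End Gulf.

(** * Existence of the cut that separates a point from infinity *)

Section GulfCut.
Variables (T : C -> Prop) (F : C -> C).
Hypothesis HT : tract_map T F.
Local Notation G := (tinv T F).
Variables (a : R) (zeta : C).
Hypothesis Hzeta : T zeta.
Hypothesis Hza : Re zeta < a.
Hypothesis Hray : exists t0, 0 <= t0 /\ forall t, t0 <= t -> a < Re (G (F zeta + RtoC t)%C).

Definition reach (w : C) : Prop := exists g, pcont g 0 1 /\ g 0 = zeta /\ g 1 = w /\
  forall s, 0 <= s <= 1 -> T (g s) /\ Re (g s) < a.

Let eta t : C := G (F zeta + RtoC t)%C.

Lemma eta_pos t : 0 <= t -> 0 < Re (F zeta + RtoC t)%C.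
Proof. intros ht. assert (h := tm_pos _ _ HT zeta Hzeta). unfold Re in *; simpl. lra. Qed.

Lemma eta_in t : 0 <= t -> T (eta t).
Proof. intros ht. apply tinv_int; auto. apply eta_pos; auto. Qed.

Lemma eta_0 : eta 0 = zeta.
Proof. unfold eta. replace (F zeta + RtoC 0)%C with (F zeta) by ring. apply tinv_left; auto. apply closure_self; auto. Qed.

Lemma eta_lip s t : 0 <= s -> 0 <= t -> Cmod (eta s - eta t) <= Rabs (s - t).
Proof.
  intros hs ht. assert (q := tinv_lip T F HT _ _ (Rlt_le _ _ (eta_pos s hs)) (Rlt_le _ _ (eta_pos t ht))).
  replace (F zeta + RtoC s - (F zeta + RtoC t))%C with (RtoC s - RtoC t)%C in q by ring.
  rewrite <- RtoC_minus, Cmod_R in q. fold (eta s) (eta t) in q. assert (h := Rabs_pos (s - t)). lra.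
Qed.

Lemma reach_start : reach zeta.
Proof.
  exists (fun _ => zeta). repeat split; auto. intros t _ e he. exists 1. split; [lra|]. intros. rewrite Cmod_self. auto.
Qed.

Lemma reach_segment w w' : reach w -> (forall r, 0 <= r <= 1 -> T (w + RtoC r * (w' - w))%C) -> Re w' < a -> reach w'.
Proof.
  intros [g [h1 [h2 [h3 h4]]]] H hw'. destruct (path_append g w' h1) as [g' [k1 [k2 [k3 k4]]]].
  exists g'. rewrite k2, k3. split; [auto|split; [auto|split; [auto|]]]. intros s H0. split; destruct (k4 s H0) as [[r [hr ->]]|[r [hr [_ ->]]]]; try apply h4; auto; rewrite h3.
  - apply H; auto.
  - rewrite Re_segment_eq. destruct (h4 1 ltac:(lra)) as [_ q]. rewrite h3 in q.
    destruct (Req_dec r 0) as [->|]; [lra|]. assert (r * Re w' < r * a) by (apply Rmult_lt_compat_l; lra).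
    assert ((1 - r) * Re w <= (1 - r) * a) by (apply Rmult_le_compat_l; lra). lra.
Qed.

Lemma reach_in w : reach w -> T w /\ Re w < a.
Proof. intros [g [_ [_ [h3 h4]]]]. rewrite <- h3. apply h4. lra. Qed.

Lemma reach_ball c r w w' : (forall x : C, Cmod (x - c) < r -> T x) -> reach w -> Cmod (w - c) < r -> Cmod (w' - c) < r -> Re w' < a -> reach w'.
Proof. intros H hw h1 h2 h3. apply (reach_segment w); auto. intros t ht. apply H. apply segment_ball; auto. Qed.

(* Leave the component of zeta in {Re < a} along the geodesic from zeta for the last time, at b. *)
Lemma last_exit : exists t1, 0 <= t1 /\ Re (eta t1) = a /\ (forall t, t1 < t -> ~ reach (eta t)) /\
  (forall d, 0 < d -> exists w, reach w /\ Cmod (w - eta t1) < d).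
Proof.
  destruct Hray as [t0 [ht0 H0]].
  destruct (completeness (fun t => 0 <= t /\ reach (eta t))) as [t1 [Hu Hl]].
  { exists t0. intros t [h1 h2]. apply Rnot_lt_le. intros c. apply reach_in in h2. assert (q := H0 t ltac:(lra)). unfold eta in h2. lra. }
  { exists 0. split; [lra|]. rewrite eta_0. apply reach_start. }
  assert (h1 : 0 <= t1). { apply Hu. split; [lra|]. rewrite eta_0. apply reach_start. }
  assert (Hnear : forall d, 0 < d -> exists t, 0 <= t /\ t1 - d < t <= t1 /\ reach (eta t)).
  { intros d hd. apply NNPP. intros n. assert (t1 <= t1 - d); [|lra]. apply Hl. intros t [k1 k2]. apply Rnot_lt_le. intros c.
    apply n. exists t. repeat split; auto. }
  assert (Hnear' : forall d, 0 < d -> exists w, reach w /\ Cmod (w - eta t1) < d).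
  { intros d hd. destruct (Hnear d hd) as [t [k1 [k2 k3]]]. exists (eta t). split; auto.
    eapply Rle_lt_trans; [apply eta_lip; auto|]. apply Rabs_def1; lra. }
  assert (Hafter : forall t, t1 < t -> ~ reach (eta t)).
  { intros t k1 k2. assert (t <= t1); [|lra]. apply Hu. split; [lra|auto]. }
  exists t1. split; auto. split; auto.
  destruct (Rtotal_order (Re (eta t1)) a) as [c|[c|c]]; auto; exfalso.
  - destruct (tm_open _ _ HT _ (eta_in t1 h1)) as [r [hr Hr]].
    set (d := Rmin r (a - Re (eta t1))). assert (hd : 0 < d) by (apply Rmin_glb_lt; lra).
    assert (d1 : d <= r) by apply Rmin_l. assert (d2 : d <= a - Re (eta t1)) by apply Rmin_r.
    destruct (Hnear' d hd) as [w [k1 k2]].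
    assert (m : Cmod (eta (t1 + d / 2) - eta t1) < d).
    { eapply Rle_lt_trans; [apply eta_lip; lra|]. apply Rabs_def1; lra. }
    apply (Hafter (t1 + d / 2)); [lra|]. apply (reach_ball (eta t1) r w); auto; try lra.
    assert (q := Re_sub_le (eta (t1 + d / 2)) (eta t1)). lra.
  - destruct (Hnear' (Re (eta t1) - a)) as [w [k1 k2]]; [lra|]. apply reach_in in k1.
    assert (q := Re_sub_le (eta t1) w). rewrite Cmod_sym in q. lra.
Qed.

Lemma ccont_path (g : R -> C) p q : pcont g p q -> (forall t, p <= t <= q -> T (g t)) -> pcont (fun t => F (g t)) p q.
Proof.
  intros hg hT t ht e he. destruct (tm_der _ _ HT (g t) (hT t ht)) as [d [D _]]. apply cder_ccont in D.
  destruct (D e he) as [d1 [hd1 H1]]. destruct (hg t ht d1 hd1) as [d2 [hd2 H2]]. exists d2. split; auto.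
Qed.

Lemma pcont_hor (x : C) p q : pcont (fun t => x + RtoC t)%C p q.
Proof.
  intros t ht e he. exists e. split; auto. intros s _ h.
  replace (x + RtoC s - (x + RtoC t))%C with (RtoC s - RtoC t)%C by ring. rewrite <- RtoC_minus, Cmod_R. auto.
Qed.

(** The cut passes through the last exit [b] of the geodesic from [zeta]. Were there a path from
    [zeta] to infinity off the cut, its image, a detour beyond F(L) and the geodesic followed
    backwards to [b] would join [F zeta] to [F b] without change of the section. But a path inside
    [{Re < a}] leads from [zeta] to points just left of [b], also without change, and the section
    changes between those points and [F b]. *)
Lemma gulf_cut_exists : exists y0, T (a, y0) /\
  separates_from_infty T (vline_component T a y0) zeta /\ joinable_left T (vline_component T a y0) a zeta.
Proof.
  destruct last_exit as [t1 [ht1 [hb [Hafter Hnear]]]]. set (b := eta t1) in *. set (y0 := Im b).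
  assert (Eb : b = (a, y0)) by (unfold y0; rewrite <- hb; destruct b; auto).
  assert (Tb : T b) by (apply eta_in; auto). assert (Ty : T (a, y0)) by (rewrite <- Eb; auto).
  assert (Lb : vline_component T a y0 b) by (rewrite Eb; apply cut_base; auto).
  exists y0. split; auto.
  assert (Fb : F b = (F zeta + RtoC t1)%C) by (apply F_tinv; auto; apply Rlt_le, eta_pos; auto).
  assert (pFb : 0 < Re (F b)) by (apply (tm_pos _ _ HT); auto).
  destruct (tm_open _ _ HT b Tb) as [r0 [hr0 H0]].
  destruct (tm_der _ _ HT b Tb) as [dF [DF _]]. apply cder_ccont in DF. destruct (DF (Re (F b) / 2)) as [r1 [hr1 H1]]; [lra|].
  set (r := Rmin r0 r1). assert (hr : 0 < r) by (apply Rmin_glb_lt; auto).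
  assert (rr0 : r <= r0) by apply Rmin_l. assert (rr1 : r <= r1) by apply Rmin_r.
  assert (HTr : forall x : C, Cmod (x - b) < r -> T x) by (intros x hx; apply H0; lra).
  destruct (Hnear r hr) as [w1 [U1 hw1]].
  assert (rw1 : Re w1 < a) by (apply reach_in; auto).
  assert (Hleft0 : forall v : C, Cmod (v - b) < r -> Re v < a -> reach v).
  { intros v hv hva. apply (reach_ball b r w1); auto. }
  split.
  2:{ destruct U1 as [g [g1 [g2 [g3 g4]]]]. destruct (path_append g b g1) as [g' [k1 [k2 [k3 k4]]]].
      exists g'. split; [|split; [|split]].
      - intros t ht e he. destruct (k1 t ht e) as [d [hd Hd]]; [lra|]. exists d. split; [lra|]. intros s hs h.
        rewrite Cnorm_Cmod. apply (Hd s hs h).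
      - rewrite k2. auto.
      - rewrite k3. auto.
      - intros s hs. destruct (k4 s) as [[q [hq ->]]|[q [hq [hq1 ->]]]]; [lra|apply g4; auto|]. rewrite g3. split.
        + apply HTr. apply segment_ball; auto. rewrite Cmod_self. auto.
        + rewrite Re_segment_eq, hb. destruct (Req_dec q 1) as [e|n]; [specialize (hq1 e); lra|].
          assert ((1 - q) * Re w1 < (1 - q) * a) by (apply Rmult_lt_compat_l; lra). lra. }
  set (L := vline_component T a y0).
  (* Near [b] the left side of the cut belongs to the component of [zeta]; real induction carries
     this along the vertical segment to every point of the cut. *)
  assert (Hleft : forall l, L l -> exists q, 0 < q /\ forall v : C, Cmod (v - l) < q -> Re v < a -> reach v).
  { intros l [l1 l2]. set (yl := Im l) in *. set (pt := fun s => ((a, y0 + s * (yl - y0)) : C)).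
    assert (Hpt : forall s, 0 <= s <= 1 -> T (pt s)).
    { intros s hs. apply l2. unfold Rmin, Rmax. repeat destruct Rle_dec; split; nra. }
    assert (Hd : forall s s', Cmod (pt s - pt s') <= Rabs (yl - y0) * Rabs (s - s')).
    { intros s s'. unfold pt. eapply Rle_trans; [apply vline_dist|].
      replace (y0 + s * (yl - y0) - (y0 + s' * (yl - y0))) with ((yl - y0) * (s - s')) by ring. rewrite Rabs_mult. lra. }
    set (good := fun s => exists q, 0 < q /\ forall v : C, Cmod (v - pt s) < q -> Re v < a -> reach v).
    assert (Hspread : forall s s' q, 0 <= s' <= 1 -> (forall x : C, Cmod (x - pt s') < q -> T x) -> Cmod (pt s - pt s') < q -> good s ->
              forall v : C, Cmod (v - pt s') < q -> Re v < a -> reach v).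
    { intros s s' q hs' hq hss [q1 [hq1 Hq1]] v hv hva.
      set (m := Rmin q1 (q - Cmod (pt s - pt s')) / 2).
      assert (hm : 0 < Rmin q1 (q - Cmod (pt s - pt s'))) by (apply Rmin_glb_lt; lra).
      assert (m1 := Rmin_l q1 (q - Cmod (pt s - pt s'))). assert (m2 := Rmin_r q1 (q - Cmod (pt s - pt s'))).
      set (x := (pt s - RtoC m)%C).
      assert (ex : Cmod (x - pt s) = m).
      { unfold x. replace (pt s - RtoC m - pt s)%C with (- RtoC m)%C by ring. rewrite Cmod_opp, Cmod_R, Rabs_right; unfold m; lra. }
      assert (rx : Re x < a) by (unfold x, pt, Re; simpl; unfold m; lra).
      apply (reach_ball (pt s') q x); auto.
      - apply Hq1; auto. unfold m in *; lra.
      - assert (t := Cmod_triangle3 x (pt s) (pt s')). unfold m in *; lra. }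
    assert (Hg : good 1).
    { apply (real_induction good 0 1); [lra| | | |lra].
      - exists r. split; auto. assert (e : pt 0 = b) by (rewrite Eb; unfold pt; f_equal; ring). rewrite e. auto.
      - intros s hs IH. destruct (IH s ltac:(lra)) as [q [hq Hq]]. exists (q / (2 * (Rabs (yl - y0) + 1))).
        assert (hp := Rabs_pos (yl - y0)).
        split; [apply Rdiv_lt_0_compat; lra|]. intros s' hs' hs1. exists (q / 2). split; [lra|]. intros v hv hva.
        apply Hq; auto. assert (t := Cmod_triangle3 v (pt s') (pt s)). assert (t2 := Hd s' s). rewrite (Rabs_right (s' - s)) in t2 by lra.
        assert (s' - s < q / (2 * (Rabs (yl - y0) + 1))) by lra.
        assert ((Rabs (yl - y0) + 1) * (s' - s) < q / 2).
        { apply Rmult_lt_compat_l with (r := Rabs (yl - y0) + 1) in H; [|lra].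
          replace ((Rabs (yl - y0) + 1) * (q / (2 * (Rabs (yl - y0) + 1)))) with (q / 2) in H by (field; lra). auto. }
        nra.
      - intros s hs IH. destruct (tm_open _ _ HT (pt s) (Hpt s ltac:(lra))) as [q [hq Hq]].
        assert (hp := Rabs_pos (yl - y0)).
        set (d := q / (2 * (Rabs (yl - y0) + 1))). assert (hd : 0 < d) by (apply Rdiv_lt_0_compat; lra).
        set (s' := Rmax 0 (s - d)). assert (b1 : 0 <= s') by apply Rmax_l. assert (b2 : s - d <= s') by apply Rmax_r.
        assert (b3 : s' < s) by (apply Rmax_lub_lt; lra).
        exists q. split; auto. apply (Hspread s' s q); auto; [lra|].
        assert (t2 := Hd s' s). rewrite (Rabs_left (s' - s)) in t2 by lra.
        assert ((Rabs (yl - y0) + 1) * d = q / 2) by (unfold d; field; lra). nra. }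
    assert (e : pt 1 = l). { unfold pt, yl. rewrite <- l1. destruct l; unfold Re, Im; simpl. f_equal; ring. }
    unfold good in Hg. rewrite e in Hg. auto. }
  intros g gc g0 gT ginf. apply NNPP. intros Hn.
  assert (gL : forall t, 0 <= t -> ~ L (g t)) by (intros t ht l; apply Hn; exists t; split; [lra|auto]).
  assert (gT' : forall t, 0 <= t -> T (g t)).
  { intros t ht. destruct (Req_dec t 0) as [->|]; [rewrite g0; auto|apply gT; lra]. }
  destruct (cut_F_bounded T F HT a y0 Ty) as [RL HRL].
  (* The path is stopped once [|F (g S)|] exceeds the bound [RL] on F(L); contraction of [G] shows
     that this happens when [g S] is far from [G 1]. *)
  destruct (ginf (Cmod (G (RtoC 1)) + Rabs RL + 2)) as [S0 HS0].
  set (S := Rmax S0 0). assert (s1 : S0 <= S) by apply Rmax_l. assert (s2 : 0 <= S) by apply Rmax_r.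
  specialize (HS0 S ltac:(lra)). rewrite Cnorm_Cmod in HS0.
  set (P1 := F (g S)). assert (pP1 : 0 < Re P1) by (apply (tm_pos _ _ HT); auto).
  assert (bP1 : RL < Cmod P1).
  { apply Rnot_le_lt. intros c. assert (q := tinv_lip T F HT P1 (RtoC 1) ltac:(lra) ltac:(unfold Re; simpl; lra)).
    unfold P1 in q. rewrite tinv_left in q by (auto; apply closure_self; auto).
    assert (q1 := Cmod_sub_le (g S) (G (RtoC 1))). assert (q2 := Cmod_le_add P1 (RtoC 1)). rewrite Cmod_1 in q2.
    fold P1 in q. assert (q3 := Rle_abs RL). assert (q4 := Rabs_pos RL). lra. }
  assert (vg : pcont (fun t => F (g t)) 0 S).
  { apply ccont_path; [|intros; apply gT'; lra]. intros t ht e he. destruct (gc t ltac:(lra) e) as [d [hd Hd]]; [lra|].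
    exists d. split; [lra|]. intros s hs h. specialize (Hd s ltac:(lra) h). rewrite Cnorm_Cmod in Hd. exact Hd. }
  destruct U1 as [u [u1 [u2 [u3 u4]]]].
  assert (vu : pcont (fun t => F (u t)) 0 1) by (apply ccont_path; auto; intros; apply u4; auto).
  destruct (path_bounds _ 0 S s2 vg) as [x1 [Y1 [hx1 B1]]]; [intros t ht; apply (tm_pos _ _ HT); apply gT'; lra|].
  destruct (path_bounds _ 0 1 Rle_0_1 vu) as [x2 [Y2 [hx2 B2]]]; [intros t ht; apply (tm_pos _ _ HT); apply u4; auto|].
  assert (pz := tm_pos _ _ HT zeta Hzeta).
  set (xm := Rmin (Rmin x1 x2) (Rmin (Re (F b) / 2) (Re (F zeta)))).
  assert (m1 := Rmin_l (Rmin x1 x2) (Rmin (Re (F b) / 2) (Re (F zeta)))). assert (m2 := Rmin_r (Rmin x1 x2) (Rmin (Re (F b) / 2) (Re (F zeta)))).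
  assert (m3 := Rmin_l x1 x2). assert (m4 := Rmin_r x1 x2). assert (m5 := Rmin_l (Re (F b) / 2) (Re (F zeta))). assert (m6 := Rmin_r (Re (F b) / 2) (Re (F zeta))).
  fold xm in m1, m2. assert (hxm : 0 < xm) by (unfold xm; repeat apply Rmin_glb_lt; lra).
  assert (N1 := Cmod_ge_0 P1). assert (N2 := Cmod_ge_0 (F b)). assert (N3 := Cmod_ge_0 (F zeta)).
  assert (hY1 : 0 <= Y1). { destruct (B1 0 ltac:(lra)) as [_ q]. eapply Rle_trans; [apply Cmod_ge_0|apply q]. }
  assert (hY2 : 0 <= Y2). { destruct (B2 0 ltac:(lra)) as [_ q]. eapply Rle_trans; [apply Cmod_ge_0|apply q]. }
  (* Large enough for the rectangle to contain all curves used below, and for its right side to lie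
     beyond F(L). *)
  set (Y := Y1 + Y2 + Cmod P1 + 2 * Cmod (F b) + Cmod (F zeta) + Rabs RL + t1 + 1).
  assert (aRL := Rle_abs RL). assert (aRL' := Rabs_pos RL).
  assert (f1 := Cmod_fst_le P1). assert (f2 := Cmod_snd_le P1). assert (f3 := Cmod_fst_le (F b)). assert (f4 := Cmod_snd_le (F b)).
  assert (f5 := Cmod_fst_le (F zeta)). assert (f6 := Cmod_snd_le (F zeta)).
  apply Rabs_le_between in f1. apply Rabs_le_between in f2. apply Rabs_le_between in f3. apply Rabs_le_between in f4. apply Rabs_le_between in f5. apply Rabs_le_between in f6.
  unfold Re in pP1, pFb, m1, m2, m5, m6, pz.
  set (Q := rect xm Y (- Y) Y).
  assert (HQ : forall v : C, xm <= Re v -> Cmod v <= Y -> Q v).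
  { intros v h1 h2. assert (q1 := Cmod_fst_le v). assert (q2 := Cmod_snd_le v). apply Rabs_le_between in q1. apply Rabs_le_between in q2.
    unfold Q, rect, Re, Im in *. lra. }
  destruct (flip_rect T F HT a y0 xm Y (- Y) Y) as [s Hs]; auto; [unfold Y; lra|unfold Y; lra|]. fold Q in Hs.
  assert (C1 : s P1 = s (F zeta)).
  { assert (q := flip_path T F a y0 Q s (fun t => F (g t)) 0 S Hs s2 vg). simpl in q. rewrite g0 in q. apply q.
    intros t ht. destruct (B1 t ht) as [k1 k2]. split; [apply HQ; unfold Y; lra|].
    rewrite tinv_left by (auto; apply closure_self, gT'; lra). apply gL. lra. }
  assert (Hout : forall v : C, 0 < Re v -> RL < Cmod v -> ~ L (G v)).
  { intros v hv hv2 l. assert (q := HRL _ l). rewrite F_tinv in q by (auto; lra). lra. }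
  assert (C2 : s (P1 + RtoC (Y - fst P1))%C = s P1).
  { assert (q := flip_path T F a y0 Q s (fun t => P1 + RtoC t)%C 0 (Y - fst P1) Hs ltac:(unfold Y in *; lra) (pcont_hor _ _ _)).
    simpl in q. replace (P1 + RtoC 0)%C with P1 in q by ring. apply q. intros t ht.
    destruct (B1 S ltac:(lra)) as [k1 _]. fold P1 in k1. unfold Re in k1. split.
    - unfold Q, rect, Re, Im; simpl. unfold Y in *. lra.
    - apply Hout; [unfold Re; simpl; lra|]. eapply Rlt_le_trans; [apply bP1|].
      assert (k2 := Cmod_sq P1). assert (k3 := Cmod_sq (P1 + RtoC t)). simpl in k3.
      assert (k4 := Cmod_ge_0 (P1 + RtoC t)). nra. }
  assert (C3 : s (F zeta + RtoC (Y - fst (F zeta)))%C = s (P1 + RtoC (Y - fst P1))%C).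
  { set (v := fun t => ((Y, snd P1)%R + RtoC t * ((Y, snd (F zeta))%R - (Y, snd P1)%R))%C).
    assert (Ev : forall t, v t = (Y, snd P1 + t * (snd (F zeta) - snd P1))) by (intros t; unfold v, Cplus, Cminus, Cmult, Copp, RtoC; simpl; f_equal; ring).
    assert (q := flip_path T F a y0 Q s v 0 1 Hs Rle_0_1 (pcont_segment _ _ 0 1)).
    replace (F zeta + RtoC (Y - fst (F zeta)))%C with (v 1) by (rewrite Ev; unfold Cplus, RtoC; simpl; f_equal; ring).
    replace (P1 + RtoC (Y - fst P1))%C with (v 0) by (rewrite Ev; unfold Cplus, RtoC; simpl; f_equal; ring).
    apply q. intros t ht. rewrite Ev. split.
    - assert (e1 : (1 - t) * snd P1 <= (1 - t) * Cmod P1) by (apply Rmult_le_compat_l; lra).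
      assert (e2 : t * snd (F zeta) <= t * Cmod (F zeta)) by (apply Rmult_le_compat_l; lra).
      assert (e3 : (1 - t) * (- Cmod P1) <= (1 - t) * snd P1) by (apply Rmult_le_compat_l; lra).
      assert (e4 : t * (- Cmod (F zeta)) <= t * snd (F zeta)) by (apply Rmult_le_compat_l; lra).
      assert (e5 : (1 - t) * Cmod P1 <= 1 * Cmod P1) by (apply Rmult_le_compat_r; lra).
      assert (e6 : t * Cmod (F zeta) <= 1 * Cmod (F zeta)) by (apply Rmult_le_compat_r; lra).
      unfold Q, rect, Re, Im; simpl. unfold Y in *. lra.
    - apply Hout; [unfold Re, Y; simpl; unfold Y in *; lra|].
      eapply Rlt_le_trans; [|apply Cmod_fst_le]. simpl. assert (k2 := Rle_abs Y). unfold Y in *. lra. }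
  assert (QF : forall t, t1 <= t <= Y - fst (F zeta) -> Q (F zeta + RtoC t)%C).
  { intros t ht. unfold Q, rect, Re, Im; simpl. unfold Y in *. lra. }
  (* After [t1] the geodesic may touch the cut but does not cross it: by [Hleft] the left side is in
     the component that it has left for good, so [right_of] is true on both sides of such a time. *)
  assert (C4 : s (F zeta + RtoC (Y - fst (F zeta)))%C = s (F zeta + RtoC t1)%C).
  { apply (locally_constant bool (fun t => s (F zeta + RtoC t)%C) t1 (Y - fst (F zeta))); [unfold Y; lra| |unfold Y; lra].
    intros t ht. destruct (Hs _ (QF t ht)) as [q [e [hq [k1 k2]]]].
    destruct (classic (L (G (F zeta + RtoC t)%C))) as [l|l].
    - destruct (Hleft _ l) as [ql [hql Hql]]. exists (Rmin q ql). split; [apply Rmin_glb_lt; auto|]. intros x hx h.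
      destruct (Rlt_Rmin h) as [x1' x2'].
      assert (Hright : forall x, t1 <= x -> Rabs (x - t) < ql -> right_of T F a (F zeta + RtoC x)%C = true).
      { intros y hy hyt. unfold right_of. fold (eta y). destruct (Rle_dec a (Re (eta y))) as [c|c]; auto. exfalso.
        destruct (Req_dec y t1) as [->|n]; [fold b in c; lra|]. apply (Hafter y); [lra|]. apply Hql; [|lra].
        fold (eta t). eapply Rle_lt_trans; [apply eta_lip; lra|auto]. }
      rewrite (k1 l (F zeta + RtoC x)%C), (k1 l (F zeta + RtoC t)%C); auto.
      + rewrite !Hright; auto; try lra. rewrite Rminus_diag, Rabs_R0. auto.
      + rewrite Cmod_self; auto.
      + replace (F zeta + RtoC x - (F zeta + RtoC t))%C with (RtoC x - RtoC t)%C by ring. rewrite <- RtoC_minus, Cmod_R. auto.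
    - exists q. split; auto. intros x hx h. rewrite (k2 l (F zeta + RtoC x)%C), (k2 l (F zeta + RtoC t)%C); auto.
      + rewrite Cmod_self; auto.
      + replace (F zeta + RtoC x - (F zeta + RtoC t))%C with (RtoC x - RtoC t)%C by ring. rewrite <- RtoC_minus, Cmod_R. auto. }
  rewrite <- Fb in C4.
  assert (C5 : s (F w1) = s (F zeta)).
  { assert (q := flip_path T F a y0 Q s (fun t => F (u t)) 0 1 Hs Rle_0_1 vu). simpl in q. rewrite u2, u3 in q. apply q.
    intros t ht. destruct (B2 t ht) as [k1 k2]. split; [apply HQ; unfold Y; lra|].
    destruct (u4 t ht) as [k3 k4]. rewrite tinv_left by (auto; apply closure_self; auto). intros [l _]. lra. }
  assert (QbF : Q (F b)) by (apply HQ; [unfold Re|unfold Y]; lra).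
  destruct (Hs (F b) QbF) as [q [e [hq [k1 _]]]].
  assert (GFb : G (F b) = b) by (apply tinv_left; auto; apply closure_self; auto).
  rewrite GFb in k1. specialize (k1 Lb).
  destruct (DF q hq) as [q' [hq' Hq']].
  set (m := Rmin q' r / 2). assert (hm : 0 < Rmin q' r) by (apply Rmin_glb_lt; auto).
  assert (mm1 := Rmin_l q' r). assert (mm2 := Rmin_r q' r).
  set (wl := (b - RtoC m)%C).
  assert (ewl : Cmod (wl - b) = m).
  { unfold wl. replace (b - RtoC m - b)%C with (- RtoC m)%C by ring. rewrite Cmod_opp, Cmod_R, Rabs_right; unfold m; lra. }
  assert (rwl : Re wl < a) by (rewrite <- hb; unfold wl, Re; simpl; unfold m; lra).
  set (sg := fun t => (w1 + RtoC t * (wl - w1))%C).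
  assert (Hsg : forall t, 0 <= t <= 1 -> Cmod (sg t - b) < r) by (intros t ht; apply segment_ball; auto; unfold m in *; lra).
  assert (HQr : forall v : C, Cmod (v - b) < r -> Q (F v)).
  { intros v hv. specialize (H1 v ltac:(lra)). assert (z1 := Re_sub_le (F b) (F v)). rewrite Cmod_sym in z1.
    assert (z2 := Cmod_sub_le (F v) (F b)). apply HQ; unfold Re in *; [lra|unfold Y; lra]. }
  assert (C6 : s (F wl) = s (F w1)).
  { assert (z := flip_path T F a y0 Q s (fun t => F (sg t)) 0 1 Hs Rle_0_1 (ccont_path sg 0 1 (pcont_segment _ _ 0 1) (fun t ht => HTr _ (Hsg t ht)))).
    simpl in z. replace (sg 0) with w1 in z by (unfold sg; ring). replace (sg 1) with wl in z by (unfold sg; ring). apply z.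
    intros t ht. split; [apply HQr; auto|]. rewrite tinv_left by (auto; apply closure_self; auto).
    intros [l _]. unfold sg in l. rewrite Re_segment_eq in l.
    destruct (Req_dec t 0) as [e0|]; [subst t; lra|]. assert (t * Re wl < t * a) by (apply Rmult_lt_compat_l; lra).
    assert ((1 - t) * Re w1 <= (1 - t) * a) by (apply Rmult_le_compat_l; lra). lra. }
  (* The contradiction: [b] counts as right of the cut, [wl] as left of it, in one neighbourhood
     where the section is [right_of] up to a constant. *)
  assert (V1 : s (F b) = xorb e true).
  { rewrite (k1 (F b)); auto; [|rewrite Cmod_self; auto]. f_equal. unfold right_of. rewrite GFb. destruct (Rle_dec a (Re b)); auto; lra. }
  assert (V2 : s (F wl) = xorb e false).
  { rewrite (k1 (F wl)).
    - f_equal. unfold right_of. rewrite tinv_left by (auto; apply closure_self, HTr; unfold m in *; lra). destruct (Rle_dec a (Re wl)); auto; lra.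
    - apply HQr. unfold m in *; lra.
    - apply Hq'. unfold m in *; lra. }
  rewrite C6, C5, <- C1, <- C2, <- C3, C4, V1 in V2. destruct e; discriminate.
Qed.

End GulfCut.

(** * Expansion of |F| *)

Lemma exp_le (x y : R) : x <= y -> exp x <= exp y.
Proof. intros [h| ->]; [left; apply exp_increasing; auto|lra]. Qed.

Lemma ln_le (x y : R) : 0 < x -> x <= y -> ln x <= ln y.
Proof. intros hx [h| ->]; [left; apply ln_increasing; auto|lra]. Qed.

Section HalfDisc.
Variables (T : C -> Prop) (F : C -> C).
Hypothesis HT : tract_map T F.
Local Notation G := (tinv T F).

(* If Re G <= A on a boundary segment, Re G cannot exceed A by much at hyperbolically bounded
   distance from it: compare on a half-disc with harmonic polynomials.  The power of (v^2+1)/2, of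
   modulus Re v on the unit circle, absorbs the logarithmic growth allowed by [tinv_hyp_bound]. *)
Lemma half_disc_estimate : exists C5, 0 <= C5 /\ forall Y A, Y <> 0 ->
  (forall y, 0 < y < Y \/ Y < y < 0 -> Re (G (0, y)) <= A) -> Re (G (Rabs Y / 4, Y / 2)) <= A + C5.
Proof.
  assert (hCK := bloch_const_pos). destruct (INR_unbounded bloch_const) as [n Hn].
  assert (hn : 0 < INR n) by lra. assert (hl4 : 0 < ln 4) by (rewrite <- ln_1; apply ln_increasing; lra).
  exists (2 * (INR n + bloch_const + bloch_const * ln 4)). split; [nra|]. intros Y A hY HA.
  set (rho := Rabs Y / 4). assert (hrho : 0 < rho) by (unfold rho; assert (h := Rabs_pos_lt Y hY); lra).
  set (V := Re (G (rho, Y / 2))).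
  destruct (Rle_dec V A) as [c|c]; [assert (0 < bloch_const * ln 4) by nra; lra|]. assert (hVA : 0 < V - A) by lra.
  (* Maps the unit half-disc onto the one centred at iY/2 with radius [|Y| / 4], whose diameter
     stays strictly between 0 and iY; the point to be estimated is the image of 1. *)
  set (p := fun v : C => ((0, Y / 2)%R + RtoC rho * v)%C).
  assert (Rp : forall v, Re (p v) = rho * Re v) by (intros v; unfold p, Re; simpl; ring).
  assert (Ip : forall v, Im (p v) = Y / 2 + rho * Im v) by (intros v; unfold p, Im; simpl; ring).
  (* The real part of [2 v - v^2] is at least 1 on the unit arc, where [Re G] may be as large as
     [V], and nonnegative on the diameter, where [Re G <= A]. At [v = 1/4] it is only 7/16, while
     [Re G] has dropped from [V] by a bounded amount; the remaining 9/16 of [V - A] is bounded,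
     whence the factor 2 in the constant. *)
  set (E := fun v : C => (G (p v) - RtoC (A + bloch_const) - RtoC (V - A) * (RtoC 2 * v - v * v))%C).
  set (W := fun v : C => Cpow ((v * v + 1) / RtoC 2)%C n).
  set (Phi := fun v : C => (Cexp (E v) * W v)%C).
  assert (hsq : forall v : C, cder (fun v => v * v)%C v (1 * v + v * 1)) by (intros v; apply (cder_mult (fun v => v) (fun v => v)); apply cder_id).
  assert (Wd : forall v, exists d, cder W v d).
  { intros v. unfold W. eapply cder_pow. unfold Cdiv. apply (cder_mult (fun v => v * v + 1)%C (fun _ => / RtoC 2)%C).
    apply cder_plus; [apply hsq|apply cder_const]. apply cder_const. }
  assert (Ld : forall v, cder (fun v => RtoC (V - A) * (RtoC 2 * v - v * v))%C v (RtoC (V - A) * (RtoC 2 * 1 - (1 * v + v * 1)))).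
  { intros v. apply cder_scal, cder_minus; auto. apply cder_scal, cder_id. }
  assert (Phid : forall v, 0 < Re v -> v <> RtoC (-1) -> exists d, cder Phi v d).
  { intros v hv _. destruct (tinv_cder T F HT (p v)) as [d [D _]]; [rewrite Rp; nra|].
    destruct (Wd v) as [dw DW].
    assert (DE : cder E v (d * (0 + RtoC rho * 1) - 0 - (RtoC (V - A) * (RtoC 2 * 1 - (1 * v + v * 1))))%C).
    { unfold E. apply cder_minus; auto. apply cder_minus; [|apply cder_const].
      apply (cder_comp G p); auto. unfold p. apply cder_plus; [apply cder_const|]. apply cder_scal, cder_id. }
    eexists. apply cder_mult; [|apply DW]. apply (cder_comp Cexp E); [apply DE|apply cder_Cexp]. }
  assert (Phic : forall v, 0 < Re v -> ccont Phi v).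
  { intros v hv. destruct (Phid v hv) as [d D]; [intros ->; unfold Re in hv; simpl in hv; lra|]. eapply cder_ccont; eauto. }
  assert (PhiM : forall v, Cmod (Phi v) = exp (Re (G (p v)) - (A + bloch_const) - (V - A) * (2 * Re v - (Re v * Re v - Im v * Im v))) * Cmod ((v * v + 1) / RtoC 2)%C ^ n).
  { intros v. unfold Phi. rewrite Cmod_mult, Cmod_Cexp. unfold W. rewrite Cmod_pow. f_equal. f_equal.
    unfold E, Re, Im; simpl. ring. }
  assert (M2 : forall v : C, Cmod ((v * v + 1) / RtoC 2)%C = Cmod (v * v + 1) / 2).
  { intros v. rewrite Cmod_div, Cmod_R, Rabs_right; auto; [lra|]. intros e. injection e. lra. }
  assert (Hnear : forall x y, 0 < x <= 1 -> Rabs y <= 1 -> Cmod (G (p (x, y)) - G (p (RtoC 1))) <= bloch_const * (Rabs y - ln x)).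
  { intros x y hx hy. eapply Rle_trans; [apply tinv_hyp_bound; auto; rewrite Rp; unfold Re; simpl; nra|].
    apply Rmult_le_compat_l; [lra|]. unfold hyp_dist. rewrite !Rp, !Ip. unfold Re, Im; simpl.
    rewrite Rmax_right by nra. rewrite !ln_mult, ln_1 by lra.
    replace (Y / 2 + rho * y - (Y / 2 + rho * 0)) with (rho * y) by ring.
    rewrite Rabs_mult, (Rabs_right rho) by lra. replace (rho * Rabs y / (rho * 1)) with (Rabs y) by (field; lra).
    replace (ln rho + ln x - (ln rho + 0)) with (ln x) by ring.
    assert (q : ln x <= 0) by (rewrite <- ln_1; apply ln_le; lra). rewrite (Rabs_left1 (ln x)) by lra. lra. }
  assert (p1 : p (RtoC 1) = (rho, Y / 2)) by (unfold p, Cplus, Cmult, RtoC; simpl; f_equal; ring).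
  assert (Hmax : Cmod (Phi (RtoC (1/4))) <= 1).
  { apply (max_modulus_half_disc Phi (RtoC (-1)) 1); auto; [| | |unfold Re; simpl; lra|rewrite Cmod_R, Rabs_right; lra].
    - intros z [hz1 hz2]. change (ccw (fun u => 0 <= Re u /\ Cmod u <= 1) Phi z).
      unfold Phi. apply ccw_mult; [|destruct (Wd z) as [d D]; apply ccont_ccw; eapply cder_ccont; eauto].
      apply (ccw_comp _ Cexp E); [|eapply cder_ccont; apply cder_Cexp].
      unfold E, Cminus. apply ccw_plus; [apply ccw_plus|].
      + intros e he. exists (e / rho). split; [apply Rdiv_lt_0_compat; auto|]. intros w [hw1 hw2] hw.
        assert (q := tinv_lip T F HT (p w) (p z) ltac:(rewrite Rp; nra) ltac:(rewrite Rp; nra)).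
        replace (p w - p z)%C with (RtoC rho * (w - z))%C in q by (unfold p; ring).
        rewrite Cmod_mult, Cmod_R, Rabs_right in q by lra. apply Rmult_lt_compat_l with (r := rho) in hw; auto.
        replace (rho * (e / rho)) with e in hw by (field; lra).
        lra.
      + apply ccont_ccw, ccont_const.
      + apply ccont_ccw. eapply cder_ccont.
        apply cder_ext_loc with (f := fun v => (RtoC (-1) * (RtoC (V - A) * (RtoC 2 * v - v * v)))%C) (r := 1); [lra| |apply cder_scal, Ld].
        intros w _. replace (RtoC (-1)) with (- RtoC 1)%C by (rewrite <- RtoC_opp; auto). unfold Cminus. ring.
    - intros z ez hz2. rewrite PhiM, M2. destruct z as [x y]. unfold Re, Im in *. simpl in *. subst x.
      assert (hy := Cmod_snd_le (0, y)). simpl in hy. assert (hy' : Rabs y <= 1) by lra. apply Rabs_le_between in hy'.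
      assert (B1 : fst (G (p (0, y))) <= A).
      { replace (p (0, y)) with ((0, Y / 2 + rho * y) : C) by (unfold p, Cplus, Cmult, RtoC; simpl; f_equal; ring).
        apply HA. unfold rho. destruct (Rcase_abs Y) as [s|s]; [right; rewrite Rabs_left by lra|left; rewrite Rabs_right by lra]; split; nra. }
      assert (cm : Cmod ((0, y) * (0, y) + 1) / 2 <= 1).
      { assert (t := Cmod_le_fst_snd ((0, y) * (0, y) + 1)). simpl in t.
        replace (0 * 0 - y * y + 1) with (1 - y * y) in t by ring. replace (0 * y + y * 0 + 0) with 0 in t by ring.
        assert (yy : y * y <= 1) by nra. assert (yy0 : 0 <= y * y) by nra.
        rewrite Rabs_R0, Rabs_right in t by lra. lra. }
      assert (cm0 : 0 <= Cmod ((0, y) * (0, y) + 1) / 2) by (assert (t := Cmod_ge_0 ((0, y) * (0, y) + 1)); lra).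
      assert (pw : (Cmod ((0, y) * (0, y) + 1) / 2) ^ n <= 1) by (apply Rle_trans with (1 ^ n); [apply pow_incr; split; auto|rewrite pow1; lra]).
      assert (pw0 : 0 <= (Cmod ((0, y) * (0, y) + 1) / 2) ^ n) by (apply pow_le; auto).
      assert (ex : exp (fst (G (p (0, y))) - (A + bloch_const) - (V - A) * (2 * 0 - (0 * 0 - y * y))) <= 1).
      { rewrite <- exp_0. apply exp_le. assert (0 <= (V - A) * (y * y)) by nra. lra. }
      nra.
    - intros z r1 ez. rewrite PhiM, M2.
      assert (sq := Cmod_sq z). rewrite ez in sq. destruct z as [x y]. unfold Re, Im in *. simpl in *.
      assert (hx : 0 < x <= 1) by nra. assert (hy : Rabs y <= 1) by (apply Rabs_le; nra).
      assert (near := Hnear x y hx hy). rewrite p1 in near.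
      assert (rr := Re_sub_le (G (p (x, y))) (G (rho, Y / 2))). change (Re (G (rho, Y / 2))) with V in rr.
      assert (cm : Cmod ((x, y) * (x, y) + 1) / 2 = x).
      { assert (s := Cmod_sq ((x, y) * (x, y) + 1)). simpl in s.
        assert (s' : Cmod ((x, y) * (x, y) + 1) * Cmod ((x, y) * (x, y) + 1) = (2 * x) * (2 * x)).
        { rewrite s. replace (y * y) with (1 - x * x) by lra. replace (x * y + y * x + 0) with (2 * x * y) by ring.
          replace (2 * x * y * (2 * x * y)) with (4 * (x * x) * (y * y)) by ring. replace (y * y) with (1 - x * x) by lra. ring. }
        assert (s0 := Cmod_ge_0 ((x, y) * (x, y) + 1)). assert (Cmod ((x, y) * (x, y) + 1) = 2 * x) by (apply Rsqr_inj; auto; lra). lra. }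
      rewrite cm.
      assert (lx : ln x <= 0) by (rewrite <- ln_1; apply ln_le; lra).
      replace (x ^ n) with (exp (INR n * ln x)) by (rewrite <- Rpower_pow by lra; reflexivity).
      rewrite <- exp_plus. rewrite <- exp_0.
      apply exp_le.
      unfold Re in rr. assert (A1 : bloch_const * (Rabs y - ln x) <= bloch_const * (1 - ln x)) by (apply Rmult_le_compat_l; lra).
      assert (A2 : (V - A) * 1 <= (V - A) * (2 * x - (x * x - y * y))) by (apply Rmult_le_compat_l; nra).
      assert (A3 : (INR n - bloch_const) * ln x <= 0) by nra. lra. }
  rewrite PhiM, M2 in Hmax.
  replace (RtoC (1/4) * RtoC (1/4) + 1)%C with (RtoC (17/16)) in Hmax by (rewrite <- RtoC_mult, <- RtoC_plus; f_equal; field).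
  rewrite Cmod_R, Rabs_right in Hmax by lra. unfold Re at 2 3 4, Im in Hmax. simpl in Hmax.
  set (Z := Re (G (p (RtoC (1/4)))) - (A + bloch_const) - (V - A) * (2 * (1/4) - (1/4 * (1/4) - 0 * 0))) in *.
  assert (HZ : Z <= INR n).
  (* At 1/4 the factor [W] has modulus [(17/32)^n >= 2^-n], so [|Phi| <= 1] leaves
     [exp Z <= 2^n <= exp n]. *)
  { assert (h2 : (1/2) ^ n <= (17/16/2) ^ n) by (apply pow_incr; lra).
    assert (e0 := exp_pos Z). assert (h3 : exp Z * (1/2) ^ n <= 1) by (assert (exp Z * (1/2)^n <= exp Z * (17/16/2) ^ n) by (apply Rmult_le_compat_l; lra); lra).
    assert (h4 : exp Z <= 2 ^ n).
    { replace (1/2) with (/2) in h3 by field. rewrite pow_inv in h3. assert (q : 0 < 2 ^ n) by (apply pow_lt; lra).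
      apply Rmult_le_compat_r with (r := 2 ^ n) in h3; [|lra]. rewrite Rmult_assoc, Rinv_l in h3 by lra. lra. }
    assert (h5 : 2 ^ n <= exp (INR n)).
    { clear - hCK. induction n; [simpl; rewrite exp_0; lra|]. rewrite S_INR, exp_plus. simpl.
      assert (q := exp_ineq1_le 1). assert (q2 : 0 < 2 ^ n) by (apply pow_lt; lra). nra. }
    apply Rnot_lt_le; intros q; apply exp_increasing in q; lra. }
  assert (near := Hnear (1/4) 0 ltac:(lra) ltac:(rewrite Rabs_R0; lra)).
  rewrite p1, Rabs_R0 in near. assert (rr := Re_sub_le (G (rho, Y / 2)) (G (p (RtoC (1/4))))). rewrite Cmod_sym in rr. fold V in rr.
  change ((1/4, 0) : C) with (RtoC (1/4)) in near.
  assert (l4 : ln (1/4) = - ln 4) by (replace (1/4) with (/4) by field; apply ln_Rinv; lra). rewrite l4 in near.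
  unfold Z in HZ. lra.
Qed.
End HalfDisc.

Section Expansion.
Variables (T : C -> Prop) (F : C -> C) (K mu Cc : R).
Hypothesis HT : tract_map T F.
Local Notation G := (tinv T F).
Local Notation p := (tinv T F (RtoC 0)).
Hypothesis HK : 1 < K. Hypothesis Hmu : 0 < mu. Hypothesis HC : 1 < Cc.
Hypothesis Hwig : forall u t, 0 <= Re u -> 0 <= t -> Rmax (Re (G (u + RtoC t)%C)) 0 > Re (G u) / K - mu.
Hypothesis Hray : forall u B, 0 <= Re u -> exists t0, 0 <= t0 /\ forall t, t0 <= t -> B < Re (G (u + RtoC t)%C).
Hypothesis Hgulf : forall zeta a, T zeta -> a > 0 -> Re zeta >= Rmax (Re p) 1 -> a >= Cc * Re zeta ->
  forall y0, T (a, y0) -> separates_from_infty T (vline_component T a y0) zeta ->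
    joinable_left T (vline_component T a y0) a zeta -> separates_from_infty T (vline_component T a y0) p.

Lemma ray_crosses L u : 0 <= Re u -> separates_from_infty T L (G u) -> exists t, 0 <= t /\ L (G (u + RtoC t)%C).
Proof.
  intros hu H.
  assert (pos : forall t, 0 <= t -> 0 <= Re (u + RtoC t)%C) by (intros t ht; unfold Re in *; simpl; lra).
  destruct (H (fun t => G (u + RtoC t)%C)) as [t [ht lt]].
  - intros t ht e he. exists e. split; auto. intros s hs h. rewrite Cnorm_Cmod.
    assert (q := tinv_lip T F HT _ _ (pos s ltac:(lra)) (pos t ltac:(lra))).
    replace (u + RtoC s - (u + RtoC t))%C with (RtoC s - RtoC t)%C in q by ring.
    rewrite <- RtoC_minus, Cmod_R in q.
    change (Cmod (G (u + RtoC s)%C - G (u + RtoC t)%C) < e). lra.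
  - replace (u + RtoC 0)%C with u by ring. auto.
  - intros t ht. apply tinv_int; auto. unfold Re in *; simpl; lra.
  - intros M. destruct (Hray u M hu) as [t0 [h0 H0]]. exists t0. intros s hs. rewrite Cnorm_Cmod.
    assert (q := H0 s ltac:(lra)). assert (q2 := Cmod_fst_le (G (u + RtoC s)%C)). assert (q3 := Rle_abs (fst (G (u + RtoC s)%C))).
    unfold Re in q. lra.
  - exists t. split; [lra|auto].
Qed.

(* L_{zeta,a} meets the geodesics from p and from zeta, on both sides of the full horizontal line
   through iy, so if it missed the geodesic from G(iy) its image would be disconnected. *)
Lemma boundary_bound zeta y : T zeta -> Rmax (Re p) 1 <= Re zeta ->
  (0 < y < Im (F zeta) \/ Im (F zeta) < y < 0) -> Re (G (0, y)) <= K * (Cc * Re zeta + mu).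
Proof.
  intros Tz hz hy. apply Rnot_lt_le. intros hl.
  assert (z1 : 1 <= Re zeta) by (assert (q := Rmax_r (Re p) 1); lra).
  set (a := Cc * Re zeta) in *. assert (ha : Re zeta < a) by (unfold a; nra).
  assert (pz := tm_pos _ _ HT zeta Tz).
  destruct (gulf_cut_exists T F HT a zeta Tz ha (Hray (F zeta) a (Rlt_le _ _ pz))) as [y0 [Ty [Hsep Hjoin]]].
  assert (Hp := Hgulf zeta a Tz ltac:(lra) ltac:(lra) ltac:(unfold a; lra) y0 Ty Hsep Hjoin).
  set (L := vline_component T a y0) in *.
  destruct (ray_crosses L (RtoC 0)) as [t0 [ht0 L0]]; [unfold Re; simpl; lra|auto|].
  destruct (ray_crosses L (F zeta)) as [t1 [ht1 L1]]; [lra|rewrite tinv_left by (auto; apply closure_self; auto); auto|].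
  set (l0 := G (RtoC 0 + RtoC t0)%C) in *. set (l1 := G (F zeta + RtoC t1)%C) in *.
  assert (I0 : Im (F l0) = 0) by (unfold l0; rewrite F_tinv; auto; unfold Re, Im; simpl; lra).
  assert (I1 : Im (F l1) = Im (F zeta)) by (unfold l1; rewrite F_tinv; auto; unfold Re, Im in *; simpl; lra).
  set (q := fun x => ((a, Im l0 + x * (Im l1 - Im l0)) : C)).
  assert (Tq : forall x, 0 <= x <= 1 -> T (q x)).
  { intros x hx. destruct L0 as [_ L0]. destruct L1 as [_ L1]. unfold q. set (s := Im l0 + x * (Im l1 - Im l0)).
    assert (hs : Rmin (Im l0) (Im l1) <= s <= Rmax (Im l0) (Im l1)) by (unfold s, Rmin, Rmax; repeat destruct Rle_dec; split; nra).
    destruct (Rle_dec (Rmin y0 (Im l0)) s); [destruct (Rle_dec s (Rmax y0 (Im l0)))|]; [apply L0; lra|apply L1|apply L1];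
      unfold Rmin, Rmax in *; repeat destruct Rle_dec; lra. }
  assert (q0 : q 0 = l0). { destruct L0 as [e _]. unfold q. destruct l0 as [u v]. unfold Re, Im in *; simpl in *. subst. f_equal; ring. }
  assert (q1 : q 1 = l1). { destruct L1 as [e _]. unfold q. destruct l1 as [u v]. unfold Re, Im in *; simpl in *. subst. f_equal; ring. }
  assert (Hc : forall x, 0 <= x <= 1 -> continuity_pt (fun x => Im (F (q x))) x).
  { intros x hx. apply continuity_pt_filterlim. apply continuous_eps. intros e he.
    destruct (tm_der _ _ HT (q x) (Tq x hx)) as [d [D _]]. apply cder_ccont in D. destruct (D e he) as [r [hr Hr]].
    assert (hm := Rabs_pos (Im l1 - Im l0)). exists (r / (Rabs (Im l1 - Im l0) + 1)). split; [apply Rdiv_lt_0_compat; lra|].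
    intros s h. eapply Rle_lt_trans; [apply Rabs_Im_sub_le|]. apply Hr. unfold q. eapply Rle_lt_trans; [apply vline_dist|].
    replace (Im l0 + s * (Im l1 - Im l0) - (Im l0 + x * (Im l1 - Im l0))) with ((s - x) * (Im l1 - Im l0)) by ring.
    rewrite Rabs_mult. apply Rlt_div_r in h; [|lra]. nra. }
  assert (Hx : exists x, 0 <= x <= 1 /\ Im (F (q x)) = y).
  { destruct hy as [hy|hy].
    - destruct (IVT_interv (fun x => Im (F (q x)) - y) 0 1) as [x [hx e]]; try lra.
      + intros x hx. apply continuity_pt_minus; [apply Hc; auto|apply continuity_pt_const; intros u v; auto].
      + rewrite q0. lra.
      + rewrite q1. lra.
      + exists x. split; [auto|lra].
    - destruct (IVT_interv (fun x => y - Im (F (q x))) 0 1) as [x [hx e]]; try lra.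
      + intros x hx. apply continuity_pt_minus; [apply continuity_pt_const; intros u v; auto|apply Hc; auto].
      + rewrite q0. lra.
      + rewrite q1. lra.
      + exists x. split; [auto|lra]. }
  destruct Hx as [x [hx e]]. assert (Tx := Tq x hx). assert (px := tm_pos _ _ HT _ Tx).
  assert (E : F (q x) = ((0, y)%R + RtoC (Re (F (q x))))%C).
  { unfold Re, Im in *. destruct (F (q x)) as [u v]. unfold Cplus, RtoC; simpl in *. subst. f_equal; ring. }
  assert (w := Hwig (0, y) (Re (F (q x))) ltac:(unfold Re; simpl; lra) (Rlt_le _ _ px)).
  rewrite <- E, tinv_left in w by (auto; apply closure_self; auto).
  change (Re (q x)) with a in w. rewrite Rmax_left in w by lra.
  assert (a < Re (G (0, y)) / K - mu); [|lra].
  apply Rmult_lt_reg_r with K; [lra|]. replace ((Re (G (0, y)) / K - mu) * K) with (Re (G (0, y)) - K * mu) by (field; lra). lra.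
Qed.

Lemma tinv_comparable u v N kap : 0 < N -> 1 <= kap -> N <= Re u <= 2 * N -> N / kap <= Re v <= N -> Rabs (Im u - Im v) <= 2 * N ->
  Cmod (G u - G v) <= bloch_const * (2 + ln (2 * kap)).
Proof.
  intros hN hk hu hv hi. assert (hq : 0 < N / kap) by (apply Rdiv_lt_0_compat; lra).
  eapply Rle_trans; [apply tinv_hyp_bound; auto; lra|]. apply Rmult_le_compat_l; [left; apply bloch_const_pos|].
  unfold hyp_dist. rewrite Rmax_left by lra. apply Rplus_le_compat.
  - apply Rle_div_l; [lra|]. lra.
  - assert (l1 : ln (Re v) <= ln (Re u)) by (apply ln_le; lra).
    assert (l2 : ln (Re u) <= ln (2 * N)) by (apply ln_le; lra).
    assert (l3 : ln (N / kap) <= ln (Re v)) by (apply ln_le; lra).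
    unfold Rdiv in l3. rewrite ln_mult, ln_Rinv in l3 by (try apply Rinv_0_lt_compat; lra). rewrite ln_mult in l2 by lra.
    rewrite ln_mult by lra. rewrite Rabs_right by lra. lra.
Qed.

(** Suppose [|F w| < N = Lam * |F zeta|] and move from [F w] to the right by [N], to [u]. Then [u]
    is at bounded hyperbolic distance from a point where [Re G] is O(Re zeta): from [F zeta] if its
    imaginary part does not dominate, and otherwise from the point controlled by [boundary_bound]
    and [half_disc_estimate]. As [G u] lies on the geodesic from [w], wiggling bounds [Re w] by a
    multiple of [Re zeta]. *)
Lemma expansion_claim Lam : 1 <= Lam -> exists B, 1 <= B /\ forall zeta w, T zeta -> T w ->
  Rmax (Re p) 1 <= Re zeta -> B * Re zeta <= Re w -> Lam * Cmod (F zeta) <= Cmod (F w).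
Proof.
  intros hL. destruct (half_disc_estimate T F HT) as [C5 [hC5 H5]]. assert (hCK := bloch_const_pos).
  assert (hln : 0 < ln (16 * Lam)) by (rewrite <- ln_1; apply ln_increasing; lra).
  set (D := K * Cc + K * mu + C5 + bloch_const * (2 + ln (16 * Lam))).
  assert (kc : 1 < K * Cc) by nra. assert (km : 0 < K * mu) by nra. assert (ck : 0 < bloch_const * (2 + ln (16 * Lam))) by nra.
  assert (hD : 1 <= D) by (unfold D; lra).
  exists (K * (D + mu)). split; [nra|]. intros zeta w Tz Tw hz hw. apply Rnot_lt_le. intros hl.
  assert (z1 : 1 <= Re zeta) by (assert (q := Rmax_r (Re p) 1); lra).
  assert (pz := tm_pos _ _ HT zeta Tz). assert (pw := tm_pos _ _ HT w Tw).
  set (N := Lam * Cmod (F zeta)) in *.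
  assert (hFz : 0 < Cmod (F zeta)) by (assert (q := Cmod_fst_le (F zeta)); assert (q2 := Rle_abs (fst (F zeta))); unfold Re in pz; lra).
  assert (hN : Cmod (F zeta) <= N) by (unfold N; nra).
  set (u := (F w + RtoC N)%C).
  assert (a1 := Cmod_fst_le (F w)). assert (a2 := Rle_abs (fst (F w))). assert (a3 := Cmod_snd_le (F w)).
  assert (b1 := Cmod_fst_le (F zeta)). assert (b2 := Rle_abs (fst (F zeta))). assert (b3 := Cmod_snd_le (F zeta)).
  assert (Ru : N <= Re u <= 2 * N) by (unfold u, Re in *; simpl; lra).
  assert (Iu : Im u = Im (F w)) by (unfold u, Im; simpl; ring).
  assert (wg := Hwig (F w) N ltac:(lra) ltac:(lra)). fold u in wg. rewrite tinv_left in wg by (auto; apply closure_self; auto).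
  assert (Hup : Re (G u) <= D * Re zeta).
  { assert (zd : bloch_const * (2 + ln (16 * Lam)) <= bloch_const * (2 + ln (16 * Lam)) * Re zeta) by nra.
    destruct (Rle_dec (Rabs (Im (F zeta))) (Re (F zeta))) as [c|c].
    - assert (cmp : Cmod (G u - G (F zeta)) <= bloch_const * (2 + ln (2 * (2 * Lam)))).
      { apply (tinv_comparable u (F zeta) N (2 * Lam)); try lra.
        - split; [|unfold Re in *; lra]. assert (q := Cmod_le_fst_snd (F zeta)). unfold Im, Re in *. rewrite (Rabs_right (fst (F zeta))) in q by lra.
          apply Rmult_le_reg_r with (2 * Lam); [lra|]. replace (N / (2 * Lam) * (2 * Lam)) with N by (field; lra). unfold N. nra.
        - rewrite Iu. unfold Im in *. apply Rabs_le_between in a3. apply Rabs_le_between in b3. apply Rabs_le. lra. }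
      rewrite tinv_left in cmp by (auto; apply closure_self; auto).
      assert (lm : ln (2 * (2 * Lam)) <= ln (16 * Lam)) by (apply ln_le; lra).
      assert (bloch_const * (2 + ln (2 * (2 * Lam))) <= bloch_const * (2 + ln (16 * Lam))) by (apply Rmult_le_compat_l; lra).
      assert (r := Re_sub_le (G u) zeta). assert (Re zeta <= K * Cc * Re zeta) by nra.
      assert (0 <= (K * mu + C5) * Re zeta) by nra. unfold D. lra.
    - set (Y := Im (F zeta)) in *. assert (nY : Y <> 0) by (intros e; rewrite e, Rabs_R0 in c; lra).
      assert (pY := Rabs_pos_lt Y nY).
      assert (h5 := H5 Y (K * (Cc * Re zeta + mu)) nY (fun y hy => boundary_bound zeta y Tz hz hy)).
      assert (cmp : Cmod (G u - G (Rabs Y / 4, Y / 2)) <= bloch_const * (2 + ln (2 * (8 * Lam)))).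
      { apply (tinv_comparable u _ N (8 * Lam)); try lra.
        - change (Re (Rabs Y / 4, Y / 2)) with (Rabs Y / 4). unfold Y, Im in *. split; [|lra].
          assert (q := Cmod_le_fst_snd (F zeta)). unfold Re in *. rewrite (Rabs_right (fst (F zeta))) in q by lra.
          apply Rmult_le_reg_r with (8 * Lam); [lra|]. replace (N / (8 * Lam) * (8 * Lam)) with N by (field; lra). unfold N. nra.
        - rewrite Iu. change (Im (Rabs Y / 4, Y / 2)) with (Y / 2). unfold Y, Im in *. apply Rabs_le_between in a3. apply Rabs_le_between in b3. apply Rabs_le. lra. }
      replace (2 * (8 * Lam)) with (16 * Lam) in cmp by ring.
      assert (r := Re_sub_le (G u) (G (Rabs Y / 4, Y / 2))).
      assert (0 <= (K * mu + C5) * (Re zeta - 1)) by nra. unfold D. nra. }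
  assert (Rmax (Re (G u)) 0 <= D * Re zeta) by (apply Rmax_lub; nra).
  assert (Re w < K * (D + mu) * Re zeta); [|lra].
  assert (q : Re w / K < D * Re zeta + mu) by lra.
  apply Rmult_lt_compat_r with (r := K) in q; [|lra]. replace (Re w / K * K) with (Re w) in q by (field; lra).
  assert (K * mu <= K * mu * Re zeta) by nra. lra.
Qed.

End Expansion.

(** * Growth of M and fast escape *)

(** With [x = d / bloch_const], [exp x >= (x / 2)^2], and the lower bound on [d] is exactly what
    makes [b * (x / 2)^2 >= 2 * d]. *)
Lemma exp_dominates (b d : R) : 0 < b -> 1 <= d -> 8 * bloch_const * bloch_const / b <= d -> 2 * d <= b * exp (d / bloch_const).
Proof.
  intros hb hd h. assert (hCK := bloch_const_pos).
  set (x := d / bloch_const). assert (hx : 0 < x) by (apply Rdiv_lt_0_compat; lra).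
  assert (e1 := exp_ineq1_le (x / 2)).
  assert (e2 : exp x = exp (x / 2) * exp (x / 2)) by (rewrite <- exp_plus; f_equal; field).
  assert (e3 : x / 2 * (x / 2) <= exp x) by (rewrite e2; apply Rmult_le_compat; lra).
  apply Rle_trans with (b * (x / 2 * (x / 2))); [|apply Rmult_le_compat_l; lra].
  assert (ed : d = bloch_const * x) by (unfold x; field; lra).
  apply Rmult_le_compat_r with (r := b) in h; [|lra]. replace (8 * bloch_const * bloch_const / b * b) with (8 * bloch_const * bloch_const) in h by (field; lra).
  rewrite ed in *. nra.
Qed.

Section Growth.
Variables (T0 : C -> Prop) (F : C -> C) (Mf : R -> R) (Rr : R).
Hypothesis HF : Blog_n_translates T0 F.
Hypothesis Hslope : forall n : Z, bounded_slope (tract T0 n).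
Hypothesis HM : M_admissible T0 F Mf Rr.

Lemma M_upper r q : Rr <= r -> clT T0 q -> Re q = r -> Re (F q) <= Mf r.
Proof. intros hr hq hq2. destruct (HM r) as [[h _] _]; [lra|]. apply h. exists q. auto. Qed.

Lemma M_nonneg r : Rr <= r -> 0 <= Mf r.
Proof.
  intros hr. destruct (HM r) as [[h1 h2] _]; [lra|]. apply Rnot_lt_le. intros hl.
  assert (Mf r <= Mf r - 1); [|lra]. apply h2. intros x [w [[n hw] [h3 ->]]]. exfalso.
  assert (q := Re_F_cl _ _ (blog_tract T0 F HF n) w hw). assert (q2 : Re (F w) <= Mf r) by (apply M_upper; auto; exists n; auto). lra.
Qed.

(** From any point [q] with real part [x] follow the geodesic until its real part is [x + h]. By
    [tinv_horizontal_bound] it covers Euclidean distance [h] only if [Re F] grows by the factor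
    [exp (h / bloch_const)]. *)
Lemma M_growth x h : Rr <= x -> 0 <= h -> exp (h / bloch_const) * Mf x <= Mf (x + h).
Proof.
  intros hx hh. assert (hCK := bloch_const_pos). assert (e0 := exp_pos (h / bloch_const)). assert (nn := M_nonneg (x + h) ltac:(lra)).
  assert (B : Mf x <= Mf (x + h) * / exp (h / bloch_const)).
  { destruct (HM x) as [[_ h2] _]; [lra|]. apply h2. intros y [q [[n hq] [hqx ->]]].
    assert (i0 := Rinv_0_lt_compat _ e0).
    assert (HT := blog_tract T0 F HF n). destruct (Re_F_cl _ _ HT q hq) as [pq|pq]; [|rewrite <- pq; apply Rmult_le_pos; lra].
    set (G := tinv (tract T0 n) F). assert (Gq : G (F q) = q) by (apply tinv_left; auto).
    destruct (blog_ray T0 F HF Hslope n (F q) (x + h) ltac:(lra)) as [t0 [ht0 Ht0]]. specialize (Ht0 t0 (Rle_refl _)). fold G in Ht0.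
    set (f := fun t => Re (G (F q + RtoC (Rmax 0 t))%C) - (x + h)).
    assert (pos : forall t, 0 <= Re (F q + RtoC (Rmax 0 t))%C) by (intros t; assert (m := Rmax_l 0 t); unfold Re in *; simpl; lra).
    assert (Hc : continuity f).
    { apply (lipschitz_continuity f 1). intros s t. unfold f.
      replace (Re (G (F q + RtoC (Rmax 0 s))%C) - (x + h) - (Re (G (F q + RtoC (Rmax 0 t))%C) - (x + h))) with (Re (G (F q + RtoC (Rmax 0 s))%C) - Re (G (F q + RtoC (Rmax 0 t))%C)) by ring.
      eapply Rle_trans; [apply Rabs_Re_sub_le|].
      assert (l := tinv_lip _ _ HT _ _ (pos s) (pos t)). fold G in l.
      replace (F q + RtoC (Rmax 0 s) - (F q + RtoC (Rmax 0 t)))%C with (RtoC (Rmax 0 s) - RtoC (Rmax 0 t))%C in l by ring.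
      rewrite <- RtoC_minus, Cmod_R in l.
      assert (hst : Rabs (Rmax 0 s - Rmax 0 t) <= Rabs (s - t)).
      { unfold Rmax. destruct (Rle_dec 0 s), (Rle_dec 0 t); split_Rabs; lra. }
      assert (hp := Rabs_pos (Rmax 0 s - Rmax 0 t)). lra. }
    destruct (IVT_cor f 0 t0 Hc ht0) as [t [ht ft]].
    { unfold f. rewrite !Rmax_right by lra. replace (F q + RtoC 0)%C with (F q) by ring. rewrite Gq. nra. }
    unfold f in ft. rewrite Rmax_right in ft by lra.
    set (u := Re (F q)) in *.
    assert (hor := tinv_horizontal_bound _ _ HT (Im (F q)) u (u + t) pq ltac:(lra)). fold G in hor.
    replace ((u, Im (F q)) : C) with (F q) in hor by (unfold u, Re, Im; destruct (F q); auto).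
    replace ((u + t, Im (F q)) : C) with (F q + RtoC t)%C in hor by (unfold u, Re, Im, Cplus, RtoC; destruct (F q); simpl; f_equal; ring).
    rewrite Gq in hor. assert (r := Re_sub_le (G (F q + RtoC t)%C) q).
    assert (hl2 : h / bloch_const + ln u <= ln (u + t)).
    { apply Rmult_le_reg_l with bloch_const; auto. replace (bloch_const * (h / bloch_const + ln u)) with (h + bloch_const * ln u) by (field; lra). lra. }
    apply exp_le in hl2. rewrite exp_plus, !exp_ln in hl2 by lra.
    assert (pt : 0 < Re (F q + RtoC t)%C) by (unfold u, Re in *; simpl; lra).
    assert (up : Re (F (G (F q + RtoC t)%C)) <= Mf (x + h)).
    { apply M_upper; [lra| |lra]. exists n. apply tinv_spec; auto. lra. }
    unfold G in up. rewrite F_tinv in up by (auto; lra).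
    assert (up2 : u + t <= Mf (x + h)) by (unfold u, Re in *; simpl in up; lra).
    apply Rmult_le_reg_l with (exp (h / bloch_const)); auto.
    replace (exp (h / bloch_const) * (Mf (x + h) * / exp (h / bloch_const))) with (Mf (x + h)) by (field; lra). lra. }
  apply Rmult_le_compat_l with (r := exp (h / bloch_const)) in B; [|lra].
  replace (exp (h / bloch_const) * (Mf (x + h) * / exp (h / bloch_const))) with (Mf (x + h)) in B by (field; lra). lra.
Qed.

(* The exponential growth of M absorbs the constant eps. *)
Lemma outgrows_iterates (y : nat -> R) (eps : R) (k0 : nat) : 0 < eps ->
  (forall B, exists N, forall k, (N <= k)%nat -> B <= y k) ->
  (forall k, (k0 <= k)%nat -> Rr <= y k -> eps * Mf (y k) <= y (S k)) ->
  exists L : nat, (k0 <= L)%nat /\ forall n, Nat.iter n Mf Rr <= y (n + L)%nat.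
Proof.
  intros he Hinf Hy. assert (hCK := bloch_const_pos).
  assert (q0 : 0 < 8 * bloch_const * bloch_const / eps) by (apply Rdiv_lt_0_compat; nra).
  (* A lead of [H] over the iterate of M survives a step: [M_growth] turns it into the factor
     [exp (H / bloch_const)], which after loss of [eps] is still at least [1 + H]. *)
  set (H := 1 + 8 * bloch_const * bloch_const / eps).
  assert (hH : 1 + H <= eps * exp (H / bloch_const)) by (assert (q := exp_dominates eps H he ltac:(unfold H; lra) ltac:(unfold H; lra)); unfold H in *; lra).
  assert (H1 : 1 <= H) by (unfold H; lra).
  set (r1 := Rmax Rr 1). assert (hr1 : Rr <= r1) by apply Rmax_l. assert (hr2 : 1 <= r1) by apply Rmax_r.
  set (Y0 := 2 * r1 + H + H).
  assert (HY0 : forall v, Y0 <= v -> v <= eps * Mf v).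
  { intros v hv. set (d := v - r1).
    assert (q := exp_dominates eps d he ltac:(unfold d, Y0, H in *; lra) ltac:(unfold d, Y0, H in *; lra)).
    assert (g := M_growth r1 d hr1 ltac:(unfold d, Y0, H in *; lra)). replace (r1 + d) with v in g by (unfold d; ring).
    destruct (HM r1) as [_ m1]; [lra|]. assert (ep := exp_pos (d / bloch_const)).
    assert (exp (d / bloch_const) <= Mf v) by nra. assert (eps * exp (d / bloch_const) <= eps * Mf v) by (apply Rmult_le_compat_l; lra).
    unfold d, Y0, H in *. lra. }
  destruct (Hinf (Rmax Y0 (Rr + H))) as [N HN].
  set (L := (N + k0)%nat). exists L. split; [unfold L; lia|].
  assert (K : forall n, Rr <= Nat.iter n Mf Rr /\ Y0 <= y (n + L)%nat /\ Nat.iter n Mf Rr + H <= y (n + L)%nat).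
  { induction n.
    - specialize (HN L ltac:(unfold L; lia)). assert (a1 := Rmax_l Y0 (Rr + H)). assert (a2 := Rmax_r Y0 (Rr + H)). simpl. lra.
    - destruct IHn as [i1 [i2 i3]]. set (x := Nat.iter n Mf Rr) in *. change (Nat.iter (S n) Mf Rr) with (Mf x).
      change (S n + L)%nat with (S (n + L)). set (v := y (n + L)%nat) in *.
      destruct (HM x) as [_ m1]; [lra|].
      assert (hv : Rr <= v) by (unfold Y0, H in *; lra).
      assert (s := Hy (n + L)%nat ltac:(unfold L; lia) hv). fold v in s. assert (s2 := HY0 v i2).
      assert (g := M_growth x (v - x) i1 ltac:(unfold H in *; lra)). replace (x + (v - x)) with v in g by ring.
      assert (ex : exp (H / bloch_const) <= exp ((v - x) / bloch_const)).
      { apply exp_le. apply Rmult_le_compat_r; [left; apply Rinv_0_lt_compat; auto|lra]. }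
      split; [lra|]. split; [lra|].
      (* [Rr] may be negative, so [Mf x] may be small and the multiplicative argument fails; then
         the invariant [Y0 <= y] supplies the lead. *)
      destruct (Rle_dec (Mf x) 1) as [c|c]; [unfold Y0 in *; lra|].
      assert (g2 : exp (H / bloch_const) * Mf x <= Mf v) by (assert (exp (H / bloch_const) * Mf x <= exp ((v - x) / bloch_const) * Mf x) by (apply Rmult_le_compat_r; lra); lra).
      assert (g3 : eps * (exp (H / bloch_const) * Mf x) <= eps * Mf v) by (apply Rmult_le_compat_l; lra).
      assert (g4 : (1 + H) * Mf x <= eps * exp (H / bloch_const) * Mf x) by (apply Rmult_le_compat_r; lra).
      assert (H * 1 <= H * Mf x) by (apply Rmult_le_compat_l; unfold H; lra). lra. }
  intros n. destruct (K n) as [_ [_ h]]. unfold H in *. lra.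
Qed.
End Growth.

Lemma exp_ge_1 d : 0 <= d -> 1 <= exp d.
Proof. intros h. assert (q := exp_ineq1_le d). lra. Qed.

Lemma pow2_ge_INR k : INR k <= 2 ^ k.
Proof.
  induction k; [simpl; lra|]. rewrite S_INR. simpl. assert (1 <= 2 ^ k) by (apply pow_R1_Rle; lra). lra.
Qed.

(** * Comparing the orbit with M across tracts *)

Section Main.
Variables (T0 : C -> Prop) (F : C -> C).
Hypothesis HF : Blog_n_translates T0 F.
Hypothesis Hslope : forall n : Z, bounded_slope (tract T0 n).
Hypothesis Hwig : forall n : Z, bounded_wiggling (tract T0 n) F.
Hypothesis Hgulf : forall n : Z, bounded_gulfs (tract T0 n) F.
Local Notation G0 := (tinv (tract T0 0) F).
Local Notation p := (tinv (tract T0 0) F (RtoC 0)).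

Lemma blog_expansion Lam : 1 <= Lam -> exists B, 1 <= B /\ forall zeta w, tract T0 0 zeta -> tract T0 0 w ->
  Rmax (Re p) 1 <= Re zeta -> B * Re zeta <= Re w -> Lam * Cmod (F zeta) <= Cmod (F w).
Proof.
  intros hL. assert (HT := blog_tract T0 F HF 0).
  destruct (blog_wiggling T0 F HF Hwig) as [K [mu [hK [hmu [W0 _]]]]].
  destruct (Hgulf 0) as [Cc [hC H]].
  destruct (tinv_spec _ _ HT (RtoC 0)) as [c0 e0]; [unfold Re; simpl; lra|].
  apply (expansion_claim (tract T0 0) F K mu Cc); auto.
  - intros u B hu. apply blog_ray; auto.
  - apply H; auto. split; auto. apply closure_self. intros h. apply (tm_pos _ _ HT) in h. rewrite e0 in h. unfold Re in h; simpl in h. lra.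
Qed.

(* The expansion estimate is available in tract 0; the similarity between F on tract n and F on
   tract 0 transports it. *)
Lemma fast_step Mf Rr : M_admissible T0 F Mf Rr -> exists B eps, 1 <= B /\ 0 < eps /\
  forall n n' z w, closure (tract T0 n) z -> closure (tract T0 n) w -> closure (tract T0 n') (F z) -> closure (tract T0 n') (F w) ->
    0 < Re (F z) -> 1 <= Re (F w) -> Rmax (Re p) 1 <= Re z -> B * Re z <= Re w -> Re (F z) <= Re (F w) -> Rr <= Re w / B ->
    eps * Mf (Re w / B) <= Re (F w).
Proof.
  intros HM. destruct (blog_expansion 1) as [B1 [hB1 E1]]; [lra|]. destruct (blog_expansion 2) as [B2 [hB2 E2]]; [lra|].
  destruct (blog_slope T0 Hslope) as [al [be [hal [hbe Hs]]]].
  destruct (choice _ (blog_similarity T0 F HF)) as [A HA].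
  assert (HT := blog_tract T0 F HF 0).
  assert (r1 : Re (RtoC 1) = 1) by reflexivity. assert (r2 : Re (RtoC 2) = 2) by reflexivity.
  assert (t1 : tract T0 0 (G0 (RtoC 1))) by (apply tinv_int; auto; lra).
  assert (t2 : tract T0 0 (G0 (RtoC 2))) by (apply tinv_int; auto; lra).
  assert (f1 : F (G0 (RtoC 1)) = RtoC 1) by (apply F_tinv; auto; lra).
  assert (f2 : F (G0 (RtoC 2)) = RtoC 2) by (apply F_tinv; auto; lra).
  (* The similarity takes the distance 1 between the values 1 and 2 to [A n], and [F] expands by 2
     on tract [n]: a lower bound on [A n] for all [n]. *)
  set (amin := 2 * Cmod (G0 (RtoC 1) - G0 (RtoC 2))).
  assert (hamin : 0 < amin).
  { assert (0 < Cmod (G0 (RtoC 1) - G0 (RtoC 2))); [|unfold amin; lra]. apply Cmod_gt_0, Csub_ne. intros e.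
    rewrite e, f2 in f1. injection f1. lra. }
  assert (Hmin : forall n, amin <= A n).
  { intros n. destruct (HA n) as [ha Hn]. destruct (Hn _ _ t1 t2) as [_ h].
    assert (q := expand_T _ _ (blog_tract T0 F HF n) _ _ (proj1 (tract_translate T0 n _) t1) (proj1 (tract_translate T0 n _) t2)).
    rewrite h, f1, f2 in q. replace (RtoC 1 - RtoC 2)%C with (- RtoC 1)%C in q by (replace (RtoC 2) with (RtoC 1 + RtoC 1)%C by (rewrite <- RtoC_plus; f_equal; ring); ring).
    rewrite Cmod_opp, Cmod_1 in q. replace (G0 (RtoC 1) + period n - (G0 (RtoC 2) + period n))%C with (G0 (RtoC 1) - G0 (RtoC 2))%C in q by ring.
    unfold amin. lra. }
  (* For the upper bound on [A n] take a point [q0] with real part above [Rr]: its translates all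
     have that real part, where M bounds [Re F]. *)
  destruct (blog_ray T0 F HF Hslope 0 (RtoC 1) Rr) as [t0 [ht0 Ht0]]; [lra|]. specialize (Ht0 t0 (Rle_refl _)).
  set (q0 := G0 (RtoC 1 + RtoC t0)%C) in *.
  assert (pq0 : 0 < Re (RtoC 1 + RtoC t0)%C) by (unfold Re; simpl; lra).
  assert (tq0 : tract T0 0 q0) by (apply tinv_int; auto).
  assert (fq0 : Re (F q0) = 1 + t0) by (unfold q0; rewrite F_tinv by (auto; lra); unfold Re; simpl; auto).
  set (amax := Mf (Re q0) / (1 + t0)).
  assert (Hmax : forall n, A n <= amax).
  { intros n. destruct (HA n) as [ha Hn]. destruct (Hn _ _ tq0 tq0) as [h _]. rewrite fq0 in h.
    assert (u : Re (F (q0 + period n)%C) <= Mf (Re q0)).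
    { apply (M_upper T0 F Mf Rr HM); [lra| |apply Re_add_period]. exists n. apply closure_self. apply (tract_translate T0 n). auto. }
    unfold amax. apply Rle_div_r; [lra|]. lra. }
  assert (hamax : 0 < amax) by (assert (h := Hmin 0%Z); assert (h2 := Hmax 0%Z); lra).
  set (c := 2 * (1 + al + be)). assert (hc : 0 < c) by (unfold c; lra).
  set (B := Rmax B1 B2). assert (B1B : B1 <= B) by apply Rmax_l. assert (B2B : B2 <= B) by apply Rmax_r.
  exists B, (amin / (amax * c)). split; [lra|]. split; [apply Rdiv_lt_0_compat; auto; apply Rmult_lt_0_compat; auto|].
  intros n n' z w cz cw cFz cFw pz pw hz hw hzw hRr.
  assert (HTn := blog_tract T0 F HF n). assert (tz := interior_cl _ _ HTn z cz pz). assert (tw := interior_cl _ _ HTn w cw ltac:(lra)).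
  set (z' := (z + - period n)%C). set (w' := (w + - period n)%C).
  assert (ez : (z' + period n)%C = z) by (unfold z'; ring). assert (ew : (w' + period n)%C = w) by (unfold w'; ring).
  assert (tz' : tract T0 0 z') by (apply (tract_translate T0 n); rewrite ez; auto).
  assert (tw' : tract T0 0 w') by (apply (tract_translate T0 n); rewrite ew; auto).
  assert (rz : Re z' = Re z) by (rewrite <- ez, Re_add_period; auto). assert (rw : Re w' = Re w) by (rewrite <- ew, Re_add_period; auto).
  assert (m1 := Rmax_r (Re p) 1).
  destruct (HA n) as [ha Hn]. destruct (Hn w' z' tw' tz') as [_ dist]. rewrite ez, ew in dist.
  (* With factor 2, [F z'] is at most half of [F w'] in modulus, so [|F w' - F z'|] controls
     [|F w'|]. As [F z] and [F w] lie in one tract, bounded slope bounds their distance by a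
     multiple of [Re (F w)]. *)
  assert (X2 := E2 z' w' tz' tw' ltac:(lra) ltac:(rewrite rz, rw; nra)).
  assert (sub := Cmod_sub_le (F w') (F z')).
  assert (sl := Hs n' (F w) (F z) cFw cFz).
  assert (mx : Rmax (Rmax (Re (F w)) (Re (F z))) 0 = Re (F w)) by (rewrite (Rmax_left (Re (F w))), Rmax_left; lra).
  rewrite mx in sl.
  assert (d1 : Cmod (F w - F z) <= (1 + al + be) * Re (F w)).
  { assert (t := Cmod_le_fst_snd (F w - F z)). change (fst (F w - F z)%C) with (Re (F w) - Re (F z)) in t. change (snd (F w - F z)%C) with (Im (F w) - Im (F z)) in t.
    rewrite (Rabs_right (Re (F w) - Re (F z))) in t by lra. assert (be <= be * Re (F w)) by nra. lra. }
  assert (d2 : A n * Cmod (F w') <= c * Re (F w)).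
  { assert (A n * Cmod (F w') <= 2 * (A n * Cmod (F w' - F z'))) by (assert (q := Cmod_ge_0 (F z')); nra). unfold c. lra. }
  assert (d3 : amin * Cmod (F w') <= c * Re (F w)).
  { assert (amin * Cmod (F w') <= A n * Cmod (F w')) by (apply Rmult_le_compat_r; [apply Cmod_ge_0|apply Hmin]). lra. }
  (* Every competitor [q] for M at [Re w / B], moved to tract 0, plays the part of [zeta] for [w']
     in the expansion estimate with factor 1. *)
  assert (d4 : Mf (Re w / B) <= amax * Cmod (F w')).
  { destruct (HM (Re w / B)) as [[_ lub] _]; [lra|]. apply lub. intros x [q [[m hq] [hqr ->]]].
    assert (n0 : 0 <= amax * Cmod (F w')) by (apply Rmult_le_pos; [lra|apply Cmod_ge_0]).
    assert (HTm := blog_tract T0 F HF m). destruct (Re_F_cl _ _ HTm q hq) as [pq|pq]; [|lra].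
    assert (tq := interior_cl _ _ HTm q hq pq).
    set (q' := (q + - period m)%C). assert (eq : (q' + period m)%C = q) by (unfold q'; ring).
    assert (tq' : tract T0 0 q') by (apply (tract_translate T0 m); rewrite eq; auto).
    assert (rq : Re q' = Re w / B) by (rewrite <- hqr, <- eq, Re_add_period; auto).
    destruct (HA m) as [ha' Hm]. destruct (Hm q' q' tq' tq') as [sq _]. rewrite eq in sq.
    assert (hwB : Re z <= Re w / B).
    { apply Rle_div_r; [lra|]. lra. }
    assert (X1 := E1 q' w' tq' tw' ltac:(lra)).
    assert (hb : B1 * Re q' <= Re w').
    { rewrite rq, rw. apply Rle_trans with (B * (Re w / B)); [apply Rmult_le_compat_r; lra|]. right. field. lra. }
    specialize (X1 hb). rewrite sq.
    assert (y1 := Cmod_fst_le (F q')). assert (y2 := Rle_abs (fst (F q'))). assert (y3 : 0 < Re (F q')) by (apply (tm_pos _ _ HT); auto).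
    assert (A m * Re (F q') <= amax * Re (F q')) by (apply Rmult_le_compat_r; [lra|apply Hmax]).
    assert (amax * Re (F q') <= amax * Cmod (F w')) by (apply Rmult_le_compat_l; unfold Re in *; lra). lra. }
  apply Rle_trans with (amin / (amax * c) * (amax * Cmod (F w'))).
  - apply Rmult_le_compat_l; auto. left. apply Rdiv_lt_0_compat; auto. apply Rmult_lt_0_compat; auto.
  - replace (amin / (amax * c) * (amax * Cmod (F w'))) with (amin * Cmod (F w') / c) by (field; lra).
    apply Rle_div_l; [auto|]. lra.
Qed.

End Main.

(** * Assembly of the hair *)

Theorem theorem5p1 (T0 : Cplx -> Prop) (F : Cplx -> Cplx)
  (HF : Blog_n_translates T0 F)
  (Hslope : forall n : Z, bounded_slope (tract T0 n))
  (Hwig : forall n : Z, bounded_wiggling (tract T0 n) F)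
  (Hgulf : forall n : Z, bounded_gulfs (tract T0 n) F)
  (w0' : Cplx) (Hw : escaping T0 F w0') :
  exists (k : nat) (g : R -> Cplx),
    g 0 = iterF F k w0' /\
    simple_curve_to_infty g /\
    (forall t, t >= 0 -> escaping T0 F (g t)) /\
    uniform_escape F (fun w => exists t, t >= 0 /\ w = g t) /\
    devaney_hair T0 F g /\
    (forall (Mf : R -> R) (Rr : R), M_admissible T0 F Mf Rr ->
       forall t, t > 0 -> fast_escaping T0 F Mf Rr (g t)).
Proof.
  destruct (blog_slope T0 Hslope) as [al [be [hal [hbe Hs]]]].
  destruct (blog_wiggling T0 F HF Hwig) as [K [mu [hK [hmu [_ HW]]]]].
  set (p := tinv (tract T0 0) F (RtoC 0)).
  (* The real part beyond which both the hair construction and the expansion estimate apply; [k] is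
     the time after which the orbit stays there. *)
  set (thr := Rmax (hair_threshold al be K mu) (Rmax (Re p) 1)).
  assert (th1 : hair_threshold al be K mu <= thr) by apply Rmax_l.
  assert (th2 : Rmax (Re p) 1 <= thr) by apply Rmax_r. assert (th3 := Rmax_r (Re p) 1).
  destruct Hw as [HJ Hesc]. destruct (Hesc thr) as [k Hk].
  set (z := fun j => iterF F (j + k) w0').
  assert (Hz : forall j, thr <= Re (z j)) by (intros j; apply Rge_le, Hk; lia).
  destruct (choice (fun j n => closure (tract T0 n) (z j)) (fun j => HJ (j + k)%nat)) as [s Hsz].
  assert (hC3 := shadow_const_pos al be K hal hbe hK). set (C3 := shadow_const al be K) in *.
  destruct (shadowing_curves (fun j => tract T0 (s j)) F z al be K mu) as [X [D [HX [X0 [Xc [D0 [Dz [Dexp Xre]]]]]]]]; auto.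
  { intros j. apply blog_tract; auto. }
  { intros j. apply Hs. }
  { intros j u B hu. destruct (blog_ray T0 F HF Hslope (s j) u B) as [t [ht Ht]]; [lra|]. exists t. split; auto. apply Ht. lra. }
  { intros j. specialize (Hz j). lra. }
  fold C3 in Xre.
  assert (Hit : forall j t, 0 <= t -> iterF F j (X 0%nat t) = X j t).
  { induction j; intros t ht; auto. change (F (iterF F j (X 0%nat t)) = X (S j) t). rewrite IHj by auto. apply HX. auto. }
  assert (Dpos : forall j t, 0 <= t -> 2 ^ j * t <= D j t).
  { intros j t ht. assert (q := Dexp j 0 t (Rle_refl 0) ht). rewrite Dz in q. lra. }
  assert (pw : forall j, 1 <= 2 ^ j) by (intros j; apply pow_R1_Rle; lra).
  assert (Zpos : forall j, 1 <= Re (z j)) by (intros j; specialize (Hz j); lra).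
  assert (Xlow : forall j t, 0 <= t -> Re (z j) * (1 + 2 ^ j * t) / (2 * K) - 2 * C3 <= Re (X j t)).
  { intros j t ht. destruct (Xre j t ht) as [h _]. eapply Rle_trans; [|apply h].
    assert (e := exp_ineq1_le (D j t)). assert (d := Dpos j t ht). assert (zp := Zpos j).
    assert (Re (z j) * (1 + 2 ^ j * t) / (2 * K) <= Re (z j) * exp (D j t) / (2 * K)); [|lra].
    apply Rmult_le_compat_r; [left; apply Rinv_0_lt_compat; lra|]. apply Rmult_le_compat_l; lra. }
  assert (HXJ : forall t, 0 <= t -> inJ T0 F (X 0%nat t)).
  { intros t ht j. rewrite Hit by auto. exists (s j). apply HX. auto. }
  assert (Hunif : uniform_escape F (fun w => exists t, t >= 0 /\ w = X 0%nat t)).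
  { intros B. destruct (Hesc ((Rabs B + 2 * C3) * (2 * K))) as [N HN]. exists N. intros n hn w [t [ht ->]].
    rewrite Hit by lra. assert (l := Xlow n t ltac:(lra)). specialize (HN (n + k)%nat ltac:(lia)). fold (z n) in HN.
    assert (q : Re (z n) / (2 * K) <= Re (z n) * (1 + 2 ^ n * t) / (2 * K)).
    { apply Rmult_le_compat_r; [left; apply Rinv_0_lt_compat; lra|]. specialize (pw n). specialize (Zpos n). assert (0 <= 2 ^ n * t) by (apply Rmult_le_pos; lra). nra. }
    assert (q2 : Rabs B + 2 * C3 <= Re (z n) / (2 * K)).
    { apply Rle_div_r; [lra|]. lra. }
    assert (q3 := Rle_abs B). lra. }
  assert (Hescg : forall t, t >= 0 -> escaping T0 F (X 0%nat t)).
  { intros t ht. split; [apply HXJ; lra|]. intros B. destruct (Hunif B) as [N HN]. exists N. intros n hn. apply HN; auto. exists t. auto. }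
  (* Coincidence at step [n] persists at all later steps [j], while the parameters drift apart by
     [2^j * (t' - t)]. The two-sided bound on [Re (X j)] limits [exp (D j t' - D j t)] to
     [2 * K * (1 + 4 * C3)]. *)
  assert (Hinj : forall n t t', 0 <= t -> t <= t' -> X n t = X n t' -> t = t').
  { intros n t t' ht htt e. destruct htt as [htt|]; auto. exfalso.
    assert (Hm : forall m, X (m + n)%nat t = X (m + n)%nat t').
    { induction m; auto. simpl. rewrite <- (proj2 (HX (m + n)%nat t ht)), <- (proj2 (HX (m + n)%nat t' ltac:(lra))). congruence. }
    set (bd := 2 * K * (1 + 4 * C3)).
    destruct (INR_unbounded (bd / (t' - t))) as [m hm].
    assert (hm2 : bd < INR m * (t' - t)).
    { apply Rlt_div_l in hm; [|lra]. lra. }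
    set (j := (m + n)%nat) in *. assert (hj : INR m <= 2 ^ j).
    { apply Rle_trans with (2 ^ m); [apply pow2_ge_INR|]. apply Rle_pow; [lra|unfold j; lia]. }
    assert (dd := Dexp j t t' ht ltac:(lra)).
    assert (hd : bd < D j t' - D j t) by (assert (INR m * (t' - t) <= 2 ^ j * (t' - t)) by (apply Rmult_le_compat_r; lra); lra).
    destruct (Xre j t ht) as [_ h1]. destruct (Xre j t' ltac:(lra)) as [h2 _].
    assert (e' : X j t = X j t') by (unfold j; apply Hm). rewrite e' in h1.
    set (y := Re (z j) * exp (D j t)) in *.
    assert (hy : 1 <= y). { unfold y. assert (q := Zpos j). assert (q2 := exp_ge_1 (D j t)). assert (q3 := Dpos j t ht). assert (0 <= 2 ^ j * t) by (apply Rmult_le_pos; specialize (pw j); lra). specialize (q2 ltac:(lra)). nra. }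
    assert (ey : Re (z j) * exp (D j t') = y * exp (D j t' - D j t)).
    { unfold y. rewrite Rmult_assoc, <- exp_plus. f_equal. f_equal. ring. }
    rewrite ey in h2. assert (e3 := exp_ineq1_le (D j t' - D j t)).
    assert (h3 : y * exp (D j t' - D j t) / (2 * K) <= y * (1 + 4 * C3)) by nra.
    apply Rmult_le_compat_r with (r := 2 * K) in h3; [|lra].
    unfold Rdiv in h3. rewrite Rmult_assoc, Rinv_l in h3 by lra. unfold bd in hd. nra. }
  assert (Hcont : forall n t, 0 <= t -> forall eps, 0 < eps -> exists eta, 0 < eta /\ forall t', 0 <= t' -> Rabs (t' - t) < eta -> Cmod (X n t' - X n t) < eps).
  { intros n t ht. induction n; intros eps heps; [apply Xc; auto|].
    destruct (HX n t ht) as [c1 c2]. destruct (tm_cont _ _ (blog_tract T0 F HF (s n)) _ c1 eps heps) as [d [hd Hd]].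
    destruct (IHn d hd) as [eta [he He]]. exists eta. split; auto. intros t' ht' h.
    destruct (HX n t' ht') as [c3 c4]. rewrite <- c2, <- c4. apply Hd; auto. }
  assert (Hcurve : forall n, simple_curve_to_infty (fun t => iterF F n (X 0%nat t))).
  { intros n. split; [|split].
    - intros t ht eps heps. destruct (Hcont n t ltac:(lra) eps heps) as [eta [he He]]. exists eta. split; [lra|].
      intros t' ht' h. rewrite !Hit by lra. rewrite Cnorm_Cmod. apply He; auto. lra.
    - intros t t' ht ht' e. rewrite !Hit in e by lra. destruct (Rle_dec t t') as [c|c].
      + apply (Hinj n); auto. lra.
      + symmetry. apply (Hinj n); auto; lra.
    - intros B. exists ((Rabs B + 2 * C3) * (2 * K)). intros t ht. assert (b0 := Rabs_pos B).
      assert (t0 : 0 <= t) by (assert (0 <= (Rabs B + 2 * C3) * (2 * K)) by (apply Rmult_le_pos; lra); lra).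
      rewrite Hit by auto. rewrite Cnorm_Cmod. assert (l := Xlow n t t0).
      assert (q : t / (2 * K) <= Re (z n) * (1 + 2 ^ n * t) / (2 * K)).
      { apply Rmult_le_compat_r; [left; apply Rinv_0_lt_compat; lra|]. specialize (pw n). specialize (Zpos n). assert (t <= 2 ^ n * t) by nra. nra. }
      assert (q2 : Rabs B + 2 * C3 <= t / (2 * K)).
      { apply Rle_div_r; [lra|]. lra. }
      assert (q3 := Rle_abs B). assert (q4 := Cmod_fst_le (X n t)). assert (q5 := Rle_abs (fst (X n t))). unfold Re in l at 2. lra. }
  exists k, (X 0%nat). split; [rewrite X0; reflexivity|]. split; [apply (Hcurve 0%nat)|]. split; [exact Hescg|]. split; [exact Hunif|]. split.
  - split; [intros t ht; apply HXJ; lra|]. split; [intros t ht; apply Hescg; lra|]. split; [|exact Hcurve].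
    intros t ht B. destruct (Hunif B) as [N HN]. exists N. intros n hn w [x [hx ->]]. apply HN; auto. exists x. split; [lra|auto].
  - intros Mf Rr HM t ht. split; [apply HXJ; lra|].
    destruct (fast_step T0 F HF Hslope Hwig Hgulf Mf Rr HM) as [B [eps [hB [heps Hstep]]]].
    destruct (INR_unbounded ((B + 2 * C3) * (2 * K) / t)) as [k0 hk0].
    (* For [t > 0] the parameter of [X j t] is at least [2^j * t], so from some [k0] depending on
       [t] the point is ahead of the orbit by the factor [B] that [fast_step] asks for. *)
    assert (Hahead : forall j, (k0 <= j)%nat -> B * Re (z j) <= Re (X j t)).
    { intros j hj. assert (l := Xlow j t ltac:(lra)). assert (zp := Zpos j).
      assert (h1 : INR k0 <= 2 ^ j).
      { apply Rle_trans with (INR j); [apply le_INR; auto|apply pow2_ge_INR]. }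
      assert (h2 : (B + 2 * C3) * (2 * K) <= 2 ^ j * t).
      { assert (h3 : (B + 2 * C3) * (2 * K) / t <= 2 ^ j) by lra. apply Rle_div_l in h3; [|lra]. lra. }
      assert (h4 : Re (z j) * (B + 2 * C3) <= Re (z j) * (1 + 2 ^ j * t) / (2 * K)).
      { apply Rmult_le_reg_r with (2 * K); [lra|]. replace (Re (z j) * (1 + 2 ^ j * t) / (2 * K) * (2 * K)) with (Re (z j) * (1 + 2 ^ j * t)) by (field; lra).
        rewrite Rmult_assoc. apply Rmult_le_compat_l; lra. }
      assert (2 * C3 <= Re (z j) * (2 * C3)) by nra. lra. }
    (* Since [fast_step] evaluates M at [Re w / B], the recursion closes for the real parts divided
       by [B], with [eps / B] in place of [eps]. *)
    destruct (outgrows_iterates T0 F Mf Rr HF Hslope HM (fun j => Re (X j t) / B) (eps / B) k0) as [L [hL HL]].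
    + apply Rdiv_lt_0_compat; lra.
    + intros b. destruct (Hunif (b * B)) as [N HN]. exists N. intros j hj.
      specialize (HN j hj (X 0%nat t) (ex_intro _ t (conj (Rle_ge _ _ (Rlt_le _ _ ht)) eq_refl))). rewrite Hit in HN by lra.
      apply Rle_div_r; [lra|]. lra.
    + intros j hj hR. assert (a1 := Hahead j hj). assert (a2 := Hahead (S j) ltac:(lia)).
      destruct (HX j t ltac:(lra)) as [c1 c2]. destruct (HX (S j) t ltac:(lra)) as [c3 c4].
      assert (z1 := Zpos (S j)). assert (ez : F (z j) = z (S j)) by reflexivity.
      assert (bz : Re (z (S j)) <= B * Re (z (S j))) by nra.
      assert (st := Hstep (s j) (s (S j)) (z j) (X j t) (Hsz j) c1). rewrite ez, c2 in st.
      specialize (st (Hsz (S j)) c3 ltac:(lra) ltac:(lra)). fold p in st. specialize (st ltac:(specialize (Hz j); lra) a1 ltac:(lra) hR).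
      replace (eps / B * Mf (Re (X j t) / B)) with (eps * Mf (Re (X j t) / B) / B) by (field; lra).
      apply Rmult_le_compat_r; [left; apply Rinv_0_lt_compat; lra|auto].
    + exists L. intros n. rewrite Hit by lra. apply Rle_ge. eapply Rle_trans; [apply HL|].
      assert (a1 := Hahead (n + L)%nat ltac:(lia)). assert (z1 := Zpos (n + L)%nat).
      apply Rmult_le_reg_r with B; [lra|]. unfold Rdiv. rewrite Rmult_assoc, Rinv_l by lra.
      assert (0 < Re (X (n + L)%nat t)) by nra. rewrite Rmult_1_r. cbv beta. nra.
Qed.
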